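(* Let $G$ be a cyclically 3-edge-connected cubic graph which is not a Klee-graph. Then, for any edge $e\in E(G)$ and any collection $\mathcal{C}$ of pairwise vertex-disjoint circuits of $G$, there exists a perfect matching $M$ of $G$ with $e\in M$ such that every circuit in $\mathcal{C}$ contains an edge of $M$.
   Context: Graphs are simple (no loops or parallel edges). A circuit is a 2-regular connected subgraph. For a partition $(V_1,V_2)$ of $V(G)$, the edge-cut $E(V_1,V_2)$ is the set of edges with one end in $V_1$ and the other in $V_2$; it is cyclic if both $G[V_1]$ and $G[V_2]$ contain a circuit. The cyclic edge-connectivity of $G$ is the smallest size of a cyclic edge-cut if one exists, and $|E(G)|-|V(G)|+1$ otherwise; $G$ is cyclically 3-edge-connected if its cyclic edge-connectivity is at least 3. Expanding a vertex $v$ with neighbours $a,b,c$ into a triangle means deleting $v$ and adding three new mutually adjacent vertices $a',b',c'$ with new edges $aa',bb',cc'$. A Klee-graph is either the complete graph $K_4$ or a graph obtained from a Klee-graph by expanding a vertex into a triangle. *)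

(* Defs.v *)
From mathcomp Require Import all_boot all_algebra.

Set Implicit Arguments.
Unset Strict Implicit.
Unset Printing Implicit Defensive.

Record sgraph := SGraph {
  svertex :> finType;
  adj : rel svertex;
  adj_sym : symmetric adj;
  adj_irrefl : irreflexive adj }.

Definition isomorphic (G H : sgraph) : Prop :=
  exists2 f : G -> H, bijective f & forall x y, adj (f x) (f y) = adj x y.

Section Graph.
Variable G : sgraph.

(* An edge is identified with the set of its two ends. *)
Definition edges : {set {set G}} :=
  [set f | [exists x, exists y, adj x y && (f == [set x; y])]].

Definition cubic : Prop := forall x : G, #|[set y | adj x y]| = 3.

Definition edge_degree (F : {set {set G}}) (x : G) : nat :=
  #|[set f in F | x \in f]|.

(* A subgraph is presented as the pair of its vertex set and its edge set. *)
Implicit Types (H : {set G} * {set {set G}}) (A B : {set G}) (F M : {set {set G}}).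

Definition subgraph H : bool :=
  (H.2 \subset edges) && [forall f in H.2, f \subset H.1].

Definition two_regular H : bool :=
  [forall x in H.1, edge_degree H.2 x == 2].

Definition connected H : bool :=
  (H.1 != set0) &&
  [forall x in H.1, forall y in H.1,
     connect [rel u v | [set u; v] \in H.2] x y].

Definition circuit H : bool := [&& subgraph H, two_regular H & connected H].

(* The circuits of the induced subgraph G[A] are the circuits of G all of
   whose vertices lie in A. *)
Definition has_circuit A : bool :=
  [exists H : {set G} * {set {set G}}, circuit H && (H.1 \subset A)].

Definition edge_cut A B : {set {set G}} :=
  [set f in edges | [exists x in A, exists y in B, f == [set x; y]]].

Definition cut_size A : nat := #|edge_cut A (~: A)|.

(* A stands for the partition (A, ~: A) of the vertex set. *)
Definition cyclic_cut A : bool := has_circuit A && has_circuit (~: A).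

(* The value is an integer because |E| - |V| + 1 is negative for a forest with
   at least two components. *)
Definition cyclic_edge_connectivity : int :=
  if [pick A | cyclic_cut A] is Some A0 then
    (cut_size [arg min_(A < A0 | cyclic_cut A) cut_size A])%:Z
  else (#|edges|%:Z - #|G|%:Z + 1)%R.

Definition cyclically_edge_connected (k : nat) : Prop :=
  (k%:Z <= cyclic_edge_connectivity)%R.

Definition perfect_matching M : Prop :=
  M \subset edges /\ forall x : G, edge_degree M x = 1.

End Graph.

Section Complete.
Variable n : nat.

Definition complete_adj : rel 'I_n := fun x y => x != y.

Fact complete_adj_sym : symmetric complete_adj.
Proof. by move=> x y; rewrite /complete_adj eq_sym. Qed.

Fact complete_adj_irrefl : irreflexive complete_adj.
Proof. by move=> x; rewrite /complete_adj eqxx. Qed.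

Definition complete : sgraph := SGraph complete_adj_sym complete_adj_irrefl.

End Complete.

Section Expansion.
Variables (G : sgraph) (v : G).

(* [inl x] is the old vertex x, and [inr a] is the new vertex a' attached to
   the neighbour a of v. *)
Definition expand_vertex : finType :=
  ({x : G | x != v} + {a : G | adj v a})%type.

Definition expand_adj : rel expand_vertex := fun p q =>
  match p, q with
  | inl x, inl y => adj (val x) (val y)
  | inl x, inr a => val x == val a
  | inr a, inl x => val x == val a
  | inr a, inr b => a != b
  end.

Fact expand_adj_sym : symmetric expand_adj.
Proof.
by move=> [x|a] [y|b]; rewrite /expand_adj //; [exact: adj_sym | rewrite eq_sym].
Qed.

Fact expand_adj_irrefl : irreflexive expand_adj.
Proof. by move=> [x|a] /=; [exact: adj_irrefl | rewrite eqxx]. Qed.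

Definition expand : sgraph := SGraph expand_adj_sym expand_adj_irrefl.

End Expansion.

(* The class is closed under isomorphism.  Since it starts from K_4, every
   expanded vertex has exactly three neighbours. *)
Inductive klee : sgraph -> Prop :=
  | klee_K4 (G : sgraph) : isomorphic G (complete 4) -> klee G
  | klee_expand (H G : sgraph) (v : H) : klee H -> isomorphic G (expand v) -> klee G.

(* Main.v *)
Require Import Defs.
From mathcomp Require Import all_boot all_algebra.
From mathcomp Require Import zify.

Set Implicit Arguments.
Unset Strict Implicit.
Unset Printing Implicit Defensive.

(** The circuits may as well be assumed not to be Hamiltonian: under this
    assumption the conclusion holds for every 3-edge-connected cubic graph, Klee
    or not, and that is proved by induction on the number of vertices.  A
    nontrivial 3-edge-cut or 4-edge-cut splits the graph into two smaller
    graphs, obtained by replacing a side by one vertex or by two adjacent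
    vertices; a circuit crossing the cut is prescribed, closed up, in a side
    that it does not cover, and matchings of the two sides that agree on the cut
    are glued.  Without such cuts the girth is at least 5, and near an end of e
    one deletes two adjacent vertices, or a path of four, and joins the vertices
    left with degree 2.  If some circuit is Hamiltonian it is the only one, and
    a perfect matching that misses it sends every vertex to its third
    neighbour.  Hence if the circuit cannot be hit, e lies in exactly one
    perfect matching.  By Kotzig's theorem, a graph with exactly one perfect
    matching has a bridge belonging to it; applied inside 3-edge-cuts, this
    yields a triangle avoiding both ends of e, and contracting it shows by
    induction that the graph is a Klee-graph. *)

(** * Edge cuts of cubic graphs *)

(** The induction needs every prescribed circuit to miss a vertex, and this must survive the passage
    to a side of a cut. A circuit whose run covers one side is therefore closed up on the other
    side, where it misses a vertex of the original graph. The main obstacle is a 4-edge-cut, because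
    both sides must use the same cut edges. The two adjacent vertices that replace a side admit
    either no cut edge or one from each of the two pairs attached to them. Four edges can be paired
    in three ways, and prescribing an edge from a replacing vertex to a cut edge leaves two
    outcomes. Enough pairings are imposed on one side for every answer of the other side to find its
    counterpart. In the local reductions e is prescribed, so the new edge at an end of e is never in
    the matching; in most cases the lifted matching then contains one of two consecutive edges of
    the circuit to be hit. In the unique-matching argument, Kotzig's bridge splits a set of cut 3,
    less one vertex, into two sets of cut 3; this descent ends in a triangle. *)

Section Cuts.
Variable T : finType.
Implicit Types (V W X Y Z : {set T}) (r : rel T) (L : seq (T * T)) (x y z : T).

(* A graph is a vertex set V together with a relation r on a fixed ambient type,
   so that deleting vertices and adding edges does not change the type. *)
Definition en r X Y : nat := \sum_(x in X) \sum_(y in Y) r x y.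
Definition cut r X : nat := en r X (~: X).

Record cgraph V r : Prop := CGraph {
  csym : symmetric r;
  cirr : irreflexive r;
  csup : forall x y, r x y -> x \in V;
  cdeg : forall x, x \in V -> \sum_y r x y = 3 }.

(** Three-edge-connectedness. It includes connectedness, since a component has an empty cut. *)
Definition tec V r : Prop :=
  forall X, X \subset V -> X != set0 -> X != V -> 3 <= cut r X.

Lemma en_sym r X Y : symmetric r -> en r X Y = en r Y X.
Proof.
move=> rs; rewrite /en exchange_big /=.
by apply: eq_bigr => y _; apply: eq_bigr => x _; rewrite rs.
Qed.

Lemma en_splitl Z r X Y : en r X Y = en r (X :&: Z) Y + en r (X :\: Z) Y.
Proof. exact: big_setID. Qed.

Lemma en_splitr Z r X Y : en r X Y = en r X (Y :&: Z) + en r X (Y :\: Z).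
Proof. by rewrite /en -big_split; apply: eq_bigr => x _; exact: big_setID. Qed.

Lemma en1r r X y : en r X [set y] = \sum_(x in X) r x y.
Proof. by apply: eq_bigr => x _; rewrite big_set1. Qed.

Lemma en0r r X : en r X set0 = 0.
Proof. by rewrite /en big1 // => x _; rewrite big_set0. Qed.

Lemma en0l r X : en r set0 X = 0.
Proof. by rewrite /en big_set0. Qed.

Section Graph.
Variables (V : {set T}) (r : rel T).
Hypothesis G : cgraph V r.

Lemma csupr x y : r x y -> y \in V.
Proof. by rewrite (csym G) => /(csup G). Qed.

Lemma cneq x y : r x y -> x != y.
Proof. by apply: contraTneq => ->; rewrite (cirr G). Qed.

Lemma cnbr x : x \in V -> exists a b c,
  uniq [:: a; b; c] /\ forall y, r x y = (y \in [:: a; b; c]).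
Proof.
move=> xV; have := cdeg G xV; rewrite -big_mkcond /= sum1_card.
move=> h; have := enum_uniq (r x); have: size (enum (r x)) = 3 by rewrite -cardE.
move: (mem_enum (r x)).
case: (enum _) => [|a [|b [|c [|]]]] //= E _ u; exists a, b, c; split=> [//|y]; by rewrite E.
Qed.

Lemma cnbr1 x a : r x a -> exists b c,
  uniq [:: a; b; c] /\ forall y, r x y = (y \in [:: a; b; c]).
Proof.
move=> xa; have [p [q [s [u E]]]] := cnbr (csup G xa).
move: u; rewrite /= !inE !negb_or => u.
move: xa; rewrite E !inE => /or3P[] /eqP ->.
- by exists q, s; split; [rewrite /= !inE !negb_or | move=> y; rewrite E !inE].
- exists p, s; split; first by rewrite /= !inE !negb_or ![_ == p]eq_sym; lia.
  by move=> y; rewrite E !inE; case: (y == p); case: (y == q).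
exists p, q; split; first by rewrite /= !inE !negb_or ![s == _]eq_sym; lia.
by move=> y; rewrite E !inE; case: (y == p); case: (y == q); case: (y == s).
Qed.

Lemma cnbr2 x a b : r x a -> r x b -> a != b -> exists c,
  uniq [:: a; b; c] /\ forall y, r x y = (y \in [:: a; b; c]).
Proof.
move=> xa xb ab; have [p [q [u E]]] := cnbr1 xa.
move: xb; rewrite E !inE eq_sym (negbTE ab) /= => /orP[]/eqP eb; subst b.
  by exists q.
exists p; split; last by move=> y; rewrite E !inE; case: (y == p); case: (y == q); rewrite ?orbT.
by move: u; rewrite /= !inE !negb_or [q == _]eq_sym; lia.
Qed.

Lemma en_degC x Y : x \in V ->
  (\sum_(y in Y) r x y) + \sum_(y in ~: Y) r x y = 3.
Proof.
move=> xV; rewrite -(cdeg G xV) [RHS](bigID (mem Y)) /=.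
by congr (_ + _); apply: eq_bigl => y; rewrite ?inE.
Qed.

Lemma en_sup X Y : en r X Y = en r X (Y :&: V).
Proof.
rewrite (en_splitr V) [X in _ + X]big1 ?addn0 // => x _; rewrite big1 // => y.
rewrite inE => /andP[yV _]; case rxy: (r x y) => //.
by rewrite (csupr rxy) in yV.
Qed.

Lemma cutE X : cut r X = en r X (V :\: X).
Proof.
by rewrite /cut en_sup; congr en; apply/setP=> y; rewrite !inE.
Qed.

Lemma cutC X : X \subset V -> cut r (V :\: X) = cut r X.
Proof.
move=> sX; rewrite !cutE (en_sym _ _ (csym G)); congr en.
by rewrite setDDr setDv set0U; apply/setIidPr.
Qed.

Lemma en_deg X : X \subset V -> en r X X + cut r X = 3 * #|X|.
Proof.
move=> /subsetP sX; rewrite /cut /en -big_split /= mulnC -sum_nat_const.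
by apply: eq_bigr => x /sX xV; rewrite en_degC.
Qed.

(** When [x] joins [X], its edges into [X] leave the cut and the others of its three edges enter
    it. *)
Lemma cutU1 X x : x \in V -> x \notin X ->
  cut r (x |: X) + 2 * (\sum_(y in X) r x y) = cut r X + 3.
Proof.
move=> xV xX; rewrite /cut.
have -> : en r (x |: X) (~: (x |: X)) =
    \sum_(y in ~: (x |: X)) r x y + en r X (~: (x |: X)).
  by rewrite /en big_setU1.
have := en_degC (x |: X) xV; rewrite (big_setU1 _ xX) /= (cirr G) add0n => E1.
have -> : en r X (~: X) = en r X [set x] + en r X (~: (x |: X)).
  rewrite (en_splitr [set x]); congr (_ + _); congr en; apply/setP=> y; rewrite !inE.
    by case: eqP => [->|]; rewrite ?andbF // xX.
  by rewrite negb_or.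
rewrite en1r; under [in RHS]eq_bigr => y _ do rewrite (csym G).
lia.
Qed.

Lemma cutD1 X x : x \in V -> x \in X ->
  cut r (X :\ x) + 3 = cut r X + 2 * (\sum_(y in X) r x y).
Proof.
move=> xV xX; have := @cutU1 (X :\ x) x xV; rewrite setD1K // !inE eqxx => /(_ isT) <-.
by rewrite (big_setD1 x xX) /= (cirr G).
Qed.

(** By [cutD1], the removal of one vertex changes the parity of the cut. *)
Lemma odd_cut X : X \subset V -> odd (cut r X) = odd #|X|.
Proof.
have [n] := ubnP #|X|; elim: n X => // n IH X le sX.
have [->|[x xX]] := set_0Vmem X; first by rewrite cards0 /cut en0l.
have xV := subsetP sX x xX.
have := cutD1 xV xX; have := IH (X :\ x); have := cardsD1 x X; rewrite xX.
move=> E /(_ _ (subset_trans (subD1set _ _) sX)) IH' Ec; have {}IH' := IH' ltac:(lia).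
lia.
Qed.

Lemma cut_set2 x y : x \in V -> y \in V -> x != y ->
  cut r [set x; y] = 6 - 2 * r x y.
Proof.
move=> xV yV xy; have := @cutU1 [set y] x xV; rewrite inE xy => /(_ isT).
rewrite big_set1; have := @cutU1 set0 y yV; rewrite inE big_set0 setU0 /cut en0l => /(_ isT).
by move: (en _ _ _) (en _ _ _) => a b; case: (r x y); lia.
Qed.

End Graph.

(** All reductions have this form: the vertices outside [W] are deleted, and the edges of [L]
    restore the degrees. An edge of [L] may also end at a replacing vertex outside [W]. *)
Definition nrel r W L : rel T :=
  fun x y => [|| [&& x \in W, y \in W & r x y], (x, y) \in L | (y, x) \in L].

(** That [L] and its reversal together have no repetition excludes loops, repeated new edges and a
    new edge listed in both directions. The graph stays simple, and its new edges can be counted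
    along [L]. *)
Definition new_edges r W V L : bool :=
  uniq (L ++ [seq (l.2, l.1) | l <- L]) &&
  all (fun l => [&& l.1 \in V, l.2 \in V & ~~ [&& l.1 \in W, l.2 \in W & r l.1 l.2]]) L.

Definition inc L x : nat := \sum_(l <- L) ((x == l.1) + (x == l.2)).

Section NewGraph.
Variables (V : {set T}) (r : rel T).
Hypothesis G : cgraph V r.
Variables (W V' : {set T}) (L : seq (T * T)).
Hypothesis sW : W \subset V.
Hypothesis sWV' : W \subset V'.
Hypothesis L_new : new_edges r W V' L.

Lemma new_uniq : uniq L.
Proof. by case/andP: L_new; rewrite cat_uniq => /andP[]. Qed.

Lemma new_asym x y : (x, y) \in L -> (y, x) \in L -> false.
Proof.
case/andP: L_new; rewrite cat_uniq => /and3P[_ /hasPn h _] _ xy yx.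
have /h : (x, y) \in [seq (l.2, l.1) | l <- L] by apply/mapP; exists (y, x).
by rewrite /= xy.
Qed.

Lemma new_notr x y : ((x, y) \in L) || ((y, x) \in L) ->
  x \in W -> y \in W -> ~~ r x y.
Proof.
case/andP: L_new => _ /allP h /orP[] /h /and3P[/= _ _ H] xW yW; move: H.
  by rewrite xW yW.
by rewrite xW yW (csym G).
Qed.

Lemma new_mem x y : ((x, y) \in L) || ((y, x) \in L) -> x \in V'.
Proof. by case/andP: L_new => _ /allP h /orP[] /h /and3P[]. Qed.

Lemma nrel_sumE x y : (nrel r W L x y : nat) =
  [&& x \in W, y \in W & r x y] + (((x, y) \in L) + ((y, x) \in L)).
Proof.
rewrite /nrel; have := @new_notr x y; have := @new_asym x y.
case: (x \in W); case: (y \in W); case: (r x y); case: (_ \in L); case: (_ \in L) => //= h1 h2;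
  by [have:= h1 isT isT | have:= h2 isT isT isT].
Qed.

Lemma nrel_sym : symmetric (nrel r W L).
Proof.
by move=> x y; rewrite /nrel (csym G) andbCA [((x,y) \in L) || _]orbC.
Qed.

Lemma nrel_irr : irreflexive (nrel r W L).
Proof.
move=> x; rewrite /nrel (cirr G) !andbF /= orbb; apply/negP => h.
by have := new_asym h h.
Qed.

Lemma nrel_sup x y : nrel r W L x y -> x \in V'.
Proof.
case/orP => [/and3P[/(subsetP sWV')]//|]; exact: new_mem.
Qed.

Lemma mem_sumL x y : ((x, y) \in L : nat) = \sum_(l <- L) ((x == l.1) && (y == l.2)).
Proof.
rewrite -(count_uniq_mem _ new_uniq) -sum1_count [LHS]big_mkcond /=.
by apply: eq_bigr => -[a b] _; rewrite /= xpair_eqE [a == _]eq_sym [b == _]eq_sym.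
Qed.

Lemma nrel_deg x : \sum_y nrel r W L x y =
  (if x \in W then \sum_(y in W) r x y else 0) + inc L x.
Proof.
under eq_bigr => y _ do rewrite nrel_sumE.
rewrite big_split /=; congr (_ + _).
  case: (x \in W); last by rewrite big1.
  by rewrite [RHS]big_mkcond; apply: eq_bigr => y _; case: (y \in W).
rewrite /inc; under eq_bigr => y _ do rewrite !mem_sumL -big_split /=.
rewrite exchange_big /=; apply: eq_bigr => -[a b] _ /=.
rewrite big_split /=; congr (_ + _).
  by rewrite (bigD1 b) //= eqxx andbT big1 ?addn0 // => y /negbTE->; rewrite andbF.
by rewrite (bigD1 a) //= eqxx big1 ?addn0 // => y /negbTE->.
Qed.

(** A kept vertex gets as many new edges as it lost old ones; a vertex of [V'] outside [W] has new
    edges only. *)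
Lemma new_cgraph :
  (forall x, x \in W -> \sum_(y in ~: W) r x y = inc L x) ->
  (forall x, x \in V' -> x \notin W -> inc L x = 3) ->
  cgraph V' (nrel r W L).
Proof.
move=> hW hN; split; [exact: nrel_sym | exact: nrel_irr | exact: nrel_sup|].
move=> x xV'; rewrite nrel_deg; case: ifP => xW; last by rewrite hN // xW.
by rewrite -hW // (en_degC G) // (subsetP sW).
Qed.

Lemma nrel_cut X : cut (nrel r W L) X =
  en r (X :&: W) (W :\: X) + \sum_(l <- L) ((l.1 \in X) (+) (l.2 \in X)).
Proof.
rewrite /cut /en.
under eq_bigr => x _ do under eq_bigr => y _ do rewrite nrel_sumE.
under eq_bigr => x _ do rewrite big_split /=.
rewrite big_split /=; congr (_ + _).
  rewrite [LHS]big_mkcond [RHS]big_mkcond /=; apply: eq_bigr => x _.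
  rewrite inE; case: (x \in X) => //=; case: (x \in W) => /=; last by rewrite big1.
  rewrite [LHS]big_mkcond [RHS]big_mkcond /=; apply: eq_bigr => y _.
  by rewrite !inE; case: (y \in X); case: (y \in W).
have E (l : T * T) : ((l.1 \in X) (+) (l.2 \in X) : nat) =
  \sum_(x in X) \sum_(y in ~: X) ((x == l.1) && (y == l.2) + ((y == l.1) && (x == l.2))).
  have F a b : \sum_(x in X) \sum_(y in ~: X) ((x == a) && (y == b)) = ((a \in X) && (b \notin X)).
    case aX: (a \in X) => /=; last first.
      rewrite big1 // => x xX; rewrite big1 // => y _.
      by case: (x =P a) => // xa; rewrite -xa xX in aX.
    rewrite (bigD1 a) //= [X in _ + X]big1 ?addn0; last first.
      by move=> x /andP[_ /negbTE->]; rewrite big1.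
    case bX: (b \in X) => /=.
      by rewrite big1 // => y; rewrite inE; case: (y =P b) => [->|]; rewrite ?bX ?andbF.
    rewrite (bigD1 b) ?inE ?bX //= !eqxx big1 // => y /andP[_ /negbTE->].
    by rewrite andbF.
  under eq_bigr => x _ do rewrite big_split /=.
  rewrite big_split /= F; under [X in _ + X]eq_bigr => x _ do
    under eq_bigr => y _ do rewrite andbC.
  by rewrite F; case: (_ \in X); case: (_ \in X).
rewrite [RHS](eq_bigr _ (fun l _ => E l)) [RHS]exchange_big /=; apply: eq_bigr => x _.
rewrite [RHS]exchange_big /=; apply: eq_bigr => y _.
by rewrite !mem_sumL -big_split.
Qed.

Hypothesis hW : forall x, x \in W -> \sum_(y in ~: W) r x y = inc L x.

Lemma sum_inc X : \sum_(x in X) inc L x = \sum_(l <- L) ((l.1 \in X) + (l.2 \in X)).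
Proof.
rewrite /inc exchange_big /=; apply: eq_bigr => -[a b] _ /=.
have F c : \sum_(x in X) (x == c) = (c \in X).
  case cX: (c \in X); last by rewrite big1 // => x xX; case: (x =P c) => // xc; rewrite -xc xX in cX.
  by rewrite (bigD1 c) //= eqxx big1 // => x /andP[_ /negbTE->].
by rewrite big_split /= !F.
Qed.

(** By [hW], the edges from [X] out of [W] are as many as the ends of new edges in [X]. So a new
    edge inside [X] counts twice here and not at all in [nrel_cut], while one with a single end in
    [X] counts once in both. *)
Lemma old_cut X : X \subset W -> cut r X =
  en r X (W :\: X) + \sum_(l <- L) ((l.1 \in X) + (l.2 \in X)).
Proof.
move=> sX; rewrite /cut (en_splitr W); congr (_ + _).
  by congr en; apply/setP => y; rewrite !inE.
rewrite -sum_inc /en; apply: eq_bigr => x xX.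
rewrite -hW ?(subsetP sX) //; apply: eq_bigl => y; rewrite !inE.
by case yW: (y \in W) => //=; apply: contraFN yW => /(subsetP sX).
Qed.

End NewGraph.
End Cuts.

(** * Perfect matchings and circuits *)

Section Matchings.
Variable T : finType.
Implicit Types (V W R X Y Z : {set T}) (r : rel T) (L : seq (T * T)) (x y z u v : T).
Implicit Types (m : T -> T) (c p q s : seq T) (CC : seq (seq T)).

Definition pm V r m : Prop := forall x, x \in V -> r x (m x) /\ m (m x) = x.

(* A circuit is the list of its vertices in cyclic order. *)
Definition circ r c : bool := [&& uniq c, cycle r c & 2 < size c].

(** A circuit is missed when [off m] holds at all its consecutive pairs, so that [hit] is the
    failure of a [cycle] and an arc is treated in the same way with [path]. *)
Definition off m : rel T := fun x y => m x != y.
Definition hit m c : bool := ~~ cycle (off m) c.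

Definition family r CC : Prop :=
  {in CC, forall c, circ r c} /\
  (forall c d x, c \in CC -> d \in CC -> x \in c -> x \in d -> c = d).

(* Klee-graphs are allowed here; Hamiltonian circuits are not. *)
Definition hits_all V r : Prop := forall u v CC, r u v -> family r CC ->
  {in CC, forall c, exists2 x, x \in V & x \notin c} ->
  exists m, [/\ pm V r m, m u = v & {in CC, forall c, hit m c}].

(* [m] matches the vertices of W among themselves, except those of [outs], which
   are to be matched across the cut. *)
Definition side W r m (outs : seq T) : Prop := forall x, x \in W -> x \notin outs ->
  [/\ m x \in W, m x \notin outs, r x (m x) & m (m x) = x].

Lemma pm_inj V r m x y : pm V r m -> x \in V -> y \in V -> m x = m y -> x = y.
Proof. by move=> pmm xV yV e; rewrite -(pmm x xV).2 e (pmm y yV).2. Qed.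

Lemma pm_eq V r m x y : pm V r m -> x \in V -> m x = y -> m y = x.
Proof. by move=> pmm xV <-; case: (pmm x xV). Qed.

Lemma glue V r W m1 m2 (ps : seq (T * T)) : cgraph V r -> W \subset V ->
  side W r m1 (unzip1 ps) -> side (V :\: W) r m2 (unzip2 ps) ->
  uniq (unzip1 ps) -> uniq (unzip2 ps) ->
  all (fun p : T * T => [&& p.1 \in W, p.2 \notin W & r p.1 p.2]) ps ->
  exists m, [/\ pm V r m,
    forall x, x \in W -> x \notin unzip1 ps -> m x = m1 x,
    forall x, x \in V :\: W -> x \notin unzip2 ps -> m x = m2 x &
    forall p : T * T, p \in ps -> m p.1 = p.2 /\ m p.2 = p.1].
Proof.
move=> G sW s1 s2 u1 u2 /allP al.
(* The mate of an end of a used cut edge stands at the same position in the list of the opposite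
   ends. *)
pose m x := if x \in unzip1 ps then nth x (unzip2 ps) (index x (unzip1 ps))
  else if x \in unzip2 ps then nth x (unzip1 ps) (index x (unzip2 ps))
  else if x \in W then m1 x else m2 x.
have z1W x : x \in unzip1 ps -> x \in W by case/mapP => p /al /and3P[h _ _] ->.
have z2W x : x \in unzip2 ps -> x \notin W by case/mapP => p /al /and3P[_ h _] ->.
have E (p : T * T) : p \in ps -> m p.1 = p.2 /\ m p.2 = p.1.
  move=> pin; have i1 : p.1 \in unzip1 ps by apply: map_f.
  have i2 : p.2 \in unzip2 ps by apply: map_f.
  have n1 : p.2 \in unzip1 ps = false by apply/negP => /z1W; apply/negP/z2W.
  have lt : index p ps < size ps by rewrite index_mem.
  have e1 : index p.1 (unzip1 ps) = index p ps.
    have := index_uniq p.1 _ u1; rewrite size_map => /(_ _ lt).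
    by rewrite (nth_map p) // nth_index.
  have e2 : index p.2 (unzip2 ps) = index p ps.
    have := index_uniq p.2 _ u2; rewrite size_map => /(_ _ lt).
    by rewrite (nth_map p) // nth_index.
  by rewrite /m i1 n1 i2 e1 e2 !(nth_map p) // nth_index.
have M1 x : x \in W -> x \notin unzip1 ps -> m x = m1 x.
  move=> xW /negbTE n1; rewrite /m n1 ifF ?xW //.
  by apply/negP => /z2W; rewrite xW.
have M2 x : x \in V :\: W -> x \notin unzip2 ps -> m x = m2 x.
  rewrite inE => /andP[xW _] /negbTE n2; rewrite /m n2 ifF ?(negbTE xW) //.
  by apply: contraNF xW => /z1W.
clearbody m; exists m; split => // x xV.
case: (boolP (x \in unzip1 ps)) => [/mapP[p pin ->]|n1].
  by case: (E p pin) => e1 e2; rewrite e1 e2; split => //; case/and3P: (al p pin).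
case: (boolP (x \in unzip2 ps)) => [/mapP[p pin ->]|n2].
  by case: (E p pin) => e1 e2; rewrite e2 e1; split => //; rewrite (csym G); case/and3P: (al p pin).
case: (boolP (x \in W)) => xW.
  by have [a b cc d] := s1 x xW n1; rewrite (M1 x) // (M1 (m1 x)).
have xD : x \in V :\: W by rewrite inE xW.
by have [a b cc d] := s2 x xD n2; rewrite (M2 x) // (M2 (m2 x)).
Qed.

(** When the new edges are deleted again, the ends of those used by [m] are the vertices left
    without a mate. *)
Definition outsL L m : seq T := flatten [seq [:: l.1; l.2] | l <- L & m l.1 == l.2].

Section NewPm.
Variables (V : {set T}) (r : rel T).
Hypothesis G : cgraph V r.
Variables (W V' : {set T}) (L : seq (T * T)).
Hypothesis sWV' : W \subset V'.
Hypothesis L_new : new_edges r W V' L.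
Variable m : T -> T.
Hypothesis pmm : pm V' (nrel r W L) m.

Lemma usedE x : x \in V' ->
  (((x, m x) \in L) || ((m x, x) \in L)) = (x \in outsL L m).
Proof.
move=> xV; apply/orP/flattenP => [[] h|[s /mapP[l]]].
- exists [:: x; m x]; last by rewrite !inE eqxx.
  by apply/mapP; exists (x, m x) => //; rewrite mem_filter /= eqxx.
- exists [:: m x; x]; last by rewrite !inE eqxx orbT.
  by apply/mapP; exists (m x, x) => //; rewrite mem_filter /= (pmm xV).2 eqxx.
rewrite mem_filter => /andP[/eqP e lL] ->; rewrite !inE => /orP[]/eqP ->.
  by left; rewrite e -surjective_pairing.
have l1 : l.1 \in V' by apply: (@new_mem _ _ _ _ _ L_new _ l.2); rewrite -surjective_pairing lL.
by right; rewrite -e (pmm l1).2 e -surjective_pairing.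
Qed.

Lemma side_new outs : {in W, outs =i outsL L m} -> side W r m outs.
Proof.
move=> E x xW; have xV := subsetP sWV' x xW; rewrite E // -usedE // => nu.
have [] := pmm xV; rewrite /nrel => /orP[/and3P[_ mW rx] mm|]; last by rewrite (negbTE nu).
split => //; rewrite E // -usedE ?(subsetP sWV') // mm.
by rewrite orbC.
Qed.

Section Transfer.
Variables (M : T -> T) (outs : seq T).
Hypothesis E : {in W, outs =i outsL L m}.
Hypothesis eM : forall x, x \in W -> x \notin outs -> M x = m x.

(** An old edge inside [W] is not parallel to a new one. If [m] matches its ends, neither of them is
    an end of a used new edge, so [M] matches them as well. *)
Lemma off_new x y : x \in W -> y \in W -> r x y && off M x y -> off m x y.
Proof.
move=> xW yW /andP[rxy]; apply: contra => /eqP mxy.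
rewrite eM ?mxy // E // -usedE ?(subsetP sWV') // mxy.
by apply/negP => /(new_notr G L_new) /(_ xW yW); rewrite rxy.
Qed.

Lemma hit_new c : all [in W] c -> cycle r c -> hit m c -> hit M c.
Proof.
move=> cW rc; apply: contra => oc.
have: cycle [rel x y | r x y && off M x y] c by rewrite cycle_relI rc.
by apply: sub_in_cycle cW => x y; exact: off_new.
Qed.

Lemma phit_new x p : all [in W] (x :: p) -> path r x p ->
  ~~ path (off m) x p -> ~~ path (off M) x p.
Proof.
move=> cW rc; apply: contra => oc.
have: path [rel x y | r x y && off M x y] x p by rewrite path_relI rc.
by apply: (@sub_in_path _ [in W]) => // a b; exact: off_new.
Qed.

End Transfer.
End NewPm.

Lemma hit_rot m i c : hit m (rot i c) = hit m c.
Proof. by rewrite /hit rot_cycle. Qed.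

Lemma circ_rot r i c : circ r (rot i c) = circ r c.
Proof. by rewrite /circ rot_uniq rot_cycle size_rot. Qed.

Lemma hit_rev V r m c : pm V r m -> {subset c <= V} -> hit m (rev c) = hit m c.
Proof.
move=> pmm cV; rewrite /hit rev_cycle; congr negb.
apply: (@eq_in_cycle _ [in V]); last by apply/allP.
move=> x y xV yV; rewrite /off; congr negb; apply/eqP/eqP => e.
  exact: pm_eq pmm _ e.
exact: pm_eq pmm _ e.
Qed.

Lemma circ_rev V r c : cgraph V r -> circ r (rev c) = circ r c.
Proof.
move=> G; rewrite /circ rev_uniq size_rev rev_cycle.
by congr [&& _, _ & _]; apply: eq_cycle => x y; rewrite (csym G).
Qed.

Lemma cycle_cat2 (e : rel T) x p y q : cycle e ((x :: p) ++ (y :: q)) =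
  [&& path e x p, e (last x p) y, path e y q & e (last y q) x].
Proof.
by rewrite /= rcons_cat cat_path /= rcons_path !andbA.
Qed.

Lemma circ_sub r c V : cgraph V r -> circ r c -> {subset c <= V}.
Proof.
move=> G /and3P[uc cc _] x xc; exact: csup (next_cycle cc xc).
Qed.

(** The rotation starts with a maximal run outside [A]. What follows begins and ends in [A], but it
    may leave [A] again in between. *)
Lemma circ_run r c (A : {pred T}) : circ r c -> has [in A] c -> ~~ all [in A] c ->
  exists i x p y q, [/\ rot i c = (x :: p) ++ (y :: q), all [predC A] (x :: p),
    y \in A & last y q \in A].
Proof.
move=> cc /hasP[x0 x0c x0A] nA.
have [i s E] := rot_to x0c.
have hs : has [predC A] s.
  move: nA; rewrite -has_predC -(has_rot i) E /=; by rewrite x0A.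
case: (split_find hs) E => x s1 s2 xA hs1 E.
have {}hs1 : all [in A] s1.
  by move: hs1; rewrite has_predC negbK.
have [p [q [Ex pB qA]]] : exists p q, [/\ s2 ++ x0 :: s1 = p ++ q, all [predC A] p &
    (if q is y :: _ then y \in A else false)].
  elim: s2 {E} => [|z s2 [p [q [e pB qA]]]] /=.
    by exists [::], (x0 :: s1).
  rewrite e; case zA: (z \in A); first by exists [::], (z :: p ++ q).
  by exists (z :: p), q; split => //=; rewrite zA.
case: q qA Ex => // y q yA Ex.
have : rot (size (x0 :: s1)) (rot i c) = (x :: p) ++ y :: q.
  by rewrite E cat_rcons -cat_cons rot_size_cat /= Ex.
rewrite rot_rot_add; move: (rot_add _ _ _) => j Ej; exists j, x, p, y, q; split => //=; first by rewrite (xA : x \notin A).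
have := congr1 (last x) Ex; rewrite !last_cat /= => <-.
case/lastP: s1 hs1 {E Ej Ex} => // s1 z; rewrite all_rcons last_rcons.
by case/andP.
Qed.

End Matchings.

(** * Reductions that preserve 3-edge-connectedness *)

Section Reductions.
Variable T : finType.
Implicit Types (V W R X Y Z : {set T}) (r : rel T) (L : seq (T * T)) (x y z u v : T).
Implicit Types (m : T -> T) (c p q s : seq T) (CC : seq (seq T)).

(** A single vertex has cut 3 and two adjacent vertices have cut 4, so small cuts around at most two
    vertices have to be allowed. *)
Definition c5 V r : Prop :=
  forall X, X \subset V -> cut r X <= 4 -> #|X| <= 2 \/ #|V :\: X| <= 2.

(** [c] and [c'] are the old cuts of the two parts of [W], and [k] is the number of old edges
    between the parts. [i], [o] and [j] count the new edges inside the first part, inside the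
    second, and between them, so the new cut is [k + j]. *)
Fact cut_arith (c c' k i o j n : nat) : c = k + (2 * i + j) -> c' = k + (2 * o + j) ->
  k + j < 3 -> 3 <= c -> 3 <= c' -> i + o + j = n -> n <= 3 ->
  0 < i /\ 0 < o /\ (c <= 4 \/ c' <= 4).
Proof. lia. Qed.

Section Tec.
Variables (V : {set T}) (r : rel T).
Hypothesis G : cgraph V r.
Hypothesis G3 : tec V r.
Hypothesis G5 : c5 V r.
Variables (W : {set T}) (L : seq (T * T)).
Hypothesis sW : W \subset V.
Hypothesis L_new : new_edges r W W L.
Hypothesis hW : forall x, x \in W -> \sum_(y in ~: W) r x y = inc L x.
Hypothesis szL : size L <= 3.
Hypothesis szR : 2 <= #|V :\: W|.

Let ins X := \sum_(l <- L) ((l.1 \in X) && (l.2 \in X)).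
Let cro X := \sum_(l <- L) ((l.1 \in X) (+) (l.2 \in X)).

(** [X] contains both ends of a new edge. If it is no larger, these ends are not adjacent in the old
    graph and the cut is 6. Otherwise [c5] bounds the complement of [X] by 2, yet it contains the
    deleted vertices, at least two, and a vertex of [W]. *)
Let bad X : X \subset W -> X != set0 -> X != W -> 0 < ins X -> cut r X <= 4 -> False.
Proof.
move=> sX X0 XW i0 c4.
have sXV := subset_trans sX sW.
have [l lL /andP[l1 l2]] : exists2 l, l \in L & (l.1 \in X) && (l.2 \in X).
  move: i0; rewrite /ins lt0n sum_nat_seq_neq0 => /hasP[l lL /=].
  by rewrite eqb0 negbK => h; exists l.
have nl : l.1 != l.2.
  apply/negP => /eqP e; have h : (l.1, l.1) \in L by rewrite {2}e -surjective_pairing.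
  by have := new_asym L_new h h.
have [XL|XL] := G5 sXV c4.
  have eX : X = [set l.1; l.2].
    apply/eqP; rewrite eq_sym eqEcard cards2 nl XL andbT.
    by apply/subsetP => z; rewrite !inE => /orP[]/eqP->.
  move: c4; rewrite eX (cut_set2 G) ?(subsetP sXV) //.
  have := @new_notr _ _ _ G _ _ _ L_new l.1 l.2; rewrite -surjective_pairing lL.
  by move=> /(_ isT (subsetP sX _ l1) (subsetP sX _ l2)) /negbTE->.
have : V :\: W \proper V :\: X.
  rewrite properE setDS //=; apply/subsetPn.
  have [z zW zX] : exists2 z, z \in W & z \notin X.
    by apply/subsetPn; apply: contra XW => h; rewrite eqEsubset sX.
  by exists z; rewrite !inE ?zX ?zW ?(subsetP sW).
by move/proper_card; rewrite ltnNge (leq_trans XL szR).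
Qed.

(** If a new cut had at most two edges, each part would contain a new edge, and one part would have
    an old cut of at most four edges; [bad] excludes that part. *)
Lemma red_tec : tec W (nrel r W L).
Proof.
move=> X sX X0 XW; rewrite leqNgt; apply/negP; rewrite (nrel_cut G L_new) => lt3.
have sXV := subset_trans sX sW.
have sY : W :\: X \subset W by apply: subsetDl.
have Y0 : W :\: X != set0 by rewrite setD_eq0; apply: contra XW => h; rewrite eqEsubset sX.
have YW : W :\: X != W.
  apply: contra X0 => /eqP e; rewrite -subset0; apply/subsetP => z zX.
  by have := subsetP sX z zX; rewrite -e inE zX.
have cX := old_cut hW sX; have cY := old_cut hW sY.
have sYV := subset_trans sY sW.
have XV : X != V by apply: contra XW => /eqP e; rewrite eqEsubset sX e.
have YV : W :\: X != V by apply: contra YW => /eqP e; rewrite eqEsubset sY e.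
have h3X := G3 sXV X0 XV; have h3Y := G3 sYV Y0 YV.
have eXW : X :&: W = X by apply/setIidPl.
have eDD : W :\: (W :\: X) = X by rewrite setDDr setDv set0U; apply/setIidPr.
rewrite eDD in cY.
have kk : en r (W :\: X) X = en r X (W :\: X) by apply: en_sym; apply: csym G.
rewrite eXW in lt3; rewrite kk in cY.
have eI Z : \sum_(l <- L) ((l.1 \in Z) + (l.2 \in Z)) = 2 * ins Z + cro Z.
  rewrite /ins /cro big_distrr -big_split /=; apply: eq_bigr => l _.
  by case: (l.1 \in Z); case: (l.2 \in Z).
have eC : cro (W :\: X) = cro X.
  rewrite /cro; apply: eq_big_seq => -[a b] lL /=.
  by rewrite !inE !(@new_mem _ _ _ _ _ L_new a b, @new_mem _ _ _ _ _ L_new b a) ?lL ?orbT // !andbT; case: (a \in X); case: (b \in X).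
have eS : ins X + ins (W :\: X) + cro X = size L.
  rewrite /ins /cro -!big_split /= -sum1_size; apply: eq_big_seq => -[a b] lL /=.
  by rewrite !inE !(@new_mem _ _ _ _ _ L_new a b, @new_mem _ _ _ _ _ L_new b a) ?lL ?orbT // !andbT; case: (a \in X); case: (b \in X).
have b1 := bad sX X0 XW; have b2 := bad sY Y0 YW.
rewrite eI in cX; rewrite eI eC in cY; rewrite -/(cro X) in lt3.
have [i1 [i2 h4]] := cut_arith cX cY lt3 h3X h3Y eS szL.
by case: h4 => [/(b1 i1)|/(b2 i2)].
Qed.

End Tec.

Lemma sum_removed V r (R : seq T) x : cgraph V r -> uniq R -> {subset R <= V} ->
  \sum_(y in ~: (V :\: [set z in R])) r x y = \sum_(z <- R) r z x.
Proof.
move=> G uR RV; rewrite (big_uniq _ uR) /=.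
rewrite (bigID (mem R)) /= addnC big1 ?add0n => [|y].
  apply: eq_big => y; last by rewrite (csym G).
  rewrite !inE; case yR: (y \in R); rewrite ?andbF //.
rewrite !inE => /andP[+ yR]; rewrite yR /= => yV.
case rxy: (r x y) => //; by rewrite (csupr G rxy) in yV.
Qed.

Lemma mem3 x a b (c : T) : uniq [:: a; b; c] ->
  (x \in [:: a; b; c] : nat) = (x == a) + (x == b) + (x == c).
Proof.
rewrite /= !inE !negb_or; case: (x =P a) => [->|_] /=; first by case/and3P=> /andP[/negbTE-> /negbTE->].
by case: (x =P b) => [->|_] /=; first by case/and3P=> _ /negbTE->.
Qed.

(** * Girth at least 5 *)

Section Girth.
Variables (V : {set T}) (r : rel T).
Hypothesis G : cgraph V r.
Hypothesis G5 : c5 V r.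
Hypothesis V6 : 6 < #|V|.

(** A triangle has cut 3, and with at least seven vertices both sides of this cut have more than
    two. *)
Lemma no_triangle x y z : r x y -> r y z -> r z x -> False.
Proof.
move=> xy yz zx; have xV := csup G xy; have yV := csup G yz; have zV := csup G zx.
have nx : x \notin [set y; z] by rewrite !inE negb_or (cneq G xy) eq_sym (cneq G zx).
have := @cutU1 _ _ _ G [set y; z] x xV nx; rewrite (cut_set2 G) ?(cneq G yz) //.
rewrite big_setU1 ?inE ?(cneq G yz) //= big_set1 xy (csym G x) zx yz => E.
have [] := G5 (X := x |: [set y; z]); first by apply/subsetP => a; rewrite !inE => /or3P[]/eqP->.
- by move: (cut _ _) E; clear; lia.
- by rewrite cardsU1 nx cards2 (cneq G yz).
rewrite cardsD; have : #|V :&: (x |: [set y; z])| <= 3.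
  by rewrite (leq_trans (subset_leq_card (subsetIr _ _))) // cardsU1 nx cards2 (cneq G yz).
by clear -V6; lia.
Qed.

(** Built up from the edge [zw] one vertex at a time, the square gets a cut of at most 4, with or
    without chords. *)
Lemma no_square x y z w : r x y -> r y z -> r z w -> r w x -> x != z -> y != w -> False.
Proof.
move=> xy yz zw wx xz yw.
have xV := csup G xy; have yV := csup G yz; have zV := csup G zw; have wV := csup G wx.
have ny : y \notin [set z; w] by rewrite !inE negb_or (cneq G yz).
have := @cutU1 _ _ _ G [set z; w] y yV ny; rewrite (cut_set2 G) ?(cneq G zw) //.
rewrite big_setU1 ?inE ?(cneq G zw) //= big_set1 zw yz => E1.
have nx : x \notin y |: [set z; w] by rewrite !inE !negb_or (cneq G xy) xz eq_sym (cneq G wx).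
have := @cutU1 _ _ _ G (y |: [set z; w]) x xV nx.
rewrite big_setU1 //= big_setU1 ?inE ?(cneq G zw) //= big_set1 xy (csym G x w) wx => E2.
have cX : #|x |: (y |: [set z; w])| = 4 by rewrite cardsU1 nx cardsU1 ny cards2 (cneq G zw).
have [] := G5 (X := x |: (y |: [set z; w])); first by apply/subsetP => a; rewrite !inE => /or4P[]/eqP->.
- by move: (cut _ _) (cut _ _) E1 E2 => a b; clear; lia.
- by rewrite cX.
rewrite cardsD; have : #|V :&: (x |: (y |: [set z; w]))| <= 4.
  by rewrite (leq_trans (subset_leq_card (subsetIr _ _))) // cX.
by clear -V6; lia.
Qed.

End Girth.
End Reductions.

(** * Graphs without nontrivial cuts of at most four edges *)

Section C5.
Variable T : finType.
Implicit Types (W R X Y Z : {set T}) (L : seq (T * T)) (x z : T).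
Implicit Types (m : T -> T) (p q s : seq T) (CC : seq (seq T)).

Variables (V : {set T}) (r : rel T).
Hypothesis G : cgraph V r.
Hypothesis G3 : tec V r.
Hypothesis G5 : c5 V r.
Hypothesis V6 : 6 < #|V|.
Hypothesis IH : forall (V' : {set T}) (r' : rel T),
  #|V'| < #|V| -> cgraph V' r' -> tec V' r' -> hits_all V' r'.

Let tri := no_triangle G G5 V6.
Let sq := no_square G G5 V6.

(** * Deletion of two adjacent vertices *)

Section Red2.
Variables u v t y b c d : T.
Hypothesis uv : r u v.
Hypothesis vt : v != t.
Hypothesis Nt_uniq : uniq [:: u; y; b].
Hypothesis Nt : forall x, r t x = (x \in [:: u; y; b]).
Hypothesis Ny_uniq : uniq [:: t; c; d].
Hypothesis Ny : forall x, r y x = (x \in [:: t; c; d]).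

(* The new edge ud cannot be used by a matching that contains uv. *)
Definition W2 := V :\: [set z in [:: t; y]].
Definition L2 := [:: (u, d); (b, c)].
Definition r2 := nrel r W2 L2.

Let tu : r t u. Proof. by rewrite Nt !inE eqxx. Qed.
Let ty : r t y. Proof. by rewrite Nt !inE eqxx orbT. Qed.
Let tb : r t b. Proof. by rewrite Nt !inE eqxx !orbT. Qed.
Let yc : r y c. Proof. by rewrite Ny !inE eqxx orbT. Qed.
Let yd : r y d. Proof. by rewrite Ny !inE eqxx !orbT. Qed.

Let ne_adj a z : r t a -> r y z -> a != z.
Proof.
move=> ta yz; apply/eqP => e; subst z; apply: (tri ta _ (_ : r y t)).
  by rewrite (csym G).
by rewrite (csym G).
Qed.

Let tV : t \in V. Proof. exact: csup ty. Qed.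
Let yV : y \in V. Proof. exact: csup yc. Qed.

Let inW a : r t a || r y a -> a != t -> a != y -> a \in W2.
Proof.
move=> h at' ay; rewrite !inE negb_or at' ay /=.
by case/orP: h => /(csupr G).
Qed.

Let nyu : u != y /\ b != y /\ u != b.
Proof. by move: Nt_uniq; rewrite /= !inE !negb_or [b == y]eq_sym; case: (u != y); case: (u != b); case: (y != b). Qed.
Let ntc : c != t /\ d != t /\ c != d.
Proof. by move: Ny_uniq; rewrite /= !inE !negb_or ![_ == t]eq_sym; case: (t != c); case: (t != d); case: (c != d). Qed.

Lemma uW2 : u \in W2. Proof. by apply: inW; rewrite ?tu ?(eq_sym u t) ?(cneq G tu) //; case: nyu. Qed.
Lemma bW2 : b \in W2. Proof. by apply: inW; rewrite ?tb ?(eq_sym b t) ?(cneq G tb) //; case: nyu => _ []. Qed.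
Lemma cW2 : c \in W2. Proof. by apply: inW; rewrite ?yc ?orbT ?(eq_sym c y) ?(cneq G yc) //; case: ntc. Qed.
Lemma dW2 : d \in W2. Proof. by apply: inW; rewrite ?yd ?orbT ?(eq_sym d y) ?(cneq G yd) //; case: ntc => _ []. Qed.

Lemma vW2 : v \in W2.
Proof.
rewrite !inE negb_or vt (csupr G uv) andbT /=; apply/eqP => e; subst v.
by apply: (tri tu uv); rewrite (csym G).
Qed.

(** An old edge [ud] or [bc] would close a square through [t] and [y], and a common neighbour of [t]
    and [y] would give a triangle. *)
Lemma L2_new : new_edges r W2 W2 L2.
Proof.
have [n1 [n2 n3]] := nyu; have [n4 [n5 n6]] := ntc.
have e1 := ne_adj tu yc; have e2 := ne_adj tu yd; have e3 := ne_adj tb yc; have e4 := ne_adj tb yd.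
rewrite /new_edges /= uW2 bW2 cW2 dW2 /= !inE !xpair_eqE.
rewrite (negbTE n3) (negbTE e1) (negbTE e2) (negbTE e3) (negbTE e4).
rewrite [d == c]eq_sym (negbTE n6) /= andbT; apply/andP; split; apply/negP.
  move=> ud; apply: (@sq u t y d) => //; rewrite ?(csym G _ t) //; first by rewrite (csym G).
  by rewrite eq_sym.
move=> bc; apply: (@sq b t y c) => //; rewrite ?(csym G _ t) //; first by rewrite (csym G).
by rewrite eq_sym.
Qed.

Lemma sW2 : W2 \subset V. Proof. exact: subsetDl. Qed.

Lemma hW2 x : x \in W2 -> \sum_(z in ~: W2) r x z = inc L2 x.
Proof.
rewrite inE => /andP[+ xV]; rewrite !inE negb_or => /andP[/negbTE xt /negbTE xy].
rewrite (sum_removed _ G) /=; first last.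
- by move=> z; rewrite !inE => /orP[]/eqP->.
- by rewrite inE (cneq G ty).
rewrite /inc !big_cons !big_nil /= Nt Ny !mem3 // xt xy.
by case: (x == u); case: (x == b); case: (x == c); case: (x == d).
Qed.

Lemma W2_card : #|V| = #|W2|.+2.
Proof.
have : #|V :&: [set z in [:: t; y]]| = 2.
  rewrite (setIidPr _); first by rewrite cardsE (card_uniqP _) //= inE (cneq G ty).
  by apply/subsetP => z; rewrite !inE => /orP[]/eqP->.
rewrite /W2 cardsD => e2; have := subset_leq_card (subsetIl V [set z in [:: t; y]]).
by rewrite e2 => le; rewrite -addn2 subnK.
Qed.

Lemma r2_cgraph : cgraph W2 r2.
Proof.
by apply: (new_cgraph G sW2 (subxx _) L2_new hW2) => x xW; rewrite xW.
Qed.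

Lemma r2_tec : tec W2 r2.
Proof.
apply: (red_tec G G3 G5 sW2 L2_new hW2) => //.
by rewrite cardsD (setIidPr sW2) W2_card -[X in X - _]addn2 addKn.
Qed.

Lemma uv2 : r2 u v.
Proof. by rewrite /r2 /nrel uW2 vW2 uv. Qed.

Lemma red2_solve CC : family r2 CC ->
  {in CC, forall C, exists2 x, x \in W2 & x \notin C} ->
  exists m' m, [/\ pm W2 r2 m' /\ {in CC, forall C, hit m' C}, pm V r m, m u = v,
   (forall C, all [in W2] C -> cycle r C -> hit m' C -> hit m C) /\
   (forall x p, all [in W2] (x :: p) -> path r x p -> ~~ path (off m') x p -> ~~ path (off m) x p) &
   if m' b == c then m b = t /\ m c = y else m t = y].
Proof.
move=> fam nH.
have lt : #|W2| < #|V| by rewrite W2_card.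
have [m' [pm' mu hC]] := IH lt r2_cgraph r2_tec uv2 fam nH.
exists m'.
(* [u] is matched to [v], and [v = d] would close the square [u t y v]. *)
have nud : m' u == d = false.
  rewrite mu; apply/negP => /eqP e.
  apply: (@sq u t y v) => //; rewrite ?(csym G _ u) ?(csym G u t) ?uv //.
  - by rewrite e.
  - by case: nyu.
  - by rewrite eq_sym.
have bc : b == c = false by apply/negbTE/(ne_adj tb yc).
have ub : u \notin [:: b; c].
  rewrite !inE negb_or (ne_adj tu yc) andbT; by case: nyu => _ [].
have tyW (x : T) : x \in V :\: W2 -> (x == t) || (x == y).
  by rewrite !inE; case: (x \in V); rewrite ?andbT ?andbF // negbK.
have tnW : t \in V :\: W2 by rewrite !inE eqxx tV.
have ynW : y \in V :\: W2 by rewrite !inE eqxx yV orbT.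
case mb : (m' b == c).
  have E : {in W2, [:: b; c] =i outsL L2 m'}.
    by move=> x _; rewrite /outsL /= nud mb /= !inE.
  have S1 : side W2 r m' [:: b; c].
    exact: (side_new (subxx _) L2_new pm' E).
  have S2 : side (V :\: W2) r id [:: t; y].
    by move=> x /tyW; rewrite !inE => ->.
  have [||| m [pmm m1 m2 mp]] := @glue _ V r W2 m' id [:: (b, t); (c, y)] G sW2 S1 S2.
  - by rewrite /= inE bc.
  - by rewrite /= inE (cneq G ty).
  - by rewrite /= bW2 cW2 !inE !eqxx orbT /= !(csym G _ t) !(csym G _ y) tb yc.
  exists m; split => //.
  - by rewrite m1 ?uW2.
  - split; first by move=> C; exact: (hit_new G (subxx _) L2_new pm' E m1).
    move=> x p; exact: (phit_new G (subxx _) L2_new pm' E m1).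
  by case: (mp (b, t)) (mp (c, y)) => [|-> _ []]; rewrite ?inE ?eqxx ?orbT.
have E : {in W2, [::] =i outsL L2 m'}.
  by move=> x _; rewrite /outsL /= nud mb.
have S1 : side W2 r m' [::] by exact: (side_new (subxx _) L2_new pm' E).
have nty : y == t = false by rewrite eq_sym; apply/negbTE/(cneq G ty).
have S2 : side (V :\: W2) r (fun x => if x == t then y else t) [::].
  move=> x /tyW /orP[]/eqP-> _; first by rewrite eqxx nty.
  by rewrite nty eqxx (csym G).
have [||| m [pmm m1 m2 mp]] := @glue _ V r W2 m' _ [::] G sW2 S1 S2 => //.
exists m; split => //.
- by rewrite m1 ?uW2.
- split; first by move=> C; exact: (hit_new G (subxx _) L2_new pm' E m1).
  move=> x p; exact: (phit_new G (subxx _) L2_new pm' E m1).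
by rewrite m2 // eqxx.
Qed.

End Red2.

(** The steps that do not run along the edge [uv]. Circuits running along it are hit as soon as the
    matching contains it. *)
Definition noe (u v : T) : rel T := fun x y => ~~ (((x == u) && (y == v)) || ((x == v) && (y == u))).

Lemma noe_hit u v m C : m u = v -> m v = u -> ~~ cycle (noe u v) C -> hit m C.
Proof.
move=> mu mv; apply: contra; apply: sub_cycle => x y; rewrite /off /noe; apply: contra.
by case/orP => /andP[/eqP-> /eqP->]; rewrite ?mu ?mv.
Qed.

Lemma circ_at C x : circ r C -> x \in C -> exists i y s z,
  rot i C = x :: y :: rcons s z.
Proof.
move=> /and3P[uC cC sC] /rot_to[i s E].
have := size_rot i C; rewrite E; case: s E => [|y s] E /=; first by move=> h; rewrite -h in sC.
case/lastP: s E => [|s z] E h; first by rewrite -h in sC.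
by exists i, y, s, z.
Qed.

(** [u] has only two edges besides [uv], and a circuit through [u] that avoids [uv] needs both. *)
Lemma noe_nbr u v t C : r u v -> r u t -> v != t -> circ r C ->
  cycle (noe u v) C -> u \in C -> t \in C.
Proof.
move=> uv ut vt cC nC uC; have [i [y [s [z E]]]] := circ_at cC uC.
have [t' [_ Nu]] := cnbr2 G uv ut vt.
have := cC; rewrite -(circ_rot _ i) E => /and3P[/= uq cc _].
move: nC; rewrite -(rot_cycle i) E /= rcons_path last_rcons => /and3P[n1 _ n2].
move: uq; rewrite !inE !mem_rcons !inE !negb_or => /and3P[/and3P[uy uz _] /andP[yz _] _].
move: cc; rewrite rcons_path last_rcons => /and3P[uy' _ zu].
rewrite -(mem_rot i) E !inE mem_rcons inE.
move: uy'; rewrite Nu; rewrite (csym G) Nu in zu; move: zu; rewrite !inE.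
have -> : y == v = false by move: n1; rewrite /noe eqxx; case: (y == v).
have -> : z == v = false by move: n2; rewrite /noe eqxx; case: (z == v); rewrite ?orbT.
rewrite /= => hz hy; move: yz; rewrite (eq_sym t y) (eq_sym t z).
case/orP: hz => /eqP ->; first by rewrite eqxx !orbT.
case/orP: hy => /eqP ->; first by rewrite eqxx !orbT.
by rewrite eqxx.
Qed.

(** One of the two directions leaves [t] towards a vertex other than [u]. The stretch [t], [y], [c]
    in that direction is what the deletion of [t] and [y] is adapted to. *)
Lemma circ_at2 C t u : circ r C -> t \in C -> exists C' y c s,
  [/\ C' = t :: y :: c :: s, y != u, circ r C', C' =i C &
      forall m, pm V r m -> hit m C' -> hit m C].
Proof.
move=> cC tC; have [i [y [s [z E]]]] := circ_at cC tC.
have cE := cC; rewrite -(circ_rot r i) in cE.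
have sub := circ_sub G cE.
have mem0 : rot i C =i C by move=> a; rewrite mem_rot.
have h0 m : pm V r m -> hit m (rot i C) -> hit m C by rewrite hit_rot.
case: (eqVneq y u) => [yu|nu].
  have zu : z != u.
    move: cE; rewrite E -yu => /and3P[/= + _ _].
    by rewrite !inE !mem_rcons !inE !negb_or => /and3P[_ /andP[+ _] _]; rewrite eq_sym.
  have E2 : rotr 1 (rev (rot i C)) = t :: z :: rev (y :: s).
    by rewrite E -rcons_cons rev_cons rotr1_rcons rev_rcons.
  have cE2 : circ r (rotr 1 (rev (rot i C))) by rewrite /rotr circ_rot (circ_rev _ G).
  have h2 m : pm V r m -> hit m (rotr 1 (rev (rot i C))) -> hit m C.
    by move=> pmm; rewrite /rotr hit_rot (hit_rev pmm) // hit_rot.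
  have m2 : rotr 1 (rev (rot i C)) =i C by move=> a; rewrite mem_rotr mem_rev mem_rot.
  case Es : (rev (y :: s)) E2 cE2 => [|c s'] E2 cE2.
    by have := size_rev (y :: s); rewrite Es.
  by exists (rotr 1 (rev (rot i C))), z, c, s'.
case: s E => [|c s] E.
  by exists (rot i C), y, z, [::].
by exists (rot i C), y, c, (rcons s z).
Qed.

Section Cases.
Variables (u v : T) (CC : seq (seq T)).
Hypothesis uv : r u v.
Hypothesis fam : family r CC.
Hypothesis famN : {in CC, forall C, cycle (noe u v) C}.

Definition solved : Prop :=
  exists m, [/\ pm V r m, m u = v & {in CC, forall C, hit m C}].

Lemma circ_new W L C : all [in W] C -> circ r C -> circ (nrel r W L) C.
Proof.
move=> al /and3P[uC cC sC]; apply/and3P; split => //.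
by apply: sub_in_cycle al cC => x y xW yW rxy; rewrite /nrel xW yW rxy.
Qed.

Lemma family_new W L CC' : {subset CC' <= CC} -> {in CC', forall C, all [in W] C} ->
  family (nrel r W L) CC'.
Proof.
move=> s al; split; last by move=> C D x /s ? /s; exact: fam.2.
by move=> C h; apply: circ_new; [exact: al | exact: fam.1 (s _ h)].
Qed.

Lemma avoidW2 t y C : C \in CC -> t \notin C -> y \notin C -> all [in W2 t y] C.
Proof.
move=> CCC tC yC; apply/allP => x xC; rewrite !inE negb_or (circ_sub G (fam.1 _ CCC)) // andbT.
by apply/andP; split; apply/eqP => e; subst x; [move: tC | move: yC]; rewrite xC.
Qed.

(** Either neighbour of [y] other than [t] may play the part of [c], and the lifted matching
    contains [ty] or [yc]. Circuits through neither [t] nor [y] survive the deletion; [hD] takes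
    care of the others. *)
Lemma caseA t y c d : r u t -> v != t -> r t y -> y != u -> uniq [:: t; c; d] ->
  (forall x, r y x = (x \in [:: t; c; d])) ->
  (forall C, C \in CC -> (t \in C) || (y \in C) -> forall m, pm V r m ->
      m t = y \/ m y = c -> hit m C) ->
  solved.
Proof.
move=> ut vt ty yu uNy Ny hD.
have [b [uNt Nt]] : exists b, uniq [:: u; y; b] /\ forall x, r t x = (x \in [:: u; y; b]).
  by apply: (cnbr2 G) => //; rewrite ?(csym G t) // eq_sym.
pose CC' := [seq C <- CC | (t \notin C) && (y \notin C)].
have sCC : {subset CC' <= CC} by move=> C; rewrite mem_filter => /andP[].
have alW : {in CC', forall C, all [in W2 t y] C}.
  by move=> C; rewrite mem_filter => /andP[/andP[tC yC] CCC]; exact: avoidW2.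
have [|m' [m [[_ hC'] pmm mu [hh _] cs]]] :=
    red2_solve uv vt uNt Nt uNy Ny (family_new (L2 u b c d) sCC alW).
  (* The missed vertex is [u]: a circuit through [u] that avoids [uv] contains [t] and was removed
     from the family. *)
  move=> C CC'C; exists u; first exact: uW2 uNt Nt.
  apply/negP => uC; have CCC := sCC C CC'C.
  have := noe_nbr uv ut vt (fam.1 _ CCC) (famN CCC) uC.
  by move: CC'C; rewrite mem_filter => /andP[/andP[/negbTE->]].
exists m; split => // C CCC.
case h : ((t \in C) || (y \in C)); last first.
  have CC'C : C \in CC' by rewrite mem_filter CCC andbT -negb_or h.
  by apply: hh (hC' _ CC'C); [exact: alW | case/and3P: (fam.1 _ CCC)].
apply: (hD C CCC h m pmm); case: ifP cs => _; last by left.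
move=> [_ mc]; right; apply: pm_eq pmm _ mc; apply: (csupr G (x := y)).
by rewrite Ny !inE eqxx orbT.
Qed.

(** [y] and [c] are chosen as the vertices after [t] on [C], so both candidates [ty] and [yc] are
    edges of [C]. By disjointness no other circuit meets [t] or [y]. *)
Lemma case1 t C : r u t -> v != t -> C \in CC -> t \in C -> solved.
Proof.
move=> ut vt CCC tC.
have [D [y [c [s [eD yu cD memD hD]]]]] := circ_at2 u (fam.1 _ CCC) tC.
move: (cD); rewrite eD => /and3P[/= /and3P[]]; rewrite !inE !negb_or => /and3P[nty ntc _] /andP[nyc _] _ /and3P[ty yc _] _.
have [d [uNy Ny]] : exists d, uniq [:: t; c; d] /\ forall x, r y x = (x \in [:: t; c; d]).
  by apply: (cnbr2 G) => //; rewrite (csym G).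
apply: (caseA ut vt ty yu uNy Ny) => C' CCC' tyC' m pmm h.
have -> : C' = C.
  case/orP: tyC' => z; first exact: (fam.2 _ _ t).
  by apply: (fam.2 _ _ y) => //; rewrite -memD eD !inE eqxx orbT.
apply: hD => //; rewrite eD /hit /= /off.
by case: h => ->; rewrite eqxx ?andbF.
Qed.

Lemma case2a t y : r u t -> v != t -> r t y -> y != u ->
  (forall C, C \in CC -> t \notin C) -> (forall C, C \in CC -> y \notin C) -> solved.
Proof.
move=> ut vt ty yu hT hY.
have [c [d [uNy Ny]]] : exists c d, uniq [:: t; c; d] /\ forall x, r y x = (x \in [:: t; c; d]).
  by apply: (cnbr1 G); rewrite (csym G).
apply: (caseA ut vt ty yu uNy Ny) => C CCC.
by rewrite (negbTE (hT _ CCC)) (negbTE (hY _ CCC)).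
Qed.

(** Here [C] contains both neighbours [y] and [b] of [t] while avoiding [t]. The new edge [bc]
    closes the arc of [C] from [b] to [c] into a circuit of the reduced graph, and this circuit is
    prescribed. If it is hit at [bc], the lifted matching contains the edge [cy] of [C]; otherwise
    it hits the arc. *)
Lemma case2b t y b C : r u t -> v != t -> r t y -> r t b -> y != u -> b != u -> y != b ->
  (forall C, C \in CC -> t \notin C) -> C \in CC -> y \in C -> b \in C -> solved.
Proof.
move=> ut vt ty tb yu bu yb hT CCC yC bC.
have uNC C' : C' \in CC -> u \notin C'.
  move=> CCC'; apply/negP => uC.
  by have := hT _ CCC'; rewrite (noe_nbr uv ut vt (fam.1 _ CCC') (famN CCC') uC).
have [i [d [s' [c E]]]] := circ_at (fam.1 _ CCC) yC.
have cE := fam.1 _ CCC; rewrite -(circ_rot r i) E in cE.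
move: (cE) => /and3P[uqE ccE _].
move: (uqE) (ccE); rewrite /= rcons_path last_rcons !inE !mem_rcons !inE !negb_or.
move=> /andP[/and3P[yd yc _] /andP[/andP[dc _] _]] /and3P[ryd _ rcy].
have ryc : r y c by rewrite (csym G).
have tC : t \notin rot i C by rewrite mem_rot hT.
have [ct dt] : c != t /\ d != t.
  by split; apply: contraNneq tC => <-; rewrite E !inE ?mem_rcons ?inE eqxx ?orbT.
have [uNy Ny] : uniq [:: t; c; d] /\ forall x, r y x = (x \in [:: t; c; d]).
  have [t' [uq N]] : exists t', uniq [:: c; d; t'] /\ forall x, r y x = (x \in [:: c; d; t']).
    by apply: (cnbr2 G) => //; rewrite eq_sym.
  have: r y t by rewrite (csym G).
  rewrite N !inE (eq_sym t c) (negbTE ct) (eq_sym t d) (negbTE dt) => /eqP et; subst t'.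
  split; first by rewrite /= !inE !negb_or ![t == _]eq_sym ct dt eq_sym dc.
  by move=> x; rewrite N !inE orbA orbC.
have [uNt Nt] : uniq [:: u; y; b] /\ forall x, r t x = (x \in [:: u; y; b]).
  have rtu : r t u by rewrite (csym G).
  have [t' [uq N]] : exists t', uniq [:: u; y; t'] /\ forall x, r t x = (x \in [:: u; y; t']).
    by apply: (cnbr2 G) => //; rewrite eq_sym.
  by move: tb; rewrite N !inE (negbTE bu) eq_sym (negbTE yb) => /eqP->.
have bt : r b t by rewrite (csym G).
have bd : b != d by apply/eqP => e; subst d; exact: (tri ty ryd bt).
have bc : b != c by apply/eqP => e; subst c; exact: (tri ty ryc bt).
have bs : b \in s'.
  have : b \in rot i C by rewrite mem_rot.
  by rewrite E !inE mem_rcons inE eq_sym (negbTE yb) (negbTE bd) (negbTE bc).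
case: (splitPr bs) E uqE ccE => s1 s2 E uqE ccE; rewrite rcons_cat /= in E uqE ccE.
pose D2 := b :: rcons s2 c.
have D2C x : x \in D2 -> x \in C.
  by move=> xD; rewrite -(mem_rot i) E !inE mem_cat xD !orbT.
have yD2 : y \notin D2.
  by move: uqE; rewrite !inE mem_cat !negb_or => /and3P[/and3P[_ _ +] _ _].
have tD2 : t \notin D2 by apply: contra (hT _ CCC) => /D2C.
have alD2 : all [in W2 t y] D2.
  apply/allP => x xD; rewrite !inE negb_or (circ_sub G (fam.1 _ CCC)) ?D2C // andbT.
  by apply/andP; split; apply/eqP => e; subst x; [move: tD2 | move: yD2]; rewrite xD.
have pD2 : path r b (rcons s2 c).
  by move: ccE; rewrite rcons_path cat_path /= => /andP[_ /andP[/andP[_ /andP[_ +]] _]].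
(* If [b] and [c] were consecutive on [C], then [b t y c] would be a square; so the closed arc has
   at least three vertices. *)
have s20 : s2 != [::].
  apply/eqP => e; move: pD2; rewrite e /= andbT => rbc.
  apply: (@sq b t y c) => //; [by rewrite (csym G) | by rewrite eq_sym | by rewrite eq_sym].
have cD2 : circ (r2 u t y b c d) D2.
  apply/and3P; split.
  - by move: uqE; rewrite /D2 /= cat_uniq => /and3P[_ _ /and3P[_ _ +]].
  - rewrite /D2 /= rcons_path last_rcons; apply/andP; split.
      move: pD2; apply: (@sub_in_path _ [in W2 t y]) => // x z xW zW rxz.
      by rewrite /r2 /nrel xW zW rxz.
    by rewrite /r2 /nrel !inE eqxx !orbT.
  by rewrite /D2 /= size_rcons; case: (s2) s20.
pose CC' := [seq C' <- CC | C' != C].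
have sCC : {subset CC' <= CC} by move=> C'; rewrite mem_filter => /andP[].
have alW : {in CC', forall C', all [in W2 t y] C'}.
  move=> C'; rewrite mem_filter => /andP[nC CCC']; apply: avoidW2 => //; first exact: hT.
  by apply: contra nC => yC'; apply/eqP; apply: (fam.2 _ _ y).
have fam' : family (r2 u t y b c d) (D2 :: CC').
  have [f1 f2] := family_new (L2 u b c d) sCC alW.
  have dj C' x : C' \in CC' -> x \in C' -> x \in D2 -> False.
    rewrite mem_filter => /andP[/eqP nC CCC'] xC' /D2C xC; apply: nC.
    exact: (fam.2 _ _ x).
  split=> [C'|C' D x]; rewrite !inE; first by case/orP => [/eqP->|/f1].
  case/orP => [/eqP->|h1] /orP[/eqP->|h2] // x1 x2.
  - by have := dj _ _ h2 x2 x1.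
  - by have := dj _ _ h1 x1 x2.
  exact: f2 x1 x2.
have [|m' [m [[pm' hC'] pmm mu [hh hp] cs]]] := red2_solve uv vt uNt Nt uNy Ny fam'.
  move=> C'; rewrite inE => h; exists u; first exact: uW2 uNt Nt.
  case/orP: h => [/eqP->|/sCC]; last exact: uNC.
  by apply: contra (uNC _ CCC) => /D2C.
exists m; split => // C' CCC'.
case: (eqVneq C' C) => [->|nC]; last first.
  have C'in : C' \in CC' by rewrite mem_filter nC.
  by apply: hh; [exact: alW | case/and3P: (fam.1 _ CCC') | apply: hC'; rewrite inE C'in orbT].
rewrite -(hit_rot _ i) E /hit.
apply/negP; rewrite /= rcons_path cat_path /= => /andP[_ /andP[/andP[_ /andP[_ om]]]].
rewrite last_cat /= last_rcons /off => mcy.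
case: ifP cs => [_ [_ mc]|mbc mty]; first by rewrite mc eqxx in mcy.
have := hp b (rcons s2 c) alD2 pD2; rewrite om => hh2.
suff /hh2 : ~~ path (off m') b (rcons s2 c) by [].
have := hC' D2; rewrite inE eqxx /= => /(_ isT); rewrite /hit /D2 /= rcons_path last_rcons.
rewrite negb_and => /orP[//|]; rewrite /off negbK => /eqP mcb.
by move: mbc; rewrite (pm_eq pm' (cW2 uNy Ny) mcb) eqxx.
Qed.

End Cases.

(** * Deletion of a path on four vertices *)

Section Red4.
Variables u v t y b c d g c2 h c3 : T.
Hypothesis uv : r u v.
Hypothesis Nt_uniq : uniq [:: u; y; b].
Hypothesis Nt : forall x, r t x = (x \in [:: u; y; b]).
Hypothesis Ny_uniq : uniq [:: t; c; d].
Hypothesis Ny : forall x, r y x = (x \in [:: t; c; d]).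
Hypothesis Nc_uniq : uniq [:: y; c2; g].
Hypothesis Nc : forall x, r c x = (x \in [:: y; c2; g]).
Hypothesis Nd_uniq : uniq [:: c; c3; h].
Hypothesis Nd : forall x, r c2 x = (x \in [:: c; c3; h]).
Hypothesis R4_uniq : uniq [:: t; y; c; c2].

Definition W4 := V :\: [set z in [:: t; y; c; c2]].
Definition L4 := [:: (u, h); (b, d); (g, c3)].
Definition r4 := nrel r W4 L4.
Hypothesis vW4 : v \in W4.
Hypothesis L4_new : new_edges r W4 W4 L4.
Hypothesis nuh : ~~ r u h.

Let ty : r t y. Proof. by rewrite Nt !inE eqxx orbT. Qed.
Let tb : r t b. Proof. by rewrite Nt !inE eqxx !orbT. Qed.
Let yc : r y c. Proof. by rewrite Ny !inE eqxx orbT. Qed.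
Let yd : r y d. Proof. by rewrite Ny !inE eqxx !orbT. Qed.
Let cg : r c g. Proof. by rewrite Nc !inE eqxx !orbT. Qed.
Let cc2 : r c c2. Proof. by rewrite Nc !inE eqxx !orbT. Qed.
Let c23 : r c2 c3. Proof. by rewrite Nd !inE eqxx !orbT. Qed.

Let RV : {subset [:: t; y; c; c2] <= V}.
Proof.
by move=> z; rewrite !inE => /or4P[]/eqP->; [exact: csup ty|exact: csup yc|exact: csup cg|exact: csup c23].
Qed.

Let inW (x z : T) : (x, z) \in L4 \/ (z, x) \in L4 -> x \in W4.
Proof. by move/orP; exact: (new_mem L4_new). Qed.

Lemma uW4 : u \in W4. Proof. by apply: (@inW u h); rewrite !inE eqxx; left. Qed.
Let bW4 : b \in W4. Proof. by apply: (@inW b d); rewrite !inE eqxx !orbT; left. Qed.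
Let dW4 : d \in W4. Proof. by apply: (@inW d b); rewrite !inE eqxx !orbT; right. Qed.
Let gW4 : g \in W4. Proof. by apply: (@inW g c3); rewrite !inE eqxx !orbT; left. Qed.
Let c3W4 : c3 \in W4. Proof. by apply: (@inW c3 g); rewrite !inE eqxx !orbT; right. Qed.

Lemma sW4 : W4 \subset V. Proof. exact: subsetDl. Qed.

Lemma hW4 x : x \in W4 -> \sum_(z in ~: W4) r x z = inc L4 x.
Proof.
rewrite inE => /andP[+ xV]; rewrite !inE !negb_or => /and4P[/negbTE xt /negbTE xy /negbTE xc /negbTE xc2].
rewrite (sum_removed _ G) // /inc !big_cons !big_nil /= Nt Ny Nc Nd !mem3 // xt xy xc xc2.
by case: (x == u); case: (x == b); case: (x == d); case: (x == g); case: (x == h); case: (x == c3).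
Qed.

Lemma W4_card : #|V| = #|W4| + 4.
Proof.
have : #|V :&: [set z in [:: t; y; c; c2]]| = 4.
  rewrite (setIidPr _); first by rewrite cardsE (card_uniqP _).
  by apply/subsetP => z; rewrite inE; exact: RV.
rewrite /W4 cardsD => e2; have := subset_leq_card (subsetIl V [set z in [:: t; y; c; c2]]).
by rewrite e2 => le; rewrite subnK.
Qed.

Lemma r4_cgraph : cgraph W4 r4.
Proof.
by apply: (new_cgraph G sW4 (subxx _) L4_new hW4) => x xW; rewrite xW.
Qed.

Lemma r4_tec : tec W4 r4.
Proof.
apply: (red_tec G G3 G5 sW4 L4_new hW4) => //.
by rewrite cardsD (setIidPr sW4) W4_card addKn.
Qed.

(** As [u] is matched to [v], the matching does not contain [uh]. An edge [bd] of the matching is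
    replaced by [bt] and [dy], and an edge [gc3] by [gc] and [c3c2]; without [bd] the pair [ty] is
    matched, without [gc3] the pair [cc2]. So the mate of [c2] is always [c3] or [c]. *)
Lemma red4_solve CC : family r4 CC ->
  {in CC, forall C, exists2 x, x \in W4 & x \notin C} ->
  exists m' m, [/\ pm W4 r4 m' /\ {in CC, forall C, hit m' C}, pm V r m, m u = v,
   (forall C, all [in W4] C -> cycle r C -> hit m' C -> hit m C) &
   m c2 = c3 \/ m c = c2].
Proof.
move=> fam nH.
have lt : #|W4| < #|V| by rewrite W4_card -{1}[#|W4|]addn0 ltn_add2l.
have uv4 : r4 u v by rewrite /r4 /nrel uW4 vW4 uv.
have [m' [pm' mu hC]] := IH lt r4_cgraph r4_tec uv4 fam nH.
exists m'.
have nuh' : m' u == h = false by rewrite mu; apply: contraNF nuh => /eqP <-.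
pose mR x := if x == t then y else if x == y then t else if x == c then c2 else c.
have [[nty ntc ntc2] [nyc nyc2 ncc2]] : [/\ y == t = false, c == t = false & c2 == t = false] /\
     [/\ c == y = false, c2 == y = false & c2 == c = false].
  move: R4_uniq; rewrite /= !inE !negb_or ![t == _]eq_sym ![y == c]eq_sym ![y == c2]eq_sym [c == c2]eq_sym.
  by case/and4P => /and3P[/negbTE-> /negbTE-> /negbTE->] /andP[/negbTE-> /negbTE->] /negbTE->.
have mRE : [/\ mR t = y, mR y = t, mR c = c2 & mR c2 = c].
  by rewrite /mR !eqxx nty ntc ntc2 nyc nyc2 ncc2.
have [mRt mRy mRc mRc2] := mRE.
have rS : [/\ r y t, r c2 c & r b t /\ r d y] by rewrite ![r y t](csym G) ![r c2 c](csym G) ![r b t](csym G) ![r d y](csym G).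
have [ryt rc2c [rbt rdy]] := rS.
have rgc : r g c by rewrite (csym G).
have rc32 : r c3 c2 by rewrite (csym G).
have rW (x : T) : (x \in V :\: W4) = (x \in [:: t; y; c; c2]).
  rewrite !in_setD in_set; case xR: (x \in [:: t; y; c; c2]) => /=; first by rewrite (RV xR).
  by case: (x \in V).
have fin outs ps : {in W4, outs =i outsL L4 m'} -> unzip1 ps = outs ->
   side (V :\: W4) r mR (unzip2 ps) -> uniq outs -> uniq (unzip2 ps) ->
   all (fun p : T * T => [&& p.1 \in W4, p.2 \notin W4 & r p.1 p.2]) ps ->
   (u \notin outs) -> (c \notin unzip2 ps) || ((c3, c2) \in ps) ->
   exists m, [/\ pm W4 r4 m' /\ {in CC, forall C, hit m' C}, pm V r m, m u = v,
   (forall C, all [in W4] C -> cycle r C -> hit m' C -> hit m C) &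
   m c2 = c3 \/ m c = c2].
  move=> E e1 S2 u1 u2 al uo cps.
  have S1 : side W4 r m' (unzip1 ps) by rewrite e1; exact: (side_new (subxx _) L4_new pm' E).
  have uu1 : uniq (unzip1 ps) by rewrite e1.
  have [m [pmm m1 m2 mp]] := glue G sW4 S1 S2 uu1 u2 al.
  rewrite e1 in m1.
  exists m; split => //.
  - by rewrite m1 ?uW4.
  - by move=> C; exact: (hit_new G (subxx _) L4_new pm' E m1).
  case/orP: cps => [cps|/mp[_ /= ->]]; last by left.
  by right; rewrite m2 // rW !inE eqxx !orbT.
have pin x : x \in [:: t; y; c; c2] -> x \notin W4 by move=> xR; rewrite in_setD in_set xR.
have inR : [/\ t \in [:: t; y; c; c2], y \in [:: t; y; c; c2], c \in [:: t; y; c; c2] & c2 \in [:: t; y; c; c2]].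
  by rewrite !inE !eqxx !orbT.
have [tR yR cR c2R] := inR.
have sR (outs : seq T) : (t \in outs) = (y \in outs) -> (c \in outs) = (c2 \in outs) ->
    side (V :\: W4) r mR outs.
  move=> h1 h2 x; rewrite rW => xR; rewrite !inE in xR; move: xR => /or4P[]/eqP-> xo;
    rewrite ?mRt ?mRy ?mRc ?mRc2 rW; split => //; [by rewrite -h1 | by rewrite h1 | by rewrite -h2 | by rewrite h2].
have uo : u \notin outsL L4 m'.
  rewrite -(usedE L4_new pm' uW4); apply/negP => /(new_notr G L4_new) /(_ uW4).
  by rewrite mu uv => /(_ vW4).
have uE outs : {in W4, outs =i outsL L4 m'} -> u \notin outs by move=> E; rewrite E ?uW4.
have inL : [/\ (b, d) \in L4 & (g, c3) \in L4] by rewrite !inE !eqxx !orbT.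
have [bdL gcL] := inL.
have bd : b != d by apply/eqP => e; have h1 := bdL; rewrite -e in h1; have := new_asym L4_new h1 h1.
have gc : g != c3 by apply/eqP => e; have h1 := gcL; rewrite -e in h1; have := new_asym L4_new h1 h1.
have pR : [/\ t \notin W4, y \notin W4, c \notin W4 & c2 \notin W4] by split; apply: pin.
have [tW yW cW c2W] := pR.
case mb : (m' b == d); case mg : (m' g == c3).
- have E : {in W4, [:: b; d; g; c3] =i outsL L4 m'}.
    by move=> x _; rewrite /outsL /= nuh' mb mg /= !inE.
  have dm : m' d = b by apply: (pm_eq pm' bW4); apply/eqP.
  have cm : m' c3 = g by apply: (pm_eq pm' gW4); apply/eqP.
  apply: (fin [:: b; d; g; c3] [:: (b, t); (d, y); (g, c); (c3, c2)]) => //.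
  - by apply: sR; rewrite !inE !eqxx !orbT.
  - have nbg : b != g.
      apply/eqP => e; have e2 : d = c3 by rewrite -(eqP mb) e (eqP mg).
      by have := new_uniq L4_new; rewrite /L4 e e2 /= !inE eqxx andbF.
    have nbc : b != c3.
      apply/eqP => e; have e2 : d = g by rewrite -(eqP mb) e cm.
      by have := new_asym L4_new bdL; rewrite e2 e gcL => /(_ isT).
    rewrite /= !inE !negb_or bd nbg nbc gc !andbT /=; apply/andP; split; apply/eqP => e.
      by move: nbc; rewrite -dm e (eqP mg) eqxx.
    by move: nbg; rewrite -dm e cm eqxx.
  - by rewrite /= bW4 dW4 gW4 c3W4 tW yW cW c2W rbt rdy rgc rc32.
  - exact: uE.
  by rewrite !inE eqxx !orbT.
- have E : {in W4, [:: b; d] =i outsL L4 m'}.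
    by move=> x _; rewrite /outsL /= nuh' mb mg /= !inE.
  apply: (fin [:: b; d] [:: (b, t); (d, y)]) => //.
  - by apply: sR; rewrite !inE ?eqxx ?orbT ?ntc ?ntc2 ?nyc ?nyc2.
  - by rewrite /= inE bd.
  - by rewrite /= inE eq_sym nty.
  - by rewrite /= bW4 dW4 tW yW rbt rdy.
  - exact: uE.
  by rewrite !inE ntc nyc.
- have E : {in W4, [:: g; c3] =i outsL L4 m'}.
    by move=> x _; rewrite /outsL /= nuh' mb mg /= !inE.
  apply: (fin [:: g; c3] [:: (g, c); (c3, c2)]) => //.
  - by apply: sR; rewrite !inE ?eqxx ?orbT // ![t == _]eq_sym ![y == _]eq_sym ?ntc ?ntc2 ?nyc ?nyc2.
  - by rewrite /= inE gc.
  - by rewrite /= inE eq_sym ncc2.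
  - by rewrite /= gW4 c3W4 cW c2W rgc rc32.
  - exact: uE.
  by rewrite !inE eqxx !orbT.
have E : {in W4, [::] =i outsL L4 m'} by move=> x _; rewrite /outsL /= nuh' mb mg.
by apply: (fin [::] [::]) => //; apply: sR.
Qed.

End Red4.

Section Final.
Variables (u v : T) (CC : seq (seq T)).
Hypothesis uv : r u v.
Hypothesis fam : family r CC.

Lemma circ5 C y : circ r C -> y \in C -> exists i c c2 c3 s d,
  rot i C = [:: y, c, c2, c3 & rcons s d].
Proof.
move=> cC yC; have [i [c [s [d E]]]] := circ_at cC yC.
have := cC; rewrite -(circ_rot r i) E => /and3P[uq cc _].
case: s E uq cc => [|c2 [|c3 s]] E uq cc.
- by case/and4P: cc => h1 h2 h3 _; case: (tri h1 h2 h3).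
- case/and5P: cc => h1 h2 h3 h4 _; case: (sq h1 h2 h3 h4).
    by apply: contraTneq uq => ->; rewrite /= !inE eqxx !orbT.
  by apply: contraTneq uq => ->; rewrite /= !inE eqxx !orbT /= andbF.
by exists i, c, c2, c3, s, d.
Qed.

(** The path [t y c c2] is deleted, and both possible mates of [c2] are its neighbours on the
    circuit. The new edge [uh] needs [u] and [h] to be nonadjacent; this is why the third neighbour
    [h] of [c2] must be neither [v] nor [t']. *)
Lemma caseR C D t t' y b c c2 c3 s d :
  uniq [:: v; t; t'] -> (forall x, r u x = (x \in [:: v; t; t'])) ->
  uniq [:: u; y; b] -> (forall x, r t x = (x \in [:: u; y; b])) ->
  (forall C', C' \in CC -> [/\ t \notin C', t' \notin C', v \notin C' & u \notin C']) ->
  C \in CC -> D =i C -> circ r D -> (forall m, pm V r m -> hit m D -> hit m C) ->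
  D = [:: y, c, c2, c3 & rcons s d] -> b \notin C -> ~~ r c2 v -> ~~ r c2 t' ->
  solved u v CC.
Proof.
move=> uNu Nu uNt Nt hT CCC DC cD hD eD bC nv nt'.
have [tC t'C vC uC] := hT C CCC.
rewrite -!DC in bC tC t'C vC uC.
have tu : r t u by rewrite Nt !inE eqxx.
have ty : r t y by rewrite Nt !inE eqxx orbT.
have tb : r t b by rewrite Nt !inE eqxx !orbT.
have [cE] := and3P cD; rewrite eD /= rcons_path last_rcons => /and5P[yc cc2 c23 _ dy] _.
have yd : r y d by rewrite (csym G).
have yt : r y t by rewrite (csym G).
rewrite eD /= !inE !mem_rcons !inE !negb_or in cE.
case/and5P: cE => /and5P[n_yc n_yc2 n_yc3 n_yd _] /and4P[n_cc2 n_cc3 n_cd _] /and3P[n_c23 n_c2d _] _ _.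
have inD x : x \in D -> [/\ x != t, x != u, x != v & x != b].
  by move=> xD; split; apply: contraTneq xD => ->.
have [m1 [m2 m3] [m4 m5]] : [/\ y \in D, c \in D /\ c2 \in D & c3 \in D /\ d \in D].
  by rewrite eD !inE !mem_rcons !inE !eqxx !orbT.
have [yt' yu yv yb] := inD _ m1; have [ct cu cv cb] := inD _ m2.
have [c2t c2u c2v c2b] := inD _ m3; have [c3t c3u c3v c3b] := inD _ m4.
have [dt du dv db] := inD _ m5.
have [uNy Ny] : uniq [:: t; c; d] /\ forall x, r y x = (x \in [:: t; c; d]).
  have [d' [uq N]] : exists d', uniq [:: t; c; d'] /\ forall x, r y x = (x \in [:: t; c; d']).
    by apply: (cnbr2 G) => //; rewrite eq_sym.
  by move: yd; rewrite N !inE (negbTE dt) eq_sym (negbTE n_cd) => /eqP ->.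
have cy : r c y by rewrite (csym G).
have c2c : r c2 c by rewrite (csym G).
have [g [uNc Nc]] := cnbr2 G cy cc2 n_yc2.
have [h [uNd Nd]] := cnbr2 G c2c c23 n_cc3.
have cg : r c g by rewrite Nc !inE eqxx !orbT.
have c2h : r c2 h by rewrite Nd !inE eqxx !orbT.
have bt : r b t by rewrite (csym G).
have ut : r u t by rewrite (csym G).
have gc : r g c by rewrite (csym G).
have [gy gc2] : g != y /\ g != c2.
  by move: uNc; rewrite /= !inE !negb_or ![g == _]eq_sym => /and3P[/andP[_ ->] -> _].
have [hc hc3] : h != c /\ h != c3.
  by move: uNd; rewrite /= !inE !negb_or ![h == _]eq_sym => /and3P[/andP[_ ->] -> _].
have [uy ub yb'] : [/\ u != y, u != b & y != b].
  by move: uNt; rewrite /= !inE !negb_or => /and3P[/andP[-> ->] -> _].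
have gt : g != t by apply/eqP => e; subst g; exact: (tri ty yc cg).
have hy : h != y by apply/eqP => e; subst h; exact: (tri yc cc2 c2h).
have ht : h != t.
  apply/eqP => e; subst h; move: c2h; rewrite (csym G) Nt !inE (negbTE c2u) (negbTE c2b).
  by rewrite eq_sym (negbTE n_yc2).
have hu : h != u.
  apply/eqP => e; subst h; move: (c2h); rewrite (csym G) Nu !inE (negbTE c2v) (negbTE c2t) /=.
  by move=> /eqP e; move: t'C; rewrite -e m3.
have gu : g != u.
  by apply/eqP => e; subst g; apply: (sq ut ty yc cg); rewrite eq_sym.
have nbg : b != g.
  by apply/eqP => e; subst g; apply: (sq bt ty yc cg); rewrite eq_sym.
have ngc3 : g != c3.
  by apply/eqP => e; subst g; apply: (tri cc2 c23); rewrite (csym G).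
have b_d : ~~ r b d.
  apply/negP => rbd; apply: (@sq b t y d) => //; first by rewrite (csym G).
    by rewrite eq_sym.
  by rewrite eq_sym.
have g_c3 : ~~ r g c3.
  by apply/negP => rgc3; apply: (sq gc cc2 c23 _ gc2 n_cc3); rewrite (csym G).
have u_h : ~~ r u h.
  rewrite Nu !inE !negb_or ht; apply/and3P; split=> //.
    by apply: contraNneq nv => <-.
  by apply: contraNneq nt' => <-.
have uR4 : uniq [:: t; y; c; c2].
  by rewrite /= !inE !negb_or ![t == _]eq_sym yt' ct c2t n_yc n_yc2 n_cc2.
have inW4 x : x \in V -> x != t -> x \notin [:: y; c; c2] -> x \in W4 t y c c2.
  by move=> xV xt xR; rewrite in_setD in_set in_cons negb_or xt xV xR.
have notD x : x \notin D -> x \notin [:: y; c; c2].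
  by apply: contra; rewrite eD !inE => /or3P[]->; rewrite ?orbT.
have uW : u \in W4 t y c c2 by apply: inW4; rewrite ?(csup G uv) ?(cneq G ut) ?notD.
have vW : v \in W4 t y c c2.
  apply: inW4; rewrite ?(csupr G uv) ?notD //.
  by move: uNu; rewrite /= !inE negb_or => /and3P[/andP[-> _] _ _].
have bW : b \in W4 t y c c2 by apply: inW4; rewrite ?(csup G bt) ?(cneq G bt) ?notD.
have dW : d \in W4 t y c c2.
  by apply: inW4; rewrite ?(csupr G yd) ?dt // !inE !negb_or ![d == _]eq_sym n_yd n_cd n_c2d.
have gW : g \in W4 t y c c2.
  by apply: inW4; rewrite ?(csupr G cg) ?gt // !inE !negb_or gy gc2 eq_sym (cneq G cg).
have hW : h \in W4 t y c c2.
  by apply: inW4; rewrite ?(csupr G c2h) ?ht // !inE !negb_or hy hc eq_sym (cneq G c2h).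
have c3W : c3 \in W4 t y c c2.
  by apply: inW4; rewrite ?(csupr G c23) ?c3t // !inE !negb_or ![c3 == _]eq_sym n_yc3 n_cc3 n_c23.
have Lnew : new_edges r (W4 t y c c2) (W4 t y c c2) (L4 u b d g h c3).
  rewrite /new_edges /= uW bW dW gW hW c3W /= u_h b_d g_c3 /= andbT !inE !xpair_eqE.
  rewrite (negbTE ub) ![u == _]eq_sym (negbTE hu) (negbTE gu) (negbTE du) (negbTE c3u).
  rewrite (negbTE nbg) ![b == _]eq_sym (negbTE db) (negbTE c3b) (negbTE ngc3) ?andbF /=.
  by [].
pose CC' := [seq C' <- CC | C' != C].
have sCC : {subset CC' <= CC} by move=> C'; rewrite mem_filter => /andP[].
have alW : {in CC', forall C', all [in W4 t y c c2] C'}.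
  move=> C'; rewrite mem_filter => /andP[nC CCC']; apply/allP => x xC'.
  have [tC' _ _ _] := hT _ CCC'.
  apply: inW4; first exact: (circ_sub G (fam.1 _ CCC')).
    by apply: contraNneq tC' => <-.
  apply: notD; rewrite DC; apply: contra nC => xC; apply/eqP; exact: (fam.2 _ _ x).
have [|m' [m [[_ hC'] pmm mu hh cs]]] :=
   red4_solve uv uNt Nt uNy Ny uNc Nc uNd Nd uR4 vW Lnew u_h (family_new fam (L4 u b d g h c3) sCC alW).
  by move=> C' /sCC CCC'; exists u => //; case: (hT _ CCC').
exists m; split => // C' CCC'.
case: (eqVneq C' C) => [->|nC].
  apply: hD => //; rewrite eD /hit /= /off.
  by case: cs => ->; rewrite eqxx ?andbF.
have C'in : C' \in CC' by rewrite mem_filter nC.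
by apply: hh (hC' _ C'in); [exact: alW | case/and3P: (fam.1 _ CCC')].
Qed.

End Final.

Theorem c5_solved u v CC : r u v -> family r CC -> {in CC, forall C, cycle (noe u v) C} ->
  solved u v CC.
Proof.
move=> uv fam famN.
have vu : r v u by rewrite (csym G).
have famN' : {in CC, forall C, cycle (noe v u) C}.
  move=> C /famN; apply: sub_cycle => x y; by rewrite /noe orbC.
have flip : solved v u CC -> solved u v CC.
  by move=> [m [pmm mv h]]; exists m; split => //; apply: pm_eq pmm _ mv; exact: csup vu.
have [t [t' [uNu Nu]]] := cnbr1 G uv.
have [w [w' [vNv Nv]]] := cnbr1 G vu.
have [ut ut'] : r u t /\ r u t' by rewrite !Nu !inE !eqxx !orbT.
have [vw vw'] : r v w /\ r v w' by rewrite !Nv !inE !eqxx !orbT.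
have [vt vt' tt'] : [/\ v != t, v != t' & t != t'].
  by move: uNu; rewrite /= !inE !negb_or => /and3P[/andP[-> ->] -> _].
have [uw uw' _] : [/\ u != w, u != w' & w != w'].
  by move: vNv; rewrite /= !inE !negb_or => /and3P[/andP[-> ->] -> _].
pose on x := has (fun C => x \in C) CC.
have c1 x : r u x -> v != x -> on x -> solved u v CC.
  by move=> ux vx /hasP[C CCC xC]; exact: (case1 uv fam famN ux vx CCC xC).
have c1' x : r v x -> u != x -> on x -> solved u v CC.
  by move=> ux vx /hasP[C CCC xC]; apply: flip; exact: (case1 vu fam famN' ux vx CCC xC).
have notin x C : ~~ on x -> C \in CC -> x \notin C.
  by move=> /hasPn h /h.
case: (boolP (on t)) => [/(c1 _ ut vt)//|nt].
case: (boolP (on t')) => [/(c1 _ ut' vt')//|nt'].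
case: (boolP (on w)) => [/(c1' _ vw uw)//|nw].
case: (boolP (on w')) => [/(c1' _ vw' uw')//|nw'].
(* A circuit through an end of [uv] would contain the other neighbours of that end, and these lie on
   no circuit. *)
have hT C : C \in CC -> [/\ t \notin C, t' \notin C, v \notin C & u \notin C].
  move=> CCC; split; [exact: notin nt CCC | exact: notin nt' CCC | |].
    apply/negP => vC; have := notin w C nw CCC.
    by rewrite (noe_nbr vu vw uw (fam.1 _ CCC) (famN' _ CCC) vC).
  apply/negP => uC; have := notin t C nt CCC.
  by rewrite (noe_nbr uv ut vt (fam.1 _ CCC) (famN _ CCC) uC).
have tu : r t u by rewrite (csym G).
have [y [b [uNt Nt]]] := cnbr1 G tu.
have [ty tb] : r t y /\ r t b by rewrite !Nt !inE !eqxx !orbT.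
have [uy ub yb] : [/\ u != y, u != b & y != b].
  by move: uNt; rewrite /= !inE !negb_or => /and3P[/andP[-> ->] -> _].
have yu : y != u by rewrite eq_sym.
have bu : b != u by rewrite eq_sym.
have ntC C : C \in CC -> t \notin C by move=> h; exact: notin nt h.
case: (boolP (on y)) => [/hasP[C CCC yC]|ny]; last first.
  by apply: (case2a uv fam famN ut vt ty yu ntC) => C h; exact: notin ny h.
case: (boolP (on b)) => [onb|nb]; last first.
  by apply: (case2a uv fam famN ut vt tb bu ntC) => C0 h; exact: notin nb h.
case: (boolP (b \in C)) => bC.
  exact: (case2b uv fam famN ut vt ty tb yu bu yb ntC CCC yC bC).
have [i [c [c2 [c3 [s [d E]]]]]] := circ5 (fam.1 _ CCC) yC.
have mC : rot i C =i C by move=> x; rewrite mem_rot.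
have cE : circ r (rot i C) by rewrite circ_rot; exact: fam.1.
have nov c0 : c0 \in C -> ~~ r c0 v.
  move=> c0C; rewrite (csym G) Nv !inE !negb_or; apply/and3P.
  split; apply: contraTneq c0C => ->; [by case: (hT _ CCC)|exact: notin nw CCC|exact: notin nw' CCC].
have c2C : c2 \in C by rewrite -mC E !inE eqxx !orbT.
(* The path [t y c c2] serves unless [c2] is adjacent to [t']. In that case [C] is followed from [y]
   in the other direction, through [d] and [d2]. *)
case: (boolP (r c2 t')) => [c2t'|nc2]; last first.
  apply: (caseR uv fam uNu Nu uNt Nt hT CCC mC cE _ E bC (nov _ c2C) nc2) => m _.
  by rewrite hit_rot.
have [d2 [s' Es]] : exists d2 s', c3 :: s = rcons s' d2 by case: (lastP s) => [|s0 z]; [exists c3, [::] | exists z, (c3 :: s0)].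
have E' : rot i C = [:: y, c, c2 & rcons (rcons s' d2) d] by rewrite E -Es.
have d2C : d2 \in C by rewrite -mC E' !(inE, mem_rcons) eqxx !orbT.
have c2d2 : c2 != d2.
  have := and3P cE => -[+ _ _]; rewrite E' /= !(inE, mem_rcons) !negb_or.
  by case/and4P => _ _ /and3P[_ -> _].
(* If [c2] and [d2] are both adjacent to [t'], they are its two neighbours besides [u], and both lie
   on [C]: this is [case2b] at [t']. *)
case: (boolP (r d2 t')) => [d2t'|nd2].
  have [u_c2 u_d2] : c2 != u /\ d2 != u.
    by split; apply: contraTneq (c2C) => e; [rewrite e|move: d2C; rewrite e]; case: (hT _ CCC) => // _ _ _ /negbTE->.
  apply: (case2b uv fam famN ut' vt' _ _ u_c2 u_d2 c2d2 _ CCC c2C d2C); rewrite ?(csym G t') //.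
  by move=> C0 h; exact: notin nt' h.
pose D := rotr 1 (rev (rot i C)).
have [c4 [s4 Es4]] : exists c4 s4, rcons (rev s') c2 = c4 :: s4.
  by case: (rev s') => [|z s0]; [exists c2, [::] | exists z, (rcons s0 c2)].
have ED : D = [:: y, d, d2, c4 & rcons s4 c].
  by rewrite /D E' -!rcons_cons !rev_rcons !rev_cons -!rcons_cons rotr1_rcons /= Es4.
apply: (caseR uv fam uNu Nu uNt Nt hT CCC _ _ _ ED bC (nov _ d2C) nd2).
- by move=> x; rewrite /D mem_rotr mem_rev mC.
- by rewrite /D /rotr circ_rot (circ_rev _ G).
move=> m pmm; rewrite /D /rotr hit_rot (hit_rev pmm) ?hit_rot //.
exact: circ_sub cE.
Qed.
End C5.

(** * Graphs with at most six vertices *)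

Section Small.
Variable T : finType.
Implicit Types (X : {set T}) (x z : T) (m : T -> T) (s : seq T).

Lemma mem_full (V : {set T}) s : uniq s -> {subset s <= V} -> #|V| <= size s ->
  forall x, x \in V -> x \in s.
Proof.
move=> us sV le x; have sub : [set z in s] \subset V by apply/subsetP => z; rewrite inE => /sV.
have : [set z in s] == V by rewrite eqEcard sub cardsE (card_uniqP us).
by move/eqP => <-; rewrite inE.
Qed.

Variables (V : {set T}) (r : rel T).
Hypothesis G : cgraph V r.
Hypothesis G5 : c5 V r.
Hypothesis V6 : #|V| <= 6.

Lemma card_even : ~~ odd #|V|.
Proof. by rewrite -(odd_cut G (subxx _)) (cutE G) setDv en0r. Qed.

(** The triangle has cut 3, so at most two vertices remain, and the order is even. *)
Lemma triangle_small x y z : r x y -> r y z -> r z x -> #|V| <= 4.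
Proof.
move=> xy yz zx; have xV := csup G xy; have yV := csup G yz; have zV := csup G zx.
have nx : x \notin [set y; z] by rewrite !inE negb_or (cneq G xy) eq_sym (cneq G zx).
have := @cutU1 _ _ _ G [set y; z] x xV nx; rewrite (cut_set2 G) ?(cneq G yz) //.
rewrite big_setU1 ?inE ?(cneq G yz) //= big_set1 xy (csym G x) zx yz => E.
have sX : x |: [set y; z] \subset V by apply/subsetP => a; rewrite !inE => /or3P[]/eqP->.
have cX : #|x |: [set y; z]| = 3 by rewrite cardsU1 nx cards2 (cneq G yz).
have [] := G5 sX.
- by move: (cut _ _) E; clear; lia.
- by rewrite cX.
have := card_even; rewrite cardsD (setIidPr sX) cX; clear -V6; lia.
Qed.

(** On a circuit of length 4 or 5 a chord makes a triangle. So, if [C] is missed, all mates of its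
    vertices lie off [C], which gives [2 * size C <= 6]. Then [C] is a triangle in a graph with six
    vertices, against [triangle_small]. *)
Lemma small_hit m C : pm V r m -> circ r C -> (exists2 x, x \in V & x \notin C) -> hit m C.
Proof.
move=> pmm cC [x0 x0V x0C]; apply/negP => oC.
have CV := circ_sub G cC; have [uC cc sC] := and3P cC.
have lt : size C < #|V|.
  rewrite ltnNge; apply: contra x0C => le; exact: (mem_full uC CV le).
have mE a b : a \in V -> m a != b -> m b != a \/ b \notin V.
  move=> aV nab; case bV: (b \in V); last by right.
  by left; apply: contra nab => /eqP e; apply/eqP; apply: pm_eq pmm bV e.
have mm a : a \in V -> m a != a.
  by move=> aV; rewrite eq_sym; apply: (cneq G); case: (pmm a aV).
have rm a : a \in V -> r a (m a) by move=> aV; case: (pmm a aV).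
suff noC x : x \in C -> m x \notin C.
  have u2 : uniq (C ++ map m C).
    rewrite cat_uniq uC map_inj_in_uniq ?uC ?andbT //; last first.
      by move=> a b aC bC; apply: (pm_inj pmm); exact: CV.
    by apply/hasPn => y /mapP[x xC ->]; apply: noC.
  have : #|[set z in C ++ map m C]| <= #|V|.
    apply/subset_leq_card/subsetP => y; rewrite inE mem_cat => /orP[/CV//|/mapP[x xC ->]].
    exact: csupr (rm x (CV x xC)).
  rewrite cardsE (card_uniqP u2) size_cat size_map => le2.
  have s3 : size C = 3 by clear -le2 V6 sC; lia.
  case: C s3 cc {uC oC sC CV lt noC u2 cC x0C} le2 => [|a [|b [|c []]]] //= _ /and4P[ab bc ca _].
  by have := triangle_small ab bc ca; clear; lia.
have C5 : size C <= 5 by clear -lt V6; lia.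
have ntri : 3 < size C -> forall a b c, r a b -> r b c -> r c a -> False.
  move=> s3 a b c ab bc ca; have := triangle_small ab bc ca; clear -s3 lt; lia.
move=> xC; apply/negP => mxC.
have [i [a [s [z E]]]] := circ_at cC xC.
have xV := CV x xC; have mx := rm x xV; have mxx := mm x xV.
have CVr y : y \in rot i C -> y \in V by rewrite mem_rot; apply: CV.
move: cc oC mxC C5 ntri CVr; rewrite -(size_rot i) -(rot_cycle i) -(rot_cycle i (off m)) -(mem_rot i) E.
rewrite /= !rcons_path !last_rcons size_rcons inE (negbTE mxx) inE mem_rcons inE.
move=> /and3P[xa pa zx] /and3P[nxa _ nzx] + C5 ntri CVr.
rewrite /off in nxa; rewrite (negbTE nxa) /=.
have zV : z \in V by apply: CVr; rewrite !(inE, mem_rcons) eqxx !orbT.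
have nxz : m x == z = false.
  by apply/negP => /eqP e; move: nzx; rewrite /off (pm_eq pmm xV e) eqxx.
rewrite nxz /=.
case: s pa C5 ntri {E CVr} => [|b [|c [|d s]]] //= pa C5 ntri; rewrite !inE.
  move=> /eqP e; rewrite e in mx; case/andP: pa => /andP[ab _] _.
  by apply: (ntri isT x a b) => //; rewrite (csym G).
case/andP: pa => /and3P[ab bc _] cz /orP[]/eqP e; rewrite e in mx.
  by apply: (ntri isT x a b) => //; rewrite (csym G).
by apply: (ntri isT x c z).
Qed.

(** Four vertices form a complete graph, and [tt'] completes [uv]. On six vertices triangles are
    excluded, so [t] and [t'] are adjacent to both [w] and [w'], and [tw], [t'w'] complete [uv]. *)
Lemma small_pm u v : r u v -> exists2 m, pm V r m & m u = v.
Proof.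
move=> uv; have vu : r v u by rewrite (csym G).
have [t [t' [uNu Nu]]] := cnbr1 G uv.
have [w [w' [vNv Nv]]] := cnbr1 G vu.
have uV := csup G uv; have vV := csup G vu.
have [ut ut'] : r u t /\ r u t' by rewrite !Nu !inE !eqxx !orbT.
have [vw vw'] : r v w /\ r v w' by rewrite !Nv !inE !eqxx !orbT.
have [tV t'V] := (csupr G ut, csupr G ut'); have [wV w'V] := (csupr G vw, csupr G vw').
have nu x : r u x -> u != x by move=> h; exact: (cneq G h).
have nv x : r v x -> v != x by move=> h; exact: (cneq G h).
have u4 : uniq [:: u; v; t; t'] by rewrite cons_uniq uNu !inE !negb_or !nu.
have V4 : {subset [:: u; v; t; t'] <= V} by move=> x; rewrite !inE => /or4P[]/eqP->.
have le4 : 4 <= #|V|.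
  have <- : size [:: u; v; t; t'] = 4 by [].
  by rewrite -(card_uniqP u4); apply/subset_leq_card/subsetP.
have := u4; rewrite /= !inE !negb_or => /and4P[/and3P[n_uv n_ut n_ut'] /andP[n_vt n_vt'] n_tt' _].
have : #|V| = 4 \/ #|V| = 6 by have := card_even; clear -le4 V6; lia.
case=> cV.
  have full := mem_full u4 V4; rewrite cV in full; have {}full := full isT.
  have tt' : r t t'.
    have [p [q [uq N]]] := cnbr1 G (etrans (csym G t u) ut : r t u).
    have tp x : r t x -> x \in [:: u; v; t'].
      move=> tx; have := full x (csupr G tx); rewrite !inE.
      by rewrite [x == t]eq_sym (negbTE (cneq G tx)).
    rewrite N; have mem : {subset [:: u; p; q] <= [:: u; v; t']} by move=> x; rewrite -N; apply: tp.
    by rewrite (uniq_min_size uq mem _).2 // !inE eqxx !orbT.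
  exists (fun x => if x == u then v else if x == v then u else if x == t then t' else t) => [x xV|]; last by rewrite eqxx.
  have := full x xV; rewrite !inE => /or4P[]/eqP->; rewrite ?eqxx.
  - by rewrite [v == u]eq_sym (negbTE n_uv).
  - by rewrite [v == u]eq_sym (negbTE n_uv) eqxx.
  - rewrite ![t == _]eq_sym (negbTE n_ut) (negbTE n_vt) ![t' == _]eq_sym (negbTE n_ut') (negbTE n_vt').
    by rewrite (negbTE n_tt').
  rewrite ![t' == _]eq_sym (negbTE n_ut') (negbTE n_vt') (negbTE n_tt').
  by rewrite ![t == _]eq_sym (negbTE n_ut) (negbTE n_vt) eqxx (csym G).
have ntri a b c : r a b -> r b c -> r c a -> False.
  by move=> ab bc ca; have := triangle_small ab bc ca; rewrite cV.
have ne x y : r u x -> r v y -> x != y.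
  by move=> ux vy; apply/eqP => e; subst y; apply: (ntri u v x) => //; rewrite (csym G).
have := vNv; rewrite /= !inE !negb_or => /and3P[/andP[n_uw n_uw'] n_ww' _].
have u6 : uniq [:: u; v; t; t'; w; w'].
  by rewrite /= !inE !negb_or n_uv n_ut n_ut' n_uw n_uw' n_vt n_vt' n_tt' n_ww' !ne //.
have V6' : {subset [:: u; v; t; t'; w; w'] <= V}.
  by move=> x; rewrite !inE => /or4P[/eqP->|/eqP->|/eqP->|/or3P[]/eqP->].
have full := mem_full u6 V6'; rewrite cV in full; have {}full := full isT.
have adjt a a' : r u a -> (a == t) && (a' == t') || (a == t') && (a' == t) -> r a w /\ r a w'.
  move=> ua aa.
  have [p [q [uq N]]] := cnbr1 G (etrans (csym G a u) ua : r a u).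
  have tp x : r a x -> x \in [:: u; w; w'].
    move=> tx; have := full x (csupr G tx); rewrite !inE.
    have nv' : x == v = false.
      apply/negP => /eqP e; subst x; apply: (ntri u a v) => //.
    have nn : r u x -> False by move=> ux; apply: (ntri u a x) => //; rewrite (csym G).
    have nxt : x == t = false by apply/negP => /eqP e; subst x; apply: nn.
    have nxt' : x == t' = false by apply/negP => /eqP e; subst x; apply: nn.
    by rewrite nv' nxt nxt'.
  have mem : {subset [:: u; p; q] <= [:: u; w; w']} by move=> x; rewrite -N; apply: tp.
  by rewrite !N !(uniq_min_size uq mem _).2 // !inE !eqxx !orbT.
have [tw _] := adjt t t' ut ltac:(by rewrite !eqxx).
have [_ tw'] := adjt t' t ut' ltac:(by rewrite !eqxx orbT).
move: u6; rewrite /= !inE !negb_or => /and5P[/and5P[h1 h2 h3 h4 h5] /and4P[h6 h7 h8 h9] /and3P[h10 h11 h12] /andP[h13 h14] /andP[h15 _]].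
exists (fun x => if x == u then v else if x == v then u else if x == t then w else
   if x == w then t else if x == t' then w' else t') => [x xV|]; last by rewrite eqxx.
have neb (a b : T) : a != b -> (a == b = false) * (b == a = false).
  by rewrite [b == a]eq_sym => /negbTE->.
have E := (neb _ _ h1, neb _ _ h2, neb _ _ h3, neb _ _ h4, neb _ _ h5, neb _ _ h6, neb _ _ h7,
  neb _ _ h8, neb _ _ h9, neb _ _ h10, neb _ _ h11, neb _ _ h12, neb _ _ h13, neb _ _ h14, neb _ _ h15, eqxx).
have := full x xV; rewrite !inE => /or4P[/eqP->|/eqP->|/eqP->|/or3P[]/eqP->]; rewrite !E //.
- by rewrite (csym G).
- by rewrite (csym G).
Qed.

Lemma small_hits : hits_all V r.
Proof.
move=> u v CC uv [fam _] nH; have [m pmm mu] := small_pm uv.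
by exists m; split => // C CCC; apply: (small_hit pmm); [exact: fam | exact: nH].
Qed.

End Small.

(** * Gluing along a cut *)

Section CutData.
Variable T : finType.
Implicit Types (V W R X Y : {set T}) (r : rel T) (x y z u v n : T).
Implicit Types (m : T -> T) (C : seq T) (CC : seq (seq T)) (L ps : seq (T * T)).

Definition swaps ps : seq (T * T) := [seq (p.2, p.1) | p <- ps].

(** The cut edges are listed with the end in [W] first. By [cd1] and [cd2] they are pairwise
    disjoint, so that replacing a side by a vertex creates no parallel edges. *)
Record cutdata V r W R ps : Prop := CutData {
  cdU : W :|: R = V;
  cdD : forall x, x \in W -> x \notin R;
  cd1 : uniq (unzip1 ps);
  cd2 : uniq (unzip2 ps);
  cdm : forall x y, (x, y) \in ps -> x \in W /\ y \in R;
  cda : forall x y, x \in W -> y \in R -> r x y = ((x, y) \in ps) }.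

Lemma mem_swaps ps x y : ((x, y) \in swaps ps) = ((y, x) \in ps).
Proof.
apply/mapP/idP => [[[a b] ab [-> ->]]//|h]; by exists (y, x).
Qed.

Lemma unzip1_swaps ps : unzip1 (swaps ps) = unzip2 ps.
Proof. by rewrite /swaps /unzip1 -map_comp. Qed.

Lemma unzip2_swaps ps : unzip2 (swaps ps) = unzip1 ps.
Proof. by rewrite /swaps /unzip2 -map_comp. Qed.

Lemma size_swaps ps : size (swaps ps) = size ps.
Proof. by rewrite size_map. Qed.

Lemma cutdata_sym V r W R ps : cgraph V r -> cutdata V r W R ps ->
  cutdata V r R W (swaps ps).
Proof.
move=> G [h1 h2 h3 h4 h5 h6]; split.
- by rewrite setUC.
- by move=> x xR; apply/negP => /h2; rewrite xR.
- by rewrite unzip1_swaps.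
- by rewrite unzip2_swaps.
- by move=> x y; rewrite mem_swaps => /h5[].
by move=> x y xR yW; rewrite (csym G) h6 // mem_swaps.
Qed.

Lemma cutdata_perm V r W R ps ps' : perm_eq ps ps' -> cutdata V r W R ps ->
  cutdata V r W R ps'.
Proof.
move=> e [h1 h2 h3 h4 h5 h6]; have em := perm_mem e; split => //.
- by rewrite -(perm_uniq (perm_map fst e)).
- by rewrite -(perm_uniq (perm_map snd e)).
- by move=> x y; rewrite -em; exact: h5.
by move=> x y xW yR; rewrite -em; exact: h6.
Qed.

Lemma cut_pairs V r W : cgraph V r -> W \subset V ->
  (forall x, x \in W -> \sum_(y in V :\: W) r x y <= 1) ->
  (forall y, y \in V :\: W -> \sum_(x in W) r y x <= 1) ->
  exists2 ps, size ps = cut r W & cutdata V r W (V :\: W) ps.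
Proof.
move=> G sW o1 o2.
pose S := [set p : T * T | [&& p.1 \in W, p.2 \in V :\: W & r p.1 p.2]].
have one (Z : {set T}) z a b : \sum_(y in Z) r z y <= 1 -> a \in Z -> b \in Z -> r z a -> r z b -> a = b.
  move=> le aZ bZ za zb; apply/eqP; apply: contraLR le => nab.
  rewrite (bigD1 a) //= (bigD1 b) ?bZ 1?eq_sym //= za zb; lia.
exists (enum S).
  rewrite -cardE (cutE G) /en -sum1_card.
  rewrite (pair_big (mem W) (mem (V :\: W)) (fun x y => (r x y : nat))) /=.
  rewrite [LHS]big_mkcond [RHS]big_mkcond /=; apply: eq_bigr => -[x y] _ /=.
  by rewrite !inE /=; case: (x \in W); case: (y \in W); case: (y \in V); case: (r x y).
split.
- by rewrite -{1}(setIidPr sW) setID.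
- by move=> x xW; rewrite inE xW.
- rewrite map_inj_in_uniq ?enum_uniq // => -[a b] [c d]; rewrite !mem_enum !inE /=.
  move=> /and3P[aW /andP[bW bV] ab] /and3P[cW /andP[dW dV] cd] ac; subst c.
  by congr pair; apply: (one _ _ _ _ (o1 a aW)) => //; rewrite inE ?bW ?dW.
- rewrite map_inj_in_uniq ?enum_uniq // => -[a b] [c d]; rewrite !mem_enum !inE /=.
  move=> /and3P[aW /andP[bW bV] ab] /and3P[cW /andP[dW dV] cd] ac; subst d.
  by congr pair; apply: (one _ _ _ _ (o2 b _)) => //; rewrite ?inE ?bW // (csym G).
- by move=> x y; rewrite mem_enum inE /= => /and3P[].
by move=> x y xW yR; rewrite mem_enum inE /= xW yR.
Qed.

Section Data.
Variables (V : {set T}) (r : rel T) (W R : {set T}) (ps : seq (T * T)).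
Hypothesis G : cgraph V r.
Hypothesis D : cutdata V r W R ps.

Lemma cd_sW : W \subset V.
Proof. by rewrite -(cdU D) subsetUl. Qed.

Lemma cd_R : R = V :\: W.
Proof.
apply/setP => x; rewrite -(cdU D) !inE; case xW: (x \in W) => //=.
by apply/negbTE/(cdD D).
Qed.

Lemma cd_r x y : (x, y) \in ps -> r x y.
Proof. by move=> h; have [xW yR] := cdm D h; rewrite (cda D). Qed.

Lemma cd_inj1 x y y' : (x, y) \in ps -> (x, y') \in ps -> y = y'.
Proof.
have := cd1 D; elim: ps => //= -[a b] s IHs /andP[na us]; rewrite !inE !xpair_eqE.
case/orP => [/andP[/eqP ea /eqP eb]|h] /orP[/andP[/eqP ea' /eqP eb']|h'].
- by rewrite eb eb'.
- by move: na; rewrite /= -ea => /mapP[]; exists (x, y').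
- by move: na; rewrite /= -ea' => /mapP[]; exists (x, y).
exact: IHs.
Qed.

Lemma cd_inj2 x x' y : (x, y) \in ps -> (x', y) \in ps -> x = x'.
Proof.
have := cd2 D; elim: ps => //= -[a b] s IHs /andP[na us]; rewrite !inE !xpair_eqE.
case/orP => [/andP[/eqP ea /eqP eb]|h] /orP[/andP[/eqP ea' /eqP eb']|h'].
- by rewrite ea ea'.
- by move: na; rewrite /= -eb => /mapP[]; exists (x', y).
- by move: na; rewrite /= -eb' => /mapP[]; exists (x, y).
exact: IHs.
Qed.

Lemma out_sum x : x \in W -> \sum_(y in ~: W) r x y = \sum_(p <- ps) (x == p.1).
Proof.
move=> xW; have -> : \sum_(p <- ps) (x == p.1) = \sum_(p <- ps) \sum_(y in R) (p == (x, y)).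
  apply: eq_big_seq => -[a b] abp /=; have [_ bR] := cdm D abp.
  rewrite eq_sym (bigD1 b) //= xpair_eqE eqxx andbT big1 ?addn0 // => y /andP[_ yb].
  by rewrite xpair_eqE [b == y]eq_sym (negbTE yb) andbF.
rewrite exchange_big /= (bigID (mem R)) /= [X in _ + X]big1 ?addn0.
  apply: eq_big => y; first by rewrite cd_R !inE; case: (y \in W); case: (y \in V).
  case/andP => _ yR; rewrite (cda D) // -(count_uniq_mem _ (map_uniq (cd1 D))) -sum1_count.
  by rewrite big_mkcond; apply: eq_bigr => p _; rewrite /=.
move=> y /andP[yW yR]; case rxy: (r x y) => //.
by move: yR yW; rewrite cd_R !inE (csupr G rxy) => + yW; rewrite yW.
Qed.

Lemma glue_cut m1 m2 qs : {subset qs <= ps} -> uniq qs ->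
  side W r m1 (unzip1 qs) -> side R r m2 (unzip2 qs) ->
  exists m, [/\ pm V r m,
    forall x, x \in W -> x \notin unzip1 qs -> m x = m1 x,
    forall x, x \in R -> x \notin unzip2 qs -> m x = m2 x &
    forall x y, (x, y) \in qs -> m x = y /\ m y = x].
Proof.
move=> sq uq s1 s2; rewrite cd_R in s2 *.
have [||| m [h1 h2 h3 h4]] := glue G cd_sW s1 s2.
- rewrite map_inj_in_uniq // => -[a b] [c d] /sq h /sq h' /= e; subst c.
  by rewrite (cd_inj1 h h').
- rewrite map_inj_in_uniq // => -[a b] [c d] /sq h /sq h' /= e; subst d.
  by rewrite (cd_inj2 h h').
- apply/allP => -[a b] /sq h /=; have [aW bR] := cdm D h; rewrite aW (cd_r h) andbT.
  by move: bR; rewrite cd_R inE => /andP[].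
exists m; split => // x y h; exact: (h4 (x, y) h).
Qed.

(** [x :: p] is a run of [C] in [R], entered and left by different cut edges. The rest [y :: q]
    starts and ends in [W] but may return to [R]. *)
Definition crossing C i x p y q : Prop :=
  [/\ rot i C = (x :: p) ++ (y :: q), all [in R] (x :: p),
      (last y q, x) \in ps, (y, last x p) \in ps & y != last y q /\ x != last x p].

Lemma crossing_ex C : circ r C -> ~~ all [in W] C -> ~~ all [in R] C ->
  exists i x p y q, crossing C i x p y q.
Proof.
move=> cC nW nR; have CV := circ_sub G cC.
have hW : has [in W] C.
  case/allPn: nR => z zC; rewrite /= cd_R inE (CV z zC) andbT negbK => zW.
  by apply/hasP; exists z.
have [i [x [p [y [q [E aR yW lW]]]]]] := circ_run cC hW nW.
have cE := cC; rewrite -(circ_rot r i) E in cE.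
have aR' : all [in R] (x :: p).
  apply/allP => z zp; have := allP aR z zp; rewrite /= cd_R inE => ->.
  by rewrite CV // -(mem_rot i) E mem_cat zp.
have [uE + sE] := and3P cE; rewrite cycle_cat2 => /and4P[px c1 py c2].
have lR : last x p \in R by apply: (allP aR'); rewrite mem_last.
have xR : x \in R by apply: (allP aR'); rewrite mem_head.
have h1 : (last y q, x) \in ps by rewrite -(cda D).
have h2 : (y, last x p) \in ps by rewrite -(cda D) // (csym G).
exists i, x, p, y, q; split => //.
have lst z s : uniq (z :: s) -> z = last z s -> s = [::].
  case/lastP: s => // s z' /=; rewrite last_rcons mem_rcons inE => /andP[+ _] e.
  by rewrite -e eqxx.
move: uE; rewrite cat_uniq => /and3P[ux _ uy].
(* If the two cut edges had a common end they would coincide, by disjointness, and [C] would consist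
   of two vertices only. *)
suff [a b] : (y = last y q -> False) /\ (x = last x p -> False) by split; apply/eqP.
split=> e; [have e2 : x = last x p | have e2 : y = last y q].
- by apply: (cd_inj1 (x := y)) => //; rewrite {1}e.
- by move: sE; rewrite (lst _ _ ux e2) (lst _ _ uy e).
- by apply: (cd_inj2 (y := x)) => //; rewrite {1}e.
by move: sE; rewrite (lst _ _ ux e) (lst _ _ uy e2).
Qed.

Lemma hit_crossing C i x p y q m : pm V r m -> crossing C i x p y q ->
  [|| ~~ path (off m) x p, ~~ path (off m) y q, m x == last y q | m y == last x p] -> hit m C.
Proof.
move=> pmm [E aR h1 h2 _] hm; rewrite -(hit_rot _ i) E /hit cycle_cat2.
have [lW xR] := cdm D h1; have [yW lR] := cdm D h2.
have V1 z : z \in W -> z \in V by move=> zW; exact: (subsetP cd_sW).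
have V2 z : z \in R -> z \in V by rewrite cd_R inE => /andP[].
apply/negP => /and4P[o1 o2 o3 o4]; move: hm; rewrite o1 o3 /= => /orP[]/eqP e.
  by move: o4; rewrite /off (pm_eq pmm (V2 _ xR) e) eqxx.
by move: o2; rewrite /off (pm_eq pmm (V1 _ yW) e) eqxx.
Qed.

End Data.
End CutData.

(** * Replacing a side of a 3-edge-cut by a vertex *)

Section Close.
Variable T : finType.
Implicit Types (X Y : {set T}) (x y z : T).
Implicit Types (m : T -> T) (C : seq T) (CC : seq (seq T)) (L : seq (T * T)).

Variables (V : {set T}) (r : rel T) (W R : {set T}) (ps : seq (T * T)).
Hypothesis G : cgraph V r.
Hypothesis G3 : tec V r.
Hypothesis D : cutdata V r W R ps.

Lemma sum_ends x : \sum_(p <- ps) (x == p.1) = (x \in unzip1 ps).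
Proof.
rewrite -(count_uniq_mem _ (cd1 D)) -sum1_count big_map /= [RHS]big_mkcond /=.
by apply: eq_bigr => p _; rewrite eq_sym; case: eqP.
Qed.

Lemma cut_sub_ge3 X : X \subset W -> X != set0 -> 2 < #|R| -> 3 <= cut r X.
Proof.
move=> sX X0 R3; apply: G3 => //; first exact: subset_trans sX (cd_sW D).
apply: contraTneq R3 => e; rewrite (cd_R D) -leqNgt.
have -> : V :\: W = set0 by apply/eqP; rewrite setD_eq0 -e.
by rewrite cards0.
Qed.

Lemma circ_close L y q s : path r y q -> all [in W] (y :: q) -> uniq (y :: q) ->
  all [predC W] s -> uniq s -> s != [::] -> y != last y q ->
  path (nrel r W L) (last y q) s -> nrel r W L (last y q) (head y s) -> nrel r W L (last (last y q) s) y ->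
  circ (nrel r W L) (s ++ (y :: q)).
Proof.
move=> pq aW uq aN us s0 yl ps' h1 h2; apply/and3P; split.
- rewrite cat_uniq us uq andbT; apply/hasPn => z zq; apply/negP => zs.
  by have := allP aN z zs; rewrite /= (allP aW z zq).
- case: s s0 aN us ps' h1 h2 => // n s _ _ _ ps' h1 h2; rewrite cycle_cat2.
  have /andP[_ pn] := ps'; apply/and4P; split => //.
  apply: (@sub_in_path _ [in W] r) aW pq => // a b aW bW rab.
  by rewrite /nrel aW bW rab.
case: s s0 {aN us ps' h1 h2} => // n s _; rewrite size_cat.
case: q yl {pq aW uq} => [|a q]; first by rewrite eqxx.
by rewrite /= addSn !addnS.
Qed.

Section Close3.
Hypothesis ps3 : size ps = 3.
Hypothesis R3 : 2 < #|R|.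
Variable n : T.
Hypothesis nR : n \in R.

(* The R-side of the 3-cut is replaced by the single vertex [n]; taking it from R
   avoids extending the ambient type. *)
Definition L3 := [seq (n, p.1) | p <- ps].
Definition V3 := n |: W.
Definition n3 := nrel r W L3.

Lemma nW3 : n \notin W.
Proof. by apply/negP => /(cdD D); rewrite nR. Qed.

Lemma sW3 : W \subset V3. Proof. exact: subsetUr. Qed.

Let endsW x : x \in unzip1 ps -> x \in W.
Proof. by case/mapP => -[a b] /(cdm D)[aW _] ->. Qed.

Lemma memL3 x y : ((x, y) \in L3) = (x == n) && (y \in unzip1 ps).
Proof.
apply/mapP/andP => [[p pp [-> ->]]|[/eqP-> /mapP[p pp ->]]]; last by exists p.
by rewrite eqxx map_f.
Qed.

Lemma L3_new : new_edges r W V3 L3.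
Proof.
apply/andP; split.
  have uL : uniq L3.
    rewrite /L3 map_inj_in_uniq ?(map_uniq (cd1 D)) // => -[a b] [c d] h h' [e]; subst c.
    by rewrite (cd_inj1 D h h').
  rewrite cat_uniq uL map_inj_uniq ?uL ?andbT; last by move=> [a b] [c d] [-> ->].
  apply/hasPn => l /mapP[[a b] ab ->]; rewrite /= memL3; move: ab; rewrite memL3.
  case/andP => /eqP-> /endsW bW; apply/negP => /andP[_ /endsW].
  by rewrite (negbTE nW3).
apply/allP => -[a b]; rewrite memL3 => /andP[/eqP-> /endsW bW] /=.
by rewrite /V3 !inE eqxx bW orbT (negbTE nW3).
Qed.

Let inc3 x : inc L3 x = (x == n) * 3 + (x \in unzip1 ps).
Proof.
rewrite /inc /L3 big_map big_split /= sum_ends big_const_seq count_predT ps3.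
by rewrite iter_addn_0.
Qed.

Lemma hW3 x : x \in W -> \sum_(y in ~: W) r x y = inc L3 x.
Proof.
move=> xW; rewrite (out_sum G D) // sum_ends inc3.
by case: eqP xW nW3 => // -> ->.
Qed.

Lemma n3_cgraph : cgraph V3 n3.
Proof.
apply: (new_cgraph G (cd_sW D) sW3 L3_new hW3) => x; rewrite !inE => /orP[/eqP->|->] // nW.
rewrite inc3 eqxx; case h: (n \in unzip1 ps) => //.
by have := endsW h; rewrite (negbTE nW).
Qed.

(** A set and its complement have the same cut, so one may take the one without [n]. It lies in [W],
    and its cut is the one it has in the original graph. *)
Lemma n3_tec : tec V3 n3.
Proof.
have key X : X \subset V3 -> X != set0 -> n \notin X -> 3 <= cut n3 X.
  move=> sX X0 nX; have sXW : X \subset W.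
    apply/subsetP => x xX; have := subsetP sX x xX; rewrite !inE.
    by case/orP => // /eqP e; rewrite -e xX in nX.
  rewrite (nrel_cut G L3_new) (setIidPl sXW).
  have := cut_sub_ge3 sXW X0 R3; rewrite (old_cut hW3 sXW).
  congr (_ <= _ + _); rewrite /L3 !big_map; apply: eq_bigr => p _ /=.
  by rewrite (negbTE nX).
move=> X sX X0 XV; case nX: (n \in X); last by apply: key; rewrite ?nX.
rewrite -(cutC n3_cgraph sX); apply: key; first exact: subsetDl.
  by rewrite setD_eq0; apply: contra XV => h; rewrite eqEsubset sX.
by rewrite inE nX.
Qed.

Lemma V3_card : #|V3| < #|V|.
Proof.
rewrite /V3 cardsU1 nW3; have := subset_leq_card (cd_sW D).
have := cardsD V W; rewrite -(cd_R D) (setIidPr (cd_sW D)); clear -R3; lia.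
Qed.

(** All new edges meet at [n] and [n] has no other edges, so a perfect matching contains exactly one
    of them. *)
Lemma n3_out m : pm V3 n3 m -> exists2 b, (m n, b) \in ps & {in W, [:: m n] =i outsL L3 m}.
Proof.
move=> pmm; have [] := pmm n; first by rewrite !inE eqxx.
rewrite /n3 /nrel (negbTE nW3) /= !memL3 eqxx /= => h mm.
have mE : m n \in unzip1 ps.
  by case/orP: h => // /andP[_ /endsW]; rewrite (negbTE nW3).
case/mapP: (mE) => -[a b] ab /= ea; exists b; first by rewrite ea.
move=> x xW; rewrite -(usedE L3_new pmm); last exact: (subsetP sW3).
rewrite !memL3 inE; have -> : x == n = false by apply: contraNF nW3 => /eqP <-.
rewrite /=; apply/eqP/andP => [->|[/eqP e _]]; first by rewrite mm mE.
by rewrite -e (pmm x _).2 // (subsetP sW3).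
Qed.

End Close3.
End Close.

(** * Matchings and circuits across a 3-edge-cut *)

Section Glue.
Variable T : finType.
Implicit Types (X Y W R : {set T}) (x y z n : T) (outs : seq T).
Implicit Types (m M : T -> T) (C p q : seq T) (CC : seq (seq T)) (L : seq (T * T)).

(* The property is required of every [M] extending the partial solution because
   the final matching is glued from the solutions of the two sides. *)
Definition ssol (r : rel T) (W : {set T}) (outs : seq T) (Q : (T -> T) -> Prop) : Prop :=
  exists m1, side W r m1 outs /\
    forall M, (forall x, x \in W -> x \notin outs -> M x = m1 x) -> Q M.

(* The second clause is what survives for a circuit crossing the cut: if [m]
   matches two consecutive vertices of its part in W, so does [M]. *)
Definition agrees (r : rel T) (W : {set T}) (F : seq (seq T)) m (outs : seq T) M : Prop :=
  [/\ {in F, forall C, hit M C},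
      forall y q, all [in W] (y :: q) -> path r y q ->
        ~~ path (off m) y q -> ~~ path (off M) y q &
      forall x, x \in W -> x \notin outs -> M x = m x].

Variables (V : {set T}) (r : rel T).
Hypothesis G : cgraph V r.
Hypothesis G3 : tec V r.
Hypothesis IH : forall (V' : {set T}) (r' : rel T),
  #|V'| < #|V| -> cgraph V' r' -> tec V' r' -> hits_all V' r'.

Lemma new_ssol W (V' : {set T}) L outs m (F : seq (seq T)) : W \subset V' -> new_edges r W V' L ->
  pm V' (nrel r W L) m -> {in W, outs =i outsL L m} ->
  {in F, forall C, [/\ all [in W] C, cycle r C & hit m C]} ->
  ssol r W outs (agrees r W F m outs).
Proof.
move=> sW Ln pmm E hF; exists m; split; first exact: (side_new sW Ln pmm E).
move=> M hM; split => // [C /hF[aW cC hC]|y q aW pq].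
  exact: (hit_new G sW Ln pmm E hM).
exact: (phit_new G sW Ln pmm E hM).
Qed.

Lemma glue_ssol W R ps qs Q1 Q2 : cutdata V r W R ps -> {subset qs <= ps} -> uniq qs ->
  ssol r W (unzip1 qs) Q1 -> ssol r R (unzip2 qs) Q2 ->
  exists m, [/\ pm V r m, Q1 m, Q2 m & forall x y, (x, y) \in qs -> m x = y /\ m y = x].
Proof.
move=> D sq uq [m1 [s1 h1]] [m2 [s2 h2]].
have [m [pmm e1 e2 e3]] := glue_cut G D sq uq s1 s2.
by exists m; split; [| apply: h1 | apply: h2 |].
Qed.

Section Families.
Variables (u v : T) (CC : seq (seq T)).
Hypothesis fam : family r CC.

Definition inside (W : {set T}) := [seq C <- CC | all [in W] C].

Lemma inside_sub W : {subset inside W <= CC}.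
Proof. by move=> C; rewrite mem_filter => /andP[]. Qed.

Lemma inside_all W C : C \in inside W -> all [in W] C.
Proof. by rewrite mem_filter => /andP[]. Qed.

(** The circuits in [ES] are closed-up arcs of crossing circuits of [CC], which are disjoint from
    the circuits inside [W]. *)
Lemma family_inside W L (ES : seq (seq T)) :
  {in ES, forall C, circ (nrel r W L) C} ->
  (forall C D x, C \in ES -> D \in ES -> x \in C -> x \in D -> C = D) ->
  (forall E, E \in ES -> exists2 C, C \in CC & ~~ all [in W] C /\
      forall x, x \in W -> x \in E -> x \in C) ->
  family (nrel r W L) (ES ++ inside W).
Proof.
move=> cE dE eE; have [f1 f2] := family_new fam L (@inside_sub W) (@inside_all W).
have dj E C x : E \in ES -> C \in inside W -> x \in E -> x \in C -> False.
  move=> /eE[C0 C0C [nW sub]] CW xE xC; have xW := allP (inside_all CW) x xC.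
  have e := fam.2 _ _ x C0C (inside_sub CW) (sub x xW xE) xC.
  by move: nW; rewrite e (inside_all CW).
split=> [C|C C' x]; rewrite !mem_cat; first by case/orP => [/cE|/f1].
case/orP => h /orP[] h' x1 x2.
- exact: dE x1 x2.
- by case: (dj _ _ _ h h' x1 x2).
- by case: (dj _ _ _ h' h x2 x1).
exact: f2 x1 x2.
Qed.

Lemma inside_cycle W m : {in inside W, forall C, hit m C} ->
  {in inside W, forall C, [/\ all [in W] C, cycle r C & hit m C]}.
Proof.
move=> h C CW; split; [exact: inside_all | | exact: h].
by case/and3P: (fam.1 _ (inside_sub CW)).
Qed.

Lemma edge_kept W outs m : m u = v -> u \in W -> v \in W ->
  (u \in outs -> m u \notin W) ->
  forall M, agrees r W (inside W) m outs M -> M u = v.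
Proof.
move=> mu uW vW ho M [_ _ h]; rewrite h //; apply/negP => /ho.
by rewrite mu vW.
Qed.

Section TwoSides.
Variables (W R : {set T}) (ps : seq (T * T)).

(** Different circuits share no vertex, hence no end of a cut edge. So at most one circuit crosses a
    3-cut, and at most two cross a 4-cut. *)
Lemma cross_disj C C' i x p y q i' x' p' y' q' :
  C \in CC -> C' \in CC -> C != C' -> crossing R ps C i x p y q -> crossing R ps C' i' x' p' y' q' ->
  uniq [:: (last y q, x); (y, last x p); (last y' q', x'); (y', last x' p')].
Proof.
move=> hC hC' nC [E _ _ _ [n1 n2]] [E' _ _ _ [n1' n2']].
have in1 : [/\ y \in C & last y q \in C].
  by rewrite -(mem_rot i C y) -(mem_rot i C (last y q)) E !mem_cat mem_head mem_last !orbT.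
have in2 : [/\ y' \in C' & last y' q' \in C'].
  by rewrite -(mem_rot i' C' y') -(mem_rot i' C' (last y' q')) E' !mem_cat mem_head mem_last !orbT.
have ne z z' : z \in C -> z' \in C' -> z == z' = false.
  move=> zC zC'; apply/negP => /eqP e; subst z'; move/eqP: nC; apply; exact: (fam.2 _ _ z).
case: in1 => y1 l1; case: in2 => y2 l2.
rewrite /= !inE !xpair_eqE !(ne _ _ y1 y2, ne _ _ y1 l2, ne _ _ l1 y2, ne _ _ l1 l2) /=.
by rewrite ![last _ _ == _]eq_sym (negbTE n1) (negbTE n1').
Qed.

End TwoSides.

Section Cut3.
Variables (W R : {set T}) (ps : seq (T * T)).
Hypothesis ps3 : size ps = 3.

Lemma cross3_uniq C C' i x p y q i' x' p' y' q' :
  C \in CC -> C' \in CC -> crossing R ps C i x p y q -> crossing R ps C' i' x' p' y' q' -> C = C'.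
Proof.
move=> hC hC' c1 c2; apply/eqP/negPn/negP => nC.
have := uniq_leq_size (cross_disj hC hC' nC c1 c2) (s2 := ps); rewrite ps3 /= => h.
suff : 3 < 3 by [].
apply: h => z; case: c1 => _ _ a1 a2 _; case: c2 => _ _ a3 a4 _.
by rewrite !inE => /or4P[]/eqP->.
Qed.

End Cut3.
End Families.

Lemma solve3 W R ps (s t : T) CC (ES : seq (seq T)) n : cutdata V r W R ps -> size ps = 3 -> 2 < #|R| ->
  n \in R -> family r CC -> n3 r W ps n s t -> family (n3 r W ps n) (ES ++ inside CC W) ->
  {in ES, forall C, exists2 x, x \in V3 W n & x \notin C} ->
  exists m b, [/\ m s = t, pm (V3 W n) (n3 r W ps n) m, (m n, b) \in ps,
    {in ES, forall C, hit m C} &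
    ssol r W [:: m n] (agrees r W (inside CC W) m [:: m n])].
Proof.
move=> D ps3 R3 nR fam st fE nH.
have lt := V3_card D R3 nR.
have [|m [pmm ms hm]] := IH lt (n3_cgraph G D ps3 nR) (n3_tec G G3 D ps3 R3 nR) st fE.
  move=> C; rewrite mem_cat => /orP[/nH//|CW]; exists n; first by rewrite !inE eqxx.
  by apply/negP => /(allP (inside_all CW)); rewrite /= (negbTE (nW3 D nR)).
have [b nb E] := n3_out D nR pmm.
exists m, b; split => //; first by move=> C CE; apply: hm; rewrite mem_cat CE.
apply: (new_ssol (sW3 W n) (L3_new D nR) pmm E).
by apply: inside_cycle => // C CW; apply: hm; rewrite mem_cat CW orbT.
Qed.

Lemma rot_mem C i x p y q (z : T) : rot i C = (x :: p) ++ (y :: q) ->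
  (z \in C) = (z \in x :: p) || (z \in y :: q).
Proof. by move=> E; rewrite -(mem_rot i C z) E mem_cat. Qed.

Lemma crossing_rest W R ps C i x p y q : cutdata V r W R ps -> circ r C ->
  crossing R ps C i x p y q -> {subset R <= x :: p} -> all [in W] (y :: q).
Proof.
move=> D cC [E aR _ _ _] cov; apply/allP => z zq.
have zV : z \in V by apply: (circ_sub G cC); rewrite (rot_mem z E) zq orbT.
apply/negPn/negP => zW; have zR : z \in R by rewrite (cd_R D) inE zW.
have := cC; rewrite -(circ_rot _ i) E => /and3P[+ _ _].
by rewrite cat_uniq => /and3P[_ /hasPn /(_ z zq) /=]; rewrite cov.
Qed.

Lemma crossing_paths R ps C i x p y q : circ r C -> crossing R ps C i x p y q ->
  [/\ path r x p, path r y q, uniq (x :: p) & uniq (y :: q)].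
Proof.
move=> cC [E _ _ _ _]; have := cC; rewrite -(circ_rot _ i) E => /and3P[+ + _].
by rewrite cat_uniq cycle_cat2 => /and3P[-> _ ->] /and4P[-> _ -> _].
Qed.

(** The side of [u] is solved first. Its matching selects a cut edge, and the corresponding edge is
    prescribed on the other side, where [u] itself serves as the vertex replacing [W]. *)
Lemma cut3_side W R ps u v CC : r u v -> family r CC ->
  {in CC, forall C, exists2 x, x \in V & x \notin C} ->
  cutdata V r W R ps -> size ps = 3 -> 2 < #|W| -> 2 < #|R| -> u \in W ->
  solved V r u v CC.
Proof.
move=> uv fam famH D ps3 W3 R3 uW.
have [n nR] : exists n, n \in R by apply/card_gt0P/(leq_trans _ R3).
have nW := nW3 D nR.
have Ds := cutdata_sym G D; have pss3 : size (swaps ps) = 3 by rewrite size_swaps.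
have key (ES ER : seq (seq T)) :
  family (n3 r W ps n) (ES ++ inside CC W) ->
  {in ES, forall C, exists2 x, x \in V3 W n & x \notin C} ->
  family (n3 r R (swaps ps) u) (ER ++ inside CC R) ->
  {in ER, forall C, exists2 x, x \in V3 R u & x \notin C} ->
  (forall m1 m2 b m, (m1 n, b) \in ps -> m2 u = b -> m (m1 n) = b -> m b = m1 n -> pm V r m ->
     pm (V3 W n) (n3 r W ps n) m1 -> pm (V3 R u) (n3 r R (swaps ps) u) m2 ->
     {in ES, forall C, hit m1 C} -> {in ER, forall C, hit m2 C} ->
     agrees r W (inside CC W) m1 [:: m1 n] m -> agrees r R (inside CC R) m2 [:: m2 u] m ->
     {in CC, forall C, ~~ all [in W] C -> ~~ all [in R] C -> hit m C}) ->
  solved V r u v CC.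
  move=> f1 h1 f2 h2 H.
  (* If [uv] is a cut edge, it has become the edge [un]. *)
  have e1 : n3 r W ps n u (if v \in W then v else n).
    rewrite /n3 /nrel uW; case vW: (v \in W); first by rewrite vW uv.
    apply/or3P/Or33; rewrite memL3 eqxx /=; apply/mapP; exists (u, v) => //.
    by rewrite -(cda D) // (cd_R D) inE vW (csupr G uv).
  have [m1 [b [m1u pm1 mb hES s1]]] := solve3 D ps3 R3 nR fam e1 f1 h1.
  have e2 : n3 r R (swaps ps) u u b.
    apply/or3P/Or32; rewrite memL3 eqxx unzip1_swaps /=; apply/mapP; by exists (m1 n, b).
  have [m2 [a [m2u pm2 ma hER s2]]] := solve3 Ds pss3 W3 uW fam e2 f2 h2.
  rewrite m2u in s2.
  have [||m [pmm a1 a2 mm]] := glue_ssol (qs := [:: (m1 n, b)]) D _ _ s1 s2 => //.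
    by move=> z; rewrite inE => /eqP ->.
  have [e3 e4] := mm (m1 n) b (mem_head _ _).
  rewrite -m2u in a2.
  exists m; split => //; last first.
    move=> C CCC; case CW: (all [in W] C).
      by case: a1 => h _ _; apply: h; rewrite mem_filter CW.
    case CR: (all [in R] C).
      by case: a2 => h _ _; apply: h; rewrite mem_filter CR.
    by apply: (H m1 m2 b m) => //; rewrite ?CW ?CR.
  case vW: (v \in W) m1u => m1u.
    apply: (edge_kept m1u uW vW _ a1); rewrite inE => /eqP e.
    have [_ e6] := pm1 n (setU11 _ _); rewrite -e m1u in e6.
    by rewrite m1u e6.
  have e5 : m1 n = u by rewrite -m1u; case: (pm1 u) => //; rewrite !inE uW orbT.
  rewrite e5 in e3 mb; rewrite e3; apply: (cd_inj1 D mb).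
  by rewrite -(cda D) // (cd_R D) inE vW (csupr G uv).
have FW : family (n3 r W ps n) ([::] ++ inside CC W) by apply: family_inside.
have FR : family (n3 r R (swaps ps) u) ([::] ++ inside CC R) by apply: family_inside.
case: (boolP (has (fun C => ~~ all [in W] C && ~~ all [in R] C) CC)) => [/hasP[C CCC /andP[nCW nCR]]|/hasPn nh]; last first.
  apply: (key [::] [::]) => // m1 m2 b m _ _ _ _ _ _ _ _ _ _ _ C CCC nCW nCR.
  by have := nh C CCC; rewrite nCW nCR.
have cC := fam.1 _ CCC.
have [i [x [p [y [q cr]]]]] := crossing_ex G D cC nCW nCR.
have uniqC C' : C' \in CC -> ~~ all [in W] C' -> ~~ all [in R] C' -> C' = C.
  move=> hC' n1 n2; have [i' [x' [p' [y' [q' cr']]]]] := crossing_ex G D (fam.1 _ hC') n1 n2.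
  exact: (cross3_uniq fam ps3 hC' CCC cr' cr).
have [E aR h1 h2 [ny nx]] := cr.
have [px py ux uy] := crossing_paths cC cr.
have yends : y \in unzip1 ps by apply/mapP; exists (y, last x p).
have lyends : last y q \in unzip1 ps by apply/mapP; exists (last y q, x).
have xends : x \in unzip2 ps by apply/mapP; exists (last y q, x).
have lxends : last x p \in unzip2 ps by apply/mapP; exists (y, last x p).
(* The crossing circuit is closed up in [R] unless its run fills [R]. In that case the rest of it
   lies in [W], as does the vertex that it misses, so it is closed up in [W]. *)
case: (boolP (all [in x :: p] (enum R))) => [/allP cov|ncov].
  have {}cov : {subset R <= x :: p} by move=> z zR; apply: cov; rewrite mem_enum.
  have aW := crossing_rest D cC cr cov.
  pose E1 := [:: n] ++ (y :: q).
  apply: (key [:: E1] [::]) => //.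
  - apply: family_inside => // [C'|C' C'' z|C'].
    + rewrite inE => /eqP->; apply: circ_close => //=; rewrite ?nW //.
      * by apply/andP; split => //; rewrite /nrel !memL3 eqxx lyends !orbT.
      * by rewrite /nrel !memL3 eqxx lyends !orbT.
      by rewrite /nrel !memL3 eqxx yends !orbT.
    + by rewrite !inE => /eqP-> /eqP->.
    rewrite inE => /eqP->; exists C => //; split => // z zW.
    rewrite in_cons => /orP[/eqP e|zq]; first by rewrite -e zW in nW.
    by rewrite (rot_mem z E) zq orbT.
  - move=> C'; rewrite inE => /eqP->; have [z zV zC] := famH _ CCC; exists z.
      rewrite !inE orbC; apply/orP; left; apply: contraR zC => zW.
      by rewrite (rot_mem z E) cov // (cd_R D) inE zW.
    rewrite in_cons negb_or; apply/andP; split.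
      apply: contraNneq zC => ->; by rewrite (rot_mem n E) cov.
    by apply: contra zC => zq; rewrite (rot_mem z E) zq orbT.
  move=> m1 m2 b m mb _ e3 e4 pmm pm1 _ hE1 _ [_ a1 _] _ C' CCC' n1 n2.
  rewrite (uniqC C' CCC' n1 n2).
  apply: (hit_crossing D pmm cr); have := hE1 E1 (mem_head _ _).
  (* The closed arc is hit inside the arc or at one of its two edges at [n]; these stand for the two
     cut edges of [C]. *)
  rewrite /hit /E1 cycle_cat2 /= !negb_and => /or3P[|/a1|].
  - rewrite negbK => /eqP e; rewrite e in mb e3.
    by rewrite e3 (cd_inj1 D mb h2) eqxx !orbT.
  - by move=> h; rewrite (h aW py) !orbT.
  rewrite negbK => /eqP e; have e5 : m1 n = last y q.
    by apply: pm_eq pm1 _ e; rewrite inE (allP aW) ?orbT // mem_last.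
  by rewrite e5 in mb e4; rewrite -(cd_inj1 D mb h1) e4 eqxx !orbT.
pose E1 := [:: u] ++ (x :: p).
have uR : u \notin R by exact: cdD D _ uW.
have xs : x \in unzip1 (swaps ps) by rewrite unzip1_swaps.
have lxs : last x p \in unzip1 (swaps ps) by rewrite unzip1_swaps.
have Rx z : z \in E1 -> (z == u) || (z \in x :: p) by rewrite in_cons.
apply: (key [::] [:: E1]) => //.
- apply: family_inside => // [C'|C' C'' z|C'].
  + rewrite inE => /eqP->; apply: circ_close => //=; rewrite ?uR //.
    * by apply/andP; split => //; rewrite /nrel !memL3 eqxx lxs !orbT.
    * by rewrite /nrel !memL3 eqxx lxs !orbT.
    by rewrite /nrel !memL3 eqxx xs !orbT.
  + by rewrite !inE => /eqP-> /eqP->.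
  rewrite inE => /eqP->; exists C => //; split => // z zR.
  rewrite in_cons => /orP[/eqP e|zq]; first by rewrite -e zR in uR.
  by rewrite (rot_mem z E) zq.
- move=> C'; rewrite inE => /eqP->; case/allPn: ncov => z; rewrite mem_enum => zR zx.
  exists z; first by rewrite !inE zR orbT.
  rewrite in_cons negb_or zx andbT; apply: contraNneq uR => <- //.
move=> m1 m2 b m mb m2u e3 e4 pmm _ pm2 _ hE1 _ [_ a2 _] C' CCC' n1 n2.
rewrite (uniqC C' CCC' n1 n2).
apply: (hit_crossing D pmm cr); have := hE1 E1 (mem_head _ _).
rewrite /hit /E1 cycle_cat2 /= !negb_and => /or3P[||].
- rewrite negbK m2u => /eqP e; rewrite e in mb e4.
  by rewrite e4 (cd_inj2 D mb h1) eqxx !orbT.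
- by move=> h; rewrite (a2 _ _ aR px h).
rewrite negbK => /eqP e; have e5 : m2 u = last x p.
  by apply: pm_eq pm2 _ e; rewrite inE (allP aR) ?orbT // mem_last.
by rewrite m2u in e5; rewrite e5 in mb e3; rewrite -(cd_inj2 D mb h2) e3 eqxx !orbT.
Qed.
End Glue.

(** * Cuts of size 4 *)

Definition c4 (T : finType) (V : {set T}) (r : rel T) : Prop :=
  forall X : {set T}, X \subset V -> cut r X <= 3 -> #|X| <= 2 \/ #|V :\: X| <= 2.

Section Close4.
Variable T : finType.
Implicit Types (X Y : {set T}) (x y z : T).
Implicit Types (m : T -> T) (C : seq T) (CC : seq (seq T)) (L : seq (T * T)).

Variables (V : {set T}) (r : rel T) (W R : {set T}).
Variables (a1 b1 a2 b2 a3 b3 a4 b4 : T).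
Hypothesis G : cgraph V r.
Hypothesis G3 : tec V r.
Hypothesis G4 : c4 V r.
Let ps := [:: (a1, b1); (a2, b2); (a3, b3); (a4, b4)].
Hypothesis D : cutdata V r W R ps.
Hypothesis W3 : 2 < #|W|.
Hypothesis R3 : 2 < #|R|.
Variables n n' : T.
Hypothesis nR : n \in R.
Hypothesis n'R : n' \in R.
Hypothesis nn' : n != n'.

(* The R-side of the 4-cut is replaced by two adjacent vertices: [n] takes the
   ends of the first two edges and [n'] those of the last two. *)
Definition Lh := [:: (n, n'); (n, a1); (n, a2); (n', a3); (n', a4)].
Definition Vh := n |: (n' |: W).
Definition nh := nrel r W Lh.

Lemma nWh : n \notin W. Proof. by apply/negP => /(cdD D); rewrite nR. Qed.
Lemma n'Wh : n' \notin W. Proof. by apply/negP => /(cdD D); rewrite n'R. Qed.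
Lemma sWh : W \subset Vh.
Proof. by apply/subsetP => x xW; rewrite !inE xW !orbT. Qed.

Let aW : [/\ a1 \in W, a2 \in W, a3 \in W & a4 \in W].
Proof.
have h (p : T * T) : p \in ps -> p.1 \in W by case: p => a b /(cdm D)[].
by split; [apply: (h (a1, b1)) | apply: (h (a2, b2)) | apply: (h (a3, b3)) | apply: (h (a4, b4))];
  rewrite !inE eqxx ?orbT.
Qed.

Let neq x : x \in W -> (x == n = false) * (n == x = false) * (x == n' = false) * (n' == x = false).
Proof.
move=> xW; have h1 : x == n = false by apply: contraNF nWh => /eqP <-.
have h2 : x == n' = false by apply: contraNF n'Wh => /eqP <-.
by rewrite ![_ == x]eq_sym h1 h2.
Qed.

Lemma memLh x y : ((x, y) \in Lh) =
  (x == n) && (y \in [:: n'; a1; a2]) || (x == n') && (y \in [:: a3; a4]).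
Proof.
rewrite !inE !xpair_eqE; case: (x == n); case: (x == n') => //=; rewrite ?orbF ?orbA //.
Qed.

Lemma Lh_new : new_edges r W Vh Lh.
Proof.
have [w1 w2 w3 w4] := aW; have := cd1 D; rewrite /= !inE !negb_or => /and4P[/and3P[e12 e13 e14] /andP[e23 e24] e34 _].
have N := (neq w1, neq w2, neq w3, neq w4).
have nn2 : n' == n = false by rewrite eq_sym (negbTE nn').
rewrite /new_edges /Vh; apply/andP; split.
  rewrite /= !inE !xpair_eqE !N !eqxx nn2 (negbTE nn') ?andbF ?orbF /=.
  by rewrite (negbTE e12) (negbTE e34).
by rewrite /= !inE !eqxx w1 w2 w3 w4 (negbTE nWh) (negbTE n'Wh) ?orbT.
Qed.

Let inch x : inc Lh x = (x == n) * 3 + (x == n') * 3 + (x \in unzip1 ps).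
Proof.
rewrite -(sum_ends D) /inc /Lh /ps !big_cons !big_nil /=.
by case: (x == n); case: (x == n'); case: (x == a1); case: (x == a2); case: (x == a3); case: (x == a4).
Qed.

Lemma hWh x : x \in W -> \sum_(y in ~: W) r x y = inc Lh x.
Proof.
by move=> xW; rewrite (out_sum G D) // (sum_ends D) inch !(neq xW).
Qed.

Let endsW x : x \in unzip1 ps -> x \in W.
Proof. by have [w1 w2 w3 w4] := aW; rewrite !inE => /or4P[]/eqP->. Qed.

Lemma nh_cgraph : cgraph Vh nh.
Proof.
apply: (new_cgraph G (cd_sW D) sWh Lh_new hWh) => x; rewrite !inE => /or3P[/eqP->|/eqP->|->] // nW.
  rewrite inch eqxx (negbTE nn'); case h: (n \in unzip1 ps) => //.
  by have := endsW h; rewrite (negbTE nW).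
rewrite inch eqxx eq_sym (negbTE nn'); case h: (n' \in unzip1 ps) => //.
by have := endsW h; rewrite (negbTE nW).
Qed.

(** Only four cut edges end in [W]. If at most one edge joined the two parts, both would have cut
    exactly 3. By [G4] and parity each would be a single vertex, against [W3]. *)
Let ge2 X : X \subset W -> X != set0 -> X != W -> 2 <= en r X (W :\: X).
Proof.
move=> sX X0 XW; have sY : W :\: X \subset W by apply: subsetDl.
have Y0 : W :\: X != set0 by rewrite setD_eq0; apply: contra XW => h; rewrite eqEsubset sX.
have cX := old_cut hWh sX; have cY := old_cut hWh sY.
have h3X := cut_sub_ge3 G3 D sX X0 R3; have h3Y := cut_sub_ge3 G3 D sY Y0 R3.
have eDD : W :\: (W :\: X) = X by rewrite setDDr setDv set0U; apply/setIidPr.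
rewrite eDD (en_sym _ _ (csym G)) in cY.
have sXV := subset_trans sX (cd_sW D); have sYV := subset_trans sY (cd_sW D).
have oX := odd_cut G sXV; have oY := odd_cut G sYV.
have cardW : #|W| = #|X| + #|W :\: X| by rewrite -(cardsID X W) (setIidPr sX).
have cR (Z : {set T}) : Z \subset W -> 2 < #|V :\: Z|.
  move=> sZ; apply: leq_trans R3 _; rewrite (cd_R D); apply: subset_leq_card.
  exact: setDS.
have big (Z : {set T}) : Z \subset W -> cut r Z <= 3 -> #|Z| <= 2.
  move=> sZ c3; case: (G4 (subset_trans sZ (cd_sW D)) c3) => //.
  by rewrite leqNgt cR.
have b1X := big X sX; have b1Y := big _ sY.
move: cX cY; rewrite /Lh !big_cons !big_nil /= !inE.
have [w1 w2 w3 w4] := aW; rewrite !(negbTE nWh, negbTE n'Wh) w1 w2 w3 w4 !andbT.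
have nX : n \in X = false by apply: contraNF nWh => /(subsetP sX).
have n'X : n' \in X = false by apply: contraNF n'Wh => /(subsetP sX).
rewrite nX n'X !andbF /=.
move: (a1 \in X) (a2 \in X) (a3 \in X) (a4 \in X) oX oY h3X h3Y b1X b1Y cardW W3.
move: (cut r X) (cut r _) (en _ _ _) (#|X|) (#|W :\: X|) #|W| => c c' k s s' w.
clear; case; case; case; case => /=; lia.
Qed.

(** One may take the side without [n']. If it also misses [n], its cut is an old one. Otherwise
    [nn'] is in the cut, and two more edges come from [ge2], or from [n] when the side has no vertex
    in [W], or from [n'] when it contains [W]. *)
Lemma nh_tec : tec Vh nh.
Proof.
have [w1 w2 w3 w4] := aW.
have key X : X \subset Vh -> X != set0 -> n' \notin X -> 3 <= cut nh X.
  move=> sX X0 n'X; rewrite (nrel_cut G Lh_new).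
  have eD : W :\: X = W :\: (X :&: W) by apply/setP => x; rewrite !inE; case: (x \in W); rewrite ?andbT ?andbF.
  have NX a : a \in W -> (a \in X) = (a \in X :&: W) by move=> aW0; rewrite inE aW0 andbT.
  case nX: (n \in X).
    have [e0|XW0] := eqVneq (X :&: W) set0.
      rewrite /Lh !big_cons !big_nil /= nX (negbTE n'X) !NX // e0 !inE /=.
      by rewrite leq_addl.
    have [e1|XW1] := eqVneq (X :&: W) W.
      rewrite /Lh !big_cons !big_nil /= nX (negbTE n'X) !NX // e1 w1 w2 w3 w4 /=.
      by rewrite leq_addl.
    have := ge2 (subsetIr X W) XW0 XW1; rewrite -eD => h2.
    rewrite /Lh big_cons /= nX (negbTE n'X) /= addnA.
    apply: leq_trans (leq_addr _ _); by rewrite addn1.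
  have sXW : X \subset W.
    apply/subsetP => x xX; have := subsetP sX x xX; rewrite !inE.
    case/or3P => // /eqP e; first by rewrite -e xX in nX.
    by rewrite -e xX in n'X.
  rewrite (setIidPl sXW); have := cut_sub_ge3 G3 D sXW X0 R3; rewrite (old_cut hWh sXW).
  by rewrite /Lh !big_cons !big_nil /= nX (negbTE n'X).
move=> X sX X0 XV; case nX: (n' \in X); last by apply: key; rewrite ?nX.
rewrite -(cutC nh_cgraph sX); apply: key; first exact: subsetDl.
  by rewrite setD_eq0; apply: contra XV => h; rewrite eqEsubset sX.
by rewrite inE nX.
Qed.

Lemma Vh_card : #|Vh| < #|V|.
Proof.
rewrite /Vh !cardsU1 n'Wh !inE negb_or nn' nWh; have := subset_leq_card (cd_sW D).
have := cardsD V W; rewrite -(cd_R D) (setIidPr (cd_sW D)); clear -R3; lia.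
Qed.

Lemma nh_out m : pm Vh nh m ->
  m n = n' /\ {in W, [::] =i outsL Lh m} \/
  exists a a', [/\ a \in [:: a1; a2], a' \in [:: a3; a4], m n = a, m n' = a' &
     {in W, [:: a; a'] =i outsL Lh m}].
Proof.
have [w1 w2 w3 w4] := aW.
move=> pmm; have [n0 mn] := pmm n (setU11 _ _).
have [n0' mn'] := pmm n' (setU1r _ (setU11 _ _)).
have pV x : x \in W -> m (m x) = x by move=> xW; case: (pmm x) => //; rewrite !inE xW !orbT.
have E x : x \in W -> (x \in outsL Lh m) =
    (m x == n) && (x \in [:: a1; a2]) || (m x == n') && (x \in [:: a3; a4]).
  move=> xW; rewrite -(usedE Lh_new pmm); last exact: (subsetP sWh).
  by rewrite !memLh !(neq xW) /= inE !(neq xW).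
have n'n : n' == n = false by rewrite eq_sym (negbTE nn').
have N := (neq w1, neq w2, neq w3, neq w4).
have A : m n \in [:: n'; a1; a2].
  by move: n0; rewrite /nh /nrel (negbTE nWh) /= !memLh !inE !N eqxx (negbTE nn') /= ?andbF ?orbF.
have A' : (m n' == n) || (m n' \in [:: a3; a4]).
  move: n0'; rewrite /nh /nrel (negbTE n'Wh) /= !memLh !inE !N !eqxx n'n /= ?andbF ?orbF ?andbT /=.
  by case/orP => [->|->]; rewrite ?orbT.
case/orP: A' => [/eqP e|A'].
  left; have e' : m n = n' by rewrite -e mn'.
  split=> // x xW; rewrite E // in_nil; apply/esym/negbTE; rewrite negb_or.
  apply/andP; split; apply/negP => /andP[/eqP e2 _].
    by have := n'Wh; rewrite -e' -e2 pV ?xW.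
  by have := nWh; rewrite -e -e2 pV ?xW.
right; exists (m n), (m n'); split => //.
  move: A; rewrite in_cons => /orP[/eqP e|//].
  move: A'; rewrite -e mn !inE !N //.
have An : m n \in [:: a1; a2].
  move: A; rewrite in_cons => /orP[/eqP e|//].
  by move: A'; rewrite -e mn !inE !N.
move=> x xW; rewrite E // in_cons mem_seq1.
apply/orP/orP => [[]/eqP ->|[]/andP[/eqP e _]].
- by left; rewrite mn eqxx.
- by right; rewrite mn' eqxx.
- by left; rewrite -e pV.
by right; rewrite -e pV.
Qed.

End Close4.

Section Solve4.
Variable T : finType.
Implicit Types (X Y W R : {set T}) (x y z : T).
Implicit Types (m M : T -> T) (C p q : seq T) (CC : seq (seq T)) (L : seq (T * T)).
Variables (V : {set T}) (r : rel T).
Hypothesis G : cgraph V r.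
Hypothesis G3 : tec V r.
Hypothesis G4 : c4 V r.
Hypothesis IH : forall (V' : {set T}) (r' : rel T),
  #|V'| < #|V| -> cgraph V' r' -> tec V' r' -> hits_all V' r'.

Lemma solve4 W R a1 b1 a2 b2 a3 b3 a4 b4 (s t : T) CC (ES : seq (seq T)) n n' :
  cutdata V r W R [:: (a1, b1); (a2, b2); (a3, b3); (a4, b4)] ->
  2 < #|W| -> 2 < #|R| -> n \in R -> n' \in R -> n != n' -> family r CC ->
  nh r W a1 a2 a3 a4 n n' s t ->
  family (nh r W a1 a2 a3 a4 n n') (ES ++ inside CC W) ->
  {in ES, forall C, exists2 x, x \in Vh W n n' & x \notin C} ->
  exists m, [/\ m s = t, pm (Vh W n n') (nh r W a1 a2 a3 a4 n n') m,
    {in ES, forall C, hit m C} &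
    m n = n' /\ ssol r W [::] (agrees r W (inside CC W) m [::]) \/
    exists a a', [/\ a \in [:: a1; a2], a' \in [:: a3; a4], m n = a, m n' = a' &
     ssol r W [:: a; a'] (agrees r W (inside CC W) m [:: a; a'])]].
Proof.
move=> D W3 R3 nR n'R nn' fam st fE nH.
have lt := Vh_card D R3 nR n'R nn'.
have [|m [pmm ms hm]] := IH lt (nh_cgraph G D nR n'R nn') (nh_tec G G3 G4 D W3 R3 nR n'R nn') st fE.
  move=> C; rewrite mem_cat => /orP[/nH//|CW]; exists n; first by rewrite !inE eqxx.
  by apply/negP => /(allP (inside_all CW)); rewrite /= (negbTE (nWh D nR)).
have hI : {in inside CC W, forall C, [/\ all [in W] C, cycle r C & hit m C]}.
  by apply: (inside_cycle fam) => C CW; apply: hm; rewrite mem_cat CW orbT.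
exists m; split => //; first by move=> C CE; apply: hm; rewrite mem_cat CE.
have Ln := Lh_new D nR n'R nn'.
case: (nh_out D nR n'R nn' pmm) => [[e E]|[a [a' [h1 h2 h3 h4 E]]]].
  by left; split => //; apply: (new_ssol G (sWh W n n') Ln pmm E).
by right; exists a, a'; split => //; apply: (new_ssol G (sWh W n n') Ln pmm E).
Qed.

End Solve4.

Section Cut4.
Variable T : finType.
Implicit Types (X Y W R : {set T}) (x y z : T).
Implicit Types (m M : T -> T) (C p q : seq T) (CC : seq (seq T)) (L : seq (T * T)).
Variables (V : {set T}) (r : rel T).
Hypothesis G : cgraph V r.
Hypothesis G3 : tec V r.
Hypothesis G4 : c4 V r.
Hypothesis IH : forall (V' : {set T}) (r' : rel T),
  #|V'| < #|V| -> cgraph V' r' -> tec V' r' -> hits_all V' r'.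

Lemma ssol_mem W outs outs' Q : outs =i outs' -> ssol r W outs Q -> ssol r W outs' Q.
Proof.
move=> e [m [s h]]; exists m; split.
  by move=> x xW; rewrite -!e; exact: s.
by move=> M hM; apply: h => x xW; rewrite e; exact: hM.
Qed.

Section Path.
Variables (W R : {set T}) (a1 b1 a2 b2 a3 b3 a4 b4 : T).
Hypothesis D : cutdata V r W R [:: (a1, b1); (a2, b2); (a3, b3); (a4, b4)].
Hypothesis W3 : 2 < #|W|.
Hypothesis R3 : 2 < #|R|.
Variables (n n' : T).
Hypothesis nR : n \in R.
Hypothesis n'R : n' \in R.
Hypothesis nn' : n != n'.
Variable CC : seq (seq T).
Hypothesis fam : family r CC.

Let nh' := nh r W a1 a2 a3 a4 n n'.

Definition arc_of C y q : Prop :=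
  [/\ C \in CC, ~~ all [in W] C, {subset y :: q <= C}, all [in W] (y :: q) &
      path r y q /\ uniq (y :: q) /\ y != last y q].

Let NW := nWh D nR.
Let NW' := n'Wh D n'R.

Lemma nh_n y : y \in [:: a1; a2] -> nh' n y /\ nh' y n.
Proof.
by move=> h; rewrite /nh' /nh /nrel !memLh eqxx !(in_cons n') h !orbT.
Qed.

Lemma nh_n' y : y \in [:: a3; a4] -> nh' n' y /\ nh' y n'.
Proof.
by move=> h; rewrite /nh' /nh /nrel !memLh eqxx h !orbT.
Qed.

Lemma nh_nn : nh' n n' /\ nh' n' n.
Proof. by rewrite /nh' /nh /nrel !memLh !inE !eqxx !orbT. Qed.

Lemma arcP_circ C y q : arc_of C y q -> y \in [:: a1; a2] -> last y q \in [:: a1; a2] ->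
  circ nh' ([:: n] ++ (y :: q)).
Proof.
move=> [_ _ _ aq [pq [uq yl]]] h1 h2; have [e1 e2] := nh_n h1; have [e3 e4] := nh_n h2.
apply: circ_close => //=; rewrite ?NW //.
by apply/andP; split.
Qed.

Lemma arcP'_circ C y q : arc_of C y q -> y \in [:: a3; a4] -> last y q \in [:: a3; a4] ->
  circ nh' ([:: n'] ++ (y :: q)).
Proof.
move=> [_ _ _ aq [pq [uq yl]]] h1 h2; have [e1 e2] := nh_n' h1; have [e3 e4] := nh_n' h2.
apply: circ_close => //=; rewrite ?NW' //.
by apply/andP; split.
Qed.

Lemma arcX_circ C y q : arc_of C y q -> y \in [:: a1; a2] -> last y q \in [:: a3; a4] ->
  circ nh' ([:: n'; n] ++ (y :: q)).
Proof.
move=> [_ _ _ aq [pq [uq yl]]] h1 h2; have [e1 e2] := nh_n h1; have [e3 e4] := nh_n' h2.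
have [e5 e6] := nh_nn.
apply: circ_close => //=; rewrite ?NW ?NW' ?inE 1?eq_sym ?nn' //.
by apply/and3P; split.
Qed.

Lemma arcX'_circ C y q : arc_of C y q -> y \in [:: a3; a4] -> last y q \in [:: a1; a2] ->
  circ nh' ([:: n; n'] ++ (y :: q)).
Proof.
move=> [_ _ _ aq [pq [uq yl]]] h1 h2; have [e1 e2] := nh_n' h1; have [e3 e4] := nh_n h2.
have [e5 e6] := nh_nn.
apply: circ_close => //=; rewrite ?NW ?NW' ?inE ?nn' //.
by apply/and3P; split.
Qed.

Lemma arc_inside C y q s : arc_of C y q -> all [predC W] s ->
  forall x, x \in W -> x \in s ++ (y :: q) -> x \in C.
Proof.
move=> [_ _ sq _ _] /allP ns x xW; rewrite mem_cat => /orP[/ns|]; last exact: sq.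
by rewrite /= xW.
Qed.

(** An arc whose ends belong to different pairs is closed up through both [n] and [n']. If none of
    the three closing edges is matched, the arc itself is hit. [f] tells whether there is an arc to
    prescribe. *)
Lemma solve4X (s t : T) (f : bool) C y q : nh' s t ->
  (f -> arc_of C y q) ->
  (f -> (y \in [:: a1; a2]) && (last y q \in [:: a3; a4]) ||
        (y \in [:: a3; a4]) && (last y q \in [:: a1; a2])) ->
  (f -> exists2 z, z \in W & z \notin y :: q) ->
  exists m, [/\ m s = t, pm (Vh W n n') nh' m,
    f -> m n != n' -> m n \notin [:: y; last y q] -> m n' \notin [:: y; last y q] ->
      ~~ path (off m) y q &
    m n = n' /\ ssol r W [::] (agrees r W (inside CC W) m [::]) \/
    exists a a', [/\ a \in [:: a1; a2], a' \in [:: a3; a4], m n = a, m n' = a' &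
     ssol r W [:: a; a'] (agrees r W (inside CC W) m [:: a; a'])]].
Proof.
move=> st arc ends miss.
case: f arc ends miss => [arc ends miss|_ _ _]; last first.
  have fE : family nh' ([::] ++ inside CC W) by exact: family_inside.
  have [|m [h1 h2 _ h3]] := solve4 G G3 G4 IH D W3 R3 nR n'R nn' fam st fE => //.
  by exists m; split.
have {}arc := arc isT; have {}ends := ends isT; have [z zW zq] := miss isT.
have [sq [cE ns hs]] : exists sq, [/\ circ nh' (sq ++ (y :: q)), all [predC W] sq &
    sq = [:: n'; n] \/ sq = [:: n; n']].
  case/orP: ends => /andP[h1 h2].
    exists [:: n'; n]; split; [exact: (arcX_circ arc h1 h2) | by rewrite /= NW NW' | by left].
  exists [:: n; n']; split; [exact: (arcX'_circ arc h1 h2) | by rewrite /= NW NW' | by right].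
have fE : family nh' ([:: sq ++ (y :: q)] ++ inside CC W).
  apply: family_inside => // [C'|C' C'' x|C'].
  - by rewrite inE => /eqP->.
  - by rewrite !inE => /eqP-> /eqP->.
  rewrite inE => /eqP->; exists C; first by case: arc.
  by split; [case: arc | exact: arc_inside].
have [|m [h1 h2 hE h3]] := solve4 G G3 G4 IH D W3 R3 nR n'R nn' fam st fE.
  move=> C'; rewrite inE => /eqP->; exists z; first by rewrite !inE zW !orbT.
  rewrite mem_cat (negbTE zq) orbF; apply/negP => /(allP ns).
  by rewrite /= zW.
exists m; split => // _ nm my my'.
have := hE _ (mem_head _ _).
have aq : forall x, x \in y :: q -> x \in Vh W n n'.
  by case: arc => _ _ _ /allP aW _ x /aW xW; rewrite !inE (xW : x \in W) !orbT.
have pmn x x' : x \in Vh W n n' -> m x = x' -> m x' = x by apply: pm_eq h2.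
have nV : n \in Vh W n n' by rewrite !inE eqxx.
have n'V : n' \in Vh W n n' by rewrite !inE eqxx orbT.
have lV : last y q \in Vh W n n' by apply: aq; rewrite mem_last.
move: my my'; rewrite !inE !negb_or => /andP[my ml] /andP[my' ml'].
have ml2 : m (last y q) != n by apply: contra ml => /eqP /(pmn _ _ lV) ->.
have ml2' : m (last y q) != n' by apply: contra ml' => /eqP /(pmn _ _ lV) ->.
have nm' : m n' != n by apply: contra nm => /eqP /(pmn _ _ n'V) ->.
rewrite /hit; case: hs => ->; rewrite cycle_cat2 /= /off.
  by rewrite nm' my ml2' /= andbT.
by rewrite nm my' ml2 /= andbT.
Qed.

(** An arc whose ends belong to one pair is closed up through the vertex of this pair alone, so that
    two arcs can be prescribed at once. If [nn'] is matched, no closing edge is, and the arcs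
    themselves are hit. *)
Lemma solve4P (s t : T) (d d' : bool) C y q C' y' q' : nh' s t ->
  (d -> arc_of C y q /\ perm_eq [:: y; last y q] [:: a1; a2]) ->
  (d' -> arc_of C' y' q' /\ perm_eq [:: y'; last y' q'] [:: a3; a4]) ->
  (d -> d' -> C != C') ->
  exists m, [/\ m s = t, pm (Vh W n n') nh' m,
    m n = n' -> (d -> ~~ path (off m) y q) /\ (d' -> ~~ path (off m) y' q') &
    m n = n' /\ ssol r W [::] (agrees r W (inside CC W) m [::]) \/
    exists a a', [/\ a \in [:: a1; a2], a' \in [:: a3; a4], m n = a, m n' = a' &
     ssol r W [:: a; a'] (agrees r W (inside CC W) m [:: a; a'])]].
Proof.
move=> st arc arc' nC.
have pin2 (A : seq T) x l : perm_eq [:: x; l] A -> x \in A /\ l \in A.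
  by move/perm_mem => e; rewrite -!e !inE !eqxx !orbT.
pose E := if d then [:: [:: n] ++ (y :: q)] else [::].
pose E' := if d' then [:: [:: n'] ++ (y' :: q')] else [::].
have sub x : x \in W -> (d -> x \in [:: n] ++ (y :: q) -> x \in C) /\ (d' -> x \in [:: n'] ++ (y' :: q') -> x \in C').
  move=> xW; split=> h; [apply: arc_inside xW; first exact: (arc h).1 | apply: arc_inside xW; first exact: (arc' h).1].
    by rewrite /= NW.
  by rewrite /= NW'.
have memE (z : seq T) : z \in E ++ E' -> (d /\ z = [:: n] ++ (y :: q)) \/ (d' /\ z = [:: n'] ++ (y' :: q')).
  rewrite mem_cat /E /E'; case: (d); case: (d'); rewrite ?in_nil ?orbF ?inE //=.
  - by case/orP => /eqP ->; [left | right].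
  - by move/eqP->; left.
  by move/eqP->; right.
have disj : d -> d' -> forall x, x \in [:: n] ++ (y :: q) -> x \in [:: n'] ++ (y' :: q') -> False.
  move=> hd hd' x; have [[CC1 _ s1 a1' _] _] := arc hd; have [[CC2 _ s2 a2' _] _] := arc' hd'.
  rewrite !mem_cat !mem_seq1 => /orP[/eqP->|xq] /orP[/eqP e|xq'].
  - by have := nn'; rewrite e eqxx.
  - by have := allP a2' _ xq'; rewrite /= (negbTE NW).
  - by have := allP a1' _ xq; rewrite e /= (negbTE NW').
  by have := nC hd hd'; rewrite (fam.2 _ _ _ CC1 CC2 (s1 _ xq) (s2 _ xq')) eqxx.
have fE : family nh' ((E ++ E') ++ inside CC W).
  apply: family_inside => // [C0|C0 C1 x|C0].
  - case/memE => -[h ->].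
      have [ar /pin2[p1 p2]] := arc h; exact: (arcP_circ ar p1 p2).
    have [ar /pin2[p1 p2]] := arc' h; exact: (arcP'_circ ar p1 p2).
  - case/memE => -[h ->] /memE[] [h' ->] // x1 x2.
      by case: (disj h h' x x1 x2).
    by case: (disj h' h x x2 x1).
  case/memE => -[h ->].
    have [ar _] := arc h; exists C; first by case: ar.
    by split; [case: ar | move=> x xW; exact: (sub x xW).1].
  have [ar _] := arc' h; exists C'; first by case: ar.
  by split; [case: ar | move=> x xW; exact: (sub x xW).2].
have [|m [h1 h2 hE h3]] := solve4 G G3 G4 IH D W3 R3 nR n'R nn' fam st fE.
  move=> C0 /memE [] [h ->].
    exists n'; first by rewrite !inE eqxx orbT.
    have [[_ _ _ a1' _] _] := arc h; rewrite mem_cat mem_seq1 eq_sym (negbTE nn') /=.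
    by apply/negP => /(allP a1'); rewrite /= (negbTE NW').
  exists n; first by rewrite !inE eqxx.
  have [[_ _ _ a1' _] _] := arc' h; rewrite mem_cat mem_seq1 (negbTE nn') /=.
  by apply/negP => /(allP a1'); rewrite /= (negbTE NW).
exists m; split => // mn.
have mn' : m n' = n by apply: pm_eq h2 _ mn; rewrite !inE eqxx.
have inV x : x \in W -> x \in Vh W n n' by move=> xW; rewrite !inE xW !orbT.
have neq x : x \in W -> (x == n = false) * (n == x = false) * (x == n' = false) * (n' == x = false).
  move=> xW; have z1 : x == n = false by apply: contraNF NW => /eqP <-.
  have z2 : x == n' = false by apply: contraNF NW' => /eqP <-.
  by rewrite ![_ == x]eq_sym z1 z2.
have nml x : x \in W -> m x != n /\ m x != n'.
  move=> xW; split; apply/eqP => e.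
    by have := pm_eq h2 (inV x xW) e; rewrite mn => e2; move: NW'; rewrite e2 xW.
  by have := pm_eq h2 (inV x xW) e; rewrite mn' => e2; move: NW; rewrite e2 xW.
split=> h.
  have [[_ _ _ aq _] _] := arc h.
  have yW : y \in W by apply: (allP aq); rewrite mem_head.
  have lW : last y q \in W by apply: (allP aq); rewrite mem_last.
  have := hE ([:: n] ++ (y :: q)); rewrite mem_cat /E h mem_head => /(_ isT).
  by rewrite /hit cycle_cat2 /= /off mn (neq _ yW) (nml _ lW).1 andbT.
have [[_ _ _ aq _] _] := arc' h.
have yW : y' \in W by apply: (allP aq); rewrite mem_head.
have lW : last y' q' \in W by apply: (allP aq); rewrite mem_last.
have := hE ([:: n'] ++ (y' :: q')); rewrite mem_cat /E' h mem_head orbT => /(_ isT).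
by rewrite /hit cycle_cat2 /= /off mn' (neq _ yW) (nml _ lW).2 andbT.
Qed.

End Path.
End Cut4.

(** * Agreement of the two sides of a 4-edge-cut *)

Section Combine.
Variable T : finType.
Implicit Types (X Y W R : {set T}) (x y z : T).
Implicit Types (m M : T -> T) (C p q : seq T) (CC : seq (seq T)) (L : seq (T * T)).
Variables (V : {set T}) (r : rel T).
Hypothesis G : cgraph V r.
Hypothesis G3 : tec V r.
Hypothesis G4 : c4 V r.
Hypothesis IH : forall (V' : {set T}) (r' : rel T),
  #|V'| < #|V| -> cgraph V' r' -> tec V' r' -> hits_all V' r'.

Variables (W R : {set T}) (ps0 : seq (T * T)).
Hypothesis D0 : cutdata V r W R ps0.
Hypothesis W3 : 2 < #|W|.
Hypothesis R3 : 2 < #|R|.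
Variables (u v : T) (CC : seq (seq T)).
Hypothesis uv : r u v.
Hypothesis fam : family r CC.
Hypothesis famH : {in CC, forall C, exists2 x, x \in V & x \notin C}.
Variables (n n' k k' : T).
Hypothesis nR : n \in R.
Hypothesis n'R : n' \in R.
Hypothesis nn' : n != n'.
Hypothesis kW : k \in W.
Hypothesis k'W : k' \in W.
Hypothesis kk' : k != k'.

(** The list [oW] in [agrees] is kept apart from [outs] so that [outs] can be reordered. [e] tells
    whether [uv] is an edge inside [W]. *)
Definition gW (e : bool) outs m : Prop := exists oW,
  ssol r W outs (agrees r W (inside CC W) m oW) /\
  (e -> m u = v /\ (u \in oW -> m u \notin W)).

Definition gR outs m : Prop := exists oR,
  ssol r R outs (agrees r R (inside CC R) m oR).

Lemma gW_mem e outs outs' m : outs =i outs' -> gW e outs m -> gW e outs' m.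
Proof. by move=> E [o [s h]]; exists o; split => //; exact: ssol_mem E s. Qed.

Lemma gR_mem outs outs' m : outs =i outs' -> gR outs m -> gR outs' m.
Proof. by move=> E [o s]; exists o; exact: ssol_mem E s. Qed.

Lemma fin4 (e : bool) qs mW mR : uniq qs -> {subset qs <= ps0} ->
  gW e (unzip1 qs) mW -> gR (unzip2 qs) mR ->
  (e -> u \in W /\ v \in W) -> (~~ e -> (u, v) \in qs) ->
  (forall C, C \in CC -> ~~ all [in W] C -> ~~ all [in R] C ->
     exists i x p y q, crossing R ps0 C i x p y q /\
       [|| (last y q, x) \in qs, (y, last x p) \in qs, ~~ path (off mR) x p |
           all [in W] (y :: q) && ~~ path (off mW) y q]) ->
  solved V r u v CC.
Proof.
move=> uq sq [oW [sW heW]] [oR sR] he hne hC.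
have [m [pmm a1 a2 mm]] := glue_ssol G D0 sq uq sW sR.
exists m; split => //.
  case: (boolP e) => [et|ef]; last by case: (mm _ _ (hne ef)).
  have [uW vW] := he et; have [mu ho] := heW et.
  exact: (edge_kept mu uW vW ho a1).
move=> C CCC; case CW: (all [in W] C).
  by case: a1 => h _ _; apply: h; rewrite mem_filter CW.
case CR: (all [in R] C).
  by case: a2 => h _ _; apply: h; rewrite mem_filter CR.
have [|| i [x [p [y [q [cr h]]]]]] := hC C CCC; rewrite ?CW ?CR //.
apply: (hit_crossing D0 pmm cr).
have [px py ux uy] := crossing_paths (fam.1 _ CCC) cr.
have [E aR h1 h2 _] := cr.
case/or4P: h => h.
- by have [_ ->] := mm _ _ h; rewrite eqxx !orbT.
- by have [-> _] := mm _ _ h; rewrite eqxx !orbT.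
- by case: a2 => _ a2 _; rewrite (a2 _ _ aR px h).
by case/andP: h => aW h; case: a1 => _ a1 _; rewrite (a1 _ _ aW py h) orbT.
Qed.

Definition xing C i x p y q (P P' : T * T) : Prop :=
  [/\ C \in CC, ~~ all [in W] C, ~~ all [in R] C, crossing R ps0 C i x p y q &
      perm_eq [:: (last y q, x); (y, last x p)] [:: P; P']].

Lemma xing_arcR C i x p y q P P' : xing C i x p y q P P' ->
  arc_of r R CC C x p /\ perm_eq [:: x; last x p] [:: P.2; P'.2].
Proof.
move=> [CCC nW nR' cr pe]; have [px py ux uy] := crossing_paths (fam.1 _ CCC) cr.
have [E aR h1 h2 [ny nx]] := cr; split; last exact: (perm_map snd pe).
split => // z zp; by rewrite (rot_mem z E) zp.
Qed.

Lemma xing_arcW C i x p y q P P' : xing C i x p y q P P' -> all [in W] (y :: q) ->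
  arc_of r W CC C y q /\ perm_eq [:: y; last y q] [:: P.1; P'.1].
Proof.
move=> [CCC nW nR' cr pe] aW; have [px py ux uy] := crossing_paths (fam.1 _ CCC) cr.
have [E aR h1 h2 [ny nx]] := cr; split.
  split => // z zp; by rewrite (rot_mem z E) zp orbT.
apply: perm_trans (perm_map fst pe); exact: permEl (perm_catC [:: y] [:: last y q]).
Qed.

Lemma permps s : perm_eq ps0 s -> cutdata V r W R s /\ cutdata V r R W (swaps s).
Proof. by move=> h; split; [|apply: (cutdata_sym G)]; exact: cutdata_perm h D0. Qed.

Lemma solveW (P1 P2 P3 P4 : T * T) (f : bool) C y q :
  u \in W -> v \in W ->
  perm_eq ps0 [:: P1; P2; P3; P4] ->
  (f -> arc_of r W CC C y q) ->
  (f -> (y \in [:: P1.1; P2.1]) && (last y q \in [:: P3.1; P4.1]) ||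
        (y \in [:: P3.1; P4.1]) && (last y q \in [:: P1.1; P2.1])) ->
  (f -> exists2 z, z \in W & z \notin y :: q) ->
  exists m, [/\ f -> m n != n' -> m n \notin [:: y; last y q] -> m n' \notin [:: y; last y q] ->
      ~~ path (off m) y q &
    m n = n' /\ gW true [::] m \/
    exists a a', [/\ a \in [:: P1.1; P2.1], a' \in [:: P3.1; P4.1], m n = a, m n' = a' &
      gW true [:: a; a'] m]].
Proof.
case: P1 P2 P3 P4 => [a1 b1] [a2 b2] [a3 b3] [a4 b4] /= uW vW hp arc ends miss.
have [D _] := permps hp.
have e0 : nh r W a1 a2 a3 a4 n n' u v by rewrite /nh /nrel uW vW uv.
have [m [mu pmm h1 h2]] := solve4X G G3 G4 IH D W3 R3 nR n'R nn' fam e0 arc ends miss.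
have [NW NW'] := (nWh D nR, nWh D n'R).
exists m; split => //; case: h2 => [[mn s]|[a [a' [aA aA' mn mn' s]]]]; [left | right].
  by split => //; exists [::]; split.
exists a, a'; split => //; exists [:: a; a']; split => // _; split => //.
rewrite !inE => /orP[]/eqP->; rewrite -?mn -?mn'.
  by rewrite (pmm n _).2 ?NW // !inE eqxx.
by rewrite (pmm n' _).2 ?NW' // !inE eqxx orbT.
Qed.

Lemma solveR (P1 P2 P3 P4 : T * T) (s t : T) (f : bool) C x p :
  perm_eq ps0 [:: P1; P2; P3; P4] ->
  nh r R P1.2 P2.2 P3.2 P4.2 k k' s t ->
  (f -> arc_of r R CC C x p) ->
  (f -> (x \in [:: P1.2; P2.2]) && (last x p \in [:: P3.2; P4.2]) ||
        (x \in [:: P3.2; P4.2]) && (last x p \in [:: P1.2; P2.2])) ->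
  (f -> exists2 z, z \in R & z \notin x :: p) ->
  exists m, [/\ m s = t, pm (Vh R k k') (nh r R P1.2 P2.2 P3.2 P4.2 k k') m,
    f -> m k != k' -> m k \notin [:: x; last x p] -> m k' \notin [:: x; last x p] ->
      ~~ path (off m) x p &
    m k = k' /\ gR [::] m \/
    exists a a', [/\ a \in [:: P1.2; P2.2], a' \in [:: P3.2; P4.2], m k = a, m k' = a' &
      gR [:: a; a'] m]].
Proof.
case: P1 P2 P3 P4 => [a1 b1] [a2 b2] [a3 b3] [a4 b4] /= hp st arc ends miss.
have [_ D] := permps hp; rewrite /swaps /= in D.
have [m [ms pmm h1 h2]] := solve4X G G3 G4 IH D R3 W3 kW k'W kk' fam st arc ends miss.
exists m; split => //; case: h2 => [[mn s0]|[a [a' [aA aA' mn mn' s0]]]]; [left | right].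
  by split => //; exists [::].
by exists a, a'; split => //; exists [:: a; a'].
Qed.

(** The edge [kk'] is prescribed; it excludes all cut edges, so closed arcs are hit inside [R]. *)
Lemma solveR0 (P1 P2 P3 P4 : T * T) (d d' : bool) C x p C' x' p' :
  perm_eq ps0 [:: P1; P2; P3; P4] ->
  (d -> arc_of r R CC C x p /\ perm_eq [:: x; last x p] [:: P1.2; P2.2]) ->
  (d' -> arc_of r R CC C' x' p' /\ perm_eq [:: x'; last x' p'] [:: P3.2; P4.2]) ->
  (d -> d' -> C != C') ->
  exists m, [/\ d -> ~~ path (off m) x p, d' -> ~~ path (off m) x' p' & gR [::] m].
Proof.
case: P1 P2 P3 P4 => [a1 b1] [a2 b2] [a3 b3] [a4 b4] /= hp arc arc' nC.
have [_ D] := permps hp; rewrite /swaps /= in D.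
have st := (nh_nn r R b1 b2 b3 b4 k k').1.
have [m [ms pmm h1 h2]] := solve4P G G3 G4 IH D R3 W3 kW k'W kk' fam st arc arc' nC.
have [h3 h4] := h1 ms.
exists m; split => //; case: h2 => [[_ s0]|[a [a' [aA aA' mn mn' s0]]]]; first by exists [::].
have : k' \in R.
  have aR : a \in R.
    move: aA; rewrite !inE => /orP[]/eqP->.
      by apply: (cdm D (y := a1) _).1; rewrite !inE eqxx.
    by apply: (cdm D (y := a2) _).1; rewrite !inE eqxx !orbT.
  by rewrite -ms mn.
by move=> k'R; have := cdD D0 k'W; rewrite k'R.
Qed.

Lemma xing_swap C i x p y q (P P' : T * T) : xing C i x p y q P P' -> xing C i x p y q P' P.
Proof.
case=> h1 h2 h3 h4 h5; split => //; apply: perm_trans h5 _.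
exact: permEl (perm_catC [:: P] [:: P']).
Qed.

Section Labels.
Variables (P1 P2 P3 P4 : T * T).
Hypothesis hp : perm_eq ps0 [:: P1; P2; P3; P4].
Variables (d d' : bool) (C1 C2 : seq T).
Variables (i1 : nat) (x1 : T) (p1 : seq T) (y1 : T) (q1 : seq T).
Variables (i2 : nat) (x2 : T) (p2 : seq T) (y2 : T) (q2 : seq T).
Hypothesis hx1 : d -> xing C1 i1 x1 p1 y1 q1 P1 P2.
Hypothesis hx2 : d' -> xing C2 i2 x2 p2 y2 q2 P3 P4.
Hypothesis d'd : d' -> d.
Hypothesis nC : d -> d' -> C1 != C2.
Hypothesis hall : forall C, C \in CC -> ~~ all [in W] C -> ~~ all [in R] C ->
  d && (C == C1) || d' && (C == C2).

Let mps (p : T * T) : p \in [:: P1; P2; P3; P4] -> p \in ps0.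
Proof. by rewrite (perm_mem hp). Qed.

Let uP1 : uniq [:: P1.1; P2.1; P3.1; P4.1].
Proof. by have := cd1 D0; rewrite (perm_uniq (perm_map fst hp)). Qed.

Let uP2 : uniq [:: P1.2; P2.2; P3.2; P4.2].
Proof. by have := cd2 D0; rewrite (perm_uniq (perm_map snd hp)). Qed.

Let inP (p : T * T) : p \in [:: P1; P2; P3; P4] -> p.1 \in W /\ p.2 \in R.
Proof. by move/mps; case: p => a b /(cdm D0). Qed.

Lemma fin5 (e : bool) qs mW mR : uniq qs -> {subset qs <= [:: P1; P2; P3; P4]} ->
  gW e (unzip1 qs) mW -> gR (unzip2 qs) mR ->
  (e -> u \in W /\ v \in W) -> (~~ e -> (u, v) \in qs) ->
  (d -> [|| P1 \in qs, P2 \in qs, ~~ path (off mR) x1 p1 |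
            all [in W] (y1 :: q1) && ~~ path (off mW) y1 q1]) ->
  (d' -> [|| P3 \in qs, P4 \in qs | ~~ path (off mR) x2 p2]) ->
  solved V r u v CC.
Proof.
move=> uq sq g1 g2 he hne h1 h2; apply: (fin4 uq _ g1 g2 he hne) => [p /sq/mps //|C CCC nW nR'].
have pm2 (A B A' B' : T * T) : perm_eq [:: A; B] [:: A'; B'] -> A' \in qs \/ B' \in qs -> A \in qs \/ B \in qs.
  move/perm_mem => E; have := E A'; have := E B'; rewrite !inE !eqxx orbT /= => eB eA.
  by case => h; [move: eA | move: eB] => /orP[]/eqP e0; rewrite -e0; auto.
case/orP: (hall CCC nW nR') => /andP[hd /eqP ->].
  have [_ _ _ cr pe] := hx1 hd; exists i1, x1, p1, y1, q1; split => //.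
  case/or4P: (h1 hd) => h.
  - by case: (pm2 _ _ _ _ pe (or_introl h)) => ->; rewrite ?orbT.
  - by case: (pm2 _ _ _ _ pe (or_intror h)) => ->; rewrite ?orbT.
  - by rewrite h !orbT.
  by rewrite h !orbT.
have [_ _ _ cr pe] := hx2 hd; exists i2, x2, p2, y2, q2; split => //.
case/or3P: (h2 hd) => h.
- by case: (pm2 _ _ _ _ pe (or_introl h)) => ->; rewrite ?orbT.
- by case: (pm2 _ _ _ _ pe (or_intror h)) => ->; rewrite ?orbT.
by rewrite h !orbT.
Qed.

(** When the first circuit fills [R], its arc there cannot be prescribed; its arc in [W], which then
    misses a vertex of [W], is prescribed instead. *)
Let cov := all [in x1 :: p1] (enum R).

Let covW : d -> cov -> all [in W] (y1 :: q1) /\ exists2 z, z \in W & z \notin y1 :: q1.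
Proof.
move=> hd /allP hc; have [CCC nW nR' cr pe] := hx1 hd.
have {}hc : {subset R <= x1 :: p1} by move=> z zR; apply: hc; rewrite mem_enum.
split; first exact: crossing_rest D0 (fam.1 _ CCC) cr hc.
have [E _ _ _ _] := cr.
have [z zV zC] : exists2 x, x \in V & x \notin C1 by exact: famH.
exists z.
  by apply: contraR zC => zW; rewrite (rot_mem z E) hc // (cd_R D0) inE zW.
by apply: contra zC => zq; rewrite (rot_mem z E) zq orbT.
Qed.

Let ncovR : ~~ cov -> exists2 z, z \in R & z \notin x1 :: p1.
Proof. by case/allPn => z; rewrite mem_enum => zR zx; exists z. Qed.

(** The second circuit cannot fill [R], because the first one has vertices there. *)
Let miss2 : d' -> exists2 z, z \in R & z \notin x2 :: p2.
Proof.
move=> hd'; have hd := d'd hd'.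
have [[CC1 _ s1 _ _] /perm_mem pe] := xing_arcR (hx1 hd).
have [[CC2 _ s2 _ _] _] := xing_arcR (hx2 hd').
have h1 : P1.2 \in x1 :: p1.
  have hh := pe P1.2; rewrite [RHS]mem_head !inE in hh.
  by case/orP: hh => /eqP ->; rewrite ?mem_head ?mem_last.
exists P1.2; first by apply: (inP _).2; rewrite mem_head.
apply/negP => h2; have := nC hd hd'.
by rewrite (fam.2 _ _ _ CC1 CC2 (s1 _ h1) (s2 _ h2)) eqxx.
Qed.

Let pends (A B y z : T) : perm_eq [:: y; z] [:: A; B] -> (y = A /\ z = B) \/ (y = B /\ z = A).
Proof.
move=> pe; have := perm_mem pe y; rewrite mem_head !inE => /esym/orP[]/eqP ey; subst y; [left|right].
  move: pe; rewrite perm_cons => /perm_mem /(_ z).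
  by rewrite !inE eqxx => /esym/eqP.
have := perm_trans pe (permEl (perm_catC [:: A] [:: B])); rewrite perm_cons => /perm_mem /(_ z).
by rewrite !inE eqxx => /esym/eqP.
Qed.

(** A solution of [R] on [P1], [P4] would fit [mA] and hit both circuits at the cut. Failing that,
    suitable pairings force [R] to offer a solution with no cut edge and one on each of the pairs
    13, 24, 12 and 34. The pairing of 1 with 4 and of 2 with 3 in [W] can only answer with one of
    these. *)
Lemma int14 mA : u \in W -> v \in W -> gW true [:: P1.1; P4.1] mA -> solved V r u v CC.
Proof.
move=> uW vW gA.
have he : true -> u \in W /\ v \in W by [].
have hne : ~~ true -> (u, v) \in [::] by [].
have in1 : P1 \in [:: P1; P2; P3; P4] by rewrite !inE eqxx.
have in2 : P2 \in [:: P1; P2; P3; P4] by rewrite !inE eqxx ?orbT.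
have in3 : P3 \in [:: P1; P2; P3; P4] by rewrite !inE eqxx ?orbT.
have in4 : P4 \in [:: P1; P2; P3; P4] by rewrite !inE eqxx ?orbT.
have := uP1; rewrite /= !inE !negb_or => /and4P[/and3P[e12 e13 e14] /andP[e23 e24] e34 _].
have := uP2; rewrite /= !inE !negb_or => /and4P[/and3P[f12 f13 f14] /andP[f23 f24] f34 _].
have uq (P Q : T * T) : P.1 != Q.1 -> uniq [:: P; Q].
  by move=> ne; rewrite /= inE andbT; apply: contra ne => /eqP->.
have sub2 (P Q : T * T) : P \in [:: P1; P2; P3; P4] -> Q \in [:: P1; P2; P3; P4] ->
    {subset [:: P; Q] <= [:: P1; P2; P3; P4]}.
  by move=> hP hQ z; rewrite !inE => /orP[]/eqP->; move: hP hQ; rewrite !inE.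
have done14 mR : gR [:: P1.2; P4.2] mR -> solved V r u v CC.
  move=> gB; apply: (fin5 (qs := [:: P1; P4]) (uq _ _ e14) (sub2 _ _ in1 in4) gA gB he) => //.
    by rewrite !inE eqxx.
  by rewrite !inE eqxx !orbT.
have kR (P : T * T) : P \in [:: P1; P2; P3; P4] -> (P.2 != k) && (P.2 != k').
  move=> hP; have [_ PR] := inP hP; apply/andP; split; apply: contraTneq PR => ->.
    exact: cdD D0 _ kW.
  exact: cdD D0 _ k'W.
have hp1324 : perm_eq ps0 [:: P1; P3; P2; P4].
  by apply: perm_trans hp _; apply/permP => f /=; rewrite !addnA; congr (_ + _ + _); rewrite -!addnA [f P2 + _]addnC.
have hp1423 : perm_eq ps0 [:: P1; P4; P2; P3].
  apply: perm_trans hp _; rewrite perm_cons.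
  exact: permEl (perm_catC [:: P2; P3] [:: P4]).
have [mR0 [r1 r2 gR0]] : exists m, [/\ d -> ~~ path (off m) x1 p1, d' -> ~~ path (off m) x2 p2 & gR [::] m].
  apply: (solveR0 hp _ _ nC); first by move=> /hx1 /xing_arcR.
  by move=> /hx2 /xing_arcR.
(* [P1] and [P2] are attached to [k], [P3] and [P4] to [k']. With the edge from [k] to [P1]
   prescribed, the second cut edge is [P3] or [P4]. *)
have g13 : solved V r u v CC \/ exists m, gR [:: P1.2; P3.2] m.
  have st := (nh_n r R P3.2 P4.2 k k' (mem_head P1.2 [:: P2.2])).1.
  have [m [mk pmm _ alt]] := solveR (f := false) (C := [::]) (x := u) (p := [::]) hp st
    (fun h => False_ind _ (notF h)) (fun h => False_ind _ (notF h)) (fun h => False_ind _ (notF h)).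
  case: alt => [[mk' _]|[a [a' [aA aA' ma ma' gB]]]].
    by have := kR P1 in1; rewrite -mk mk' eqxx andbF.
  rewrite mk in ma; subst a; move: aA'; rewrite !inE => /orP[]/eqP e; rewrite e in gB ma'; last by left; exact: done14 gB.
  by right; exists m.
case: g13 => [//|[m13 g13]].
have g24 : solved V r u v CC \/ exists m, gR [:: P2.2; P4.2] m.
  have in4' : P4.2 \in [:: P3.2; P4.2] by rewrite !inE eqxx orbT.
  have st := (nh_n' r R P1.2 P2.2 k k' in4').1.
  have [m [mk pmm _ alt]] := solveR (f := false) (C := [::]) (x := u) (p := [::]) hp st
    (fun h => False_ind _ (notF h)) (fun h => False_ind _ (notF h)) (fun h => False_ind _ (notF h)).
  case: alt => [[mk' _]|[a [a' [aA aA' ma ma' gB]]]].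
    have e : m k' = k by apply: pm_eq pmm _ mk'; rewrite !inE eqxx.
    by have := kR P4 in4; rewrite -mk e eqxx.
  rewrite mk in ma'; subst a'; move: aA; rewrite !inE => /orP[]/eqP e; rewrite e in gB ma; first by left; exact: done14 gB.
  by right; exists m.
case: g24 => [//|[m24 g24]].
have g12 : solved V r u v CC \/ exists m, gR [:: P1.2; P2.2] m /\ (d' -> ~~ path (off m) x2 p2).
  have in1' : P1.2 \in [:: P1.2; P3.2] by rewrite mem_head.
  have st := (nh_n r R P2.2 P4.2 k k' in1').1.
  have arc2 : d' -> arc_of r R CC C2 x2 p2 by move=> /hx2 /xing_arcR[].
  have pe2 : d' -> (x2 = P3.2 /\ last x2 p2 = P4.2) \/ (x2 = P4.2 /\ last x2 p2 = P3.2).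
    by move=> /hx2 /xing_arcR[_ /pends].
  have en2 : d' -> (x2 \in [:: P1.2; P3.2]) && (last x2 p2 \in [:: P2.2; P4.2]) ||
        (x2 \in [:: P2.2; P4.2]) && (last x2 p2 \in [:: P1.2; P3.2]).
    by case/pe2 => -[-> ->]; rewrite !inE !eqxx !orbT.
  have [m [mk pmm hpath alt]] := solveR (f := d') hp1324 st arc2 en2 miss2.
  case: alt => [[mk' _]|[a [a' [aA aA' ma ma' gB]]]].
    by have := kR P1 in1; rewrite -mk mk' eqxx andbF.
  rewrite mk in ma; subst a; move: aA'; rewrite !inE => /orP[]/eqP e; rewrite e in gB ma'; last by left; exact: done14 gB.
  right; exists m; split => // hd'; apply: hpath => //.
  - by rewrite mk; case/andP: (kR P1 in1).
  - by rewrite mk; case: (pe2 hd') => -[-> ->]; rewrite !inE !negb_or f13 f14.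
  by rewrite ma'; case: (pe2 hd') => -[-> ->]; rewrite !inE !negb_or f23 f24.
case: g12 => [//|[m12 [g12 h12]]].
(* The first circuit uses neither [P3] nor [P4], so it must be hit inside a side. Its arc is
   prescribed in [R] when it does not fill [R], and in [W] otherwise. *)
have g34 : solved V r u v CC \/ exists m, gR [:: P3.2; P4.2] m /\ (d && ~~ cov -> ~~ path (off m) x1 p1).
  have in4' : P4.2 \in [:: P2.2; P4.2] by rewrite !inE eqxx orbT.
  have st := (nh_n' r R P1.2 P3.2 k k' in4').1.
  have arc1 : d && ~~ cov -> arc_of r R CC C1 x1 p1 by case/andP => /hx1 /xing_arcR[].
  have pe1 : d && ~~ cov -> (x1 = P1.2 /\ last x1 p1 = P2.2) \/ (x1 = P2.2 /\ last x1 p1 = P1.2).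
    by case/andP => /hx1 /xing_arcR[_ /pends].
  have en1 : d && ~~ cov -> (x1 \in [:: P1.2; P3.2]) && (last x1 p1 \in [:: P2.2; P4.2]) ||
        (x1 \in [:: P2.2; P4.2]) && (last x1 p1 \in [:: P1.2; P3.2]).
    by case/pe1 => -[-> ->]; rewrite !inE !eqxx ?orbT.
  have ms1 : d && ~~ cov -> exists2 z, z \in R & z \notin x1 :: p1 by case/andP => _ /ncovR.
  have [m [mk pmm hpath alt]] := solveR (f := d && ~~ cov) hp1324 st arc1 en1 ms1.
  case: alt => [[mk' _]|[a [a' [aA aA' ma ma' gB]]]].
    have e : m k' = k by apply: pm_eq pmm _ mk'; rewrite !inE eqxx.
    by have := kR P4 in4; rewrite -mk e eqxx.
  rewrite mk in ma'; subst a'; move: aA; rewrite !inE => /orP[]/eqP e; rewrite e in gB ma; first by left; exact: done14 gB.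
  right; exists m; split => // hd; apply: hpath => //.
  - by rewrite ma; case/andP: (kR P3 in3).
  - by rewrite ma; case: (pe1 hd) => -[-> ->]; rewrite !inE !negb_or ![P3.2 == _]eq_sym f13 f23.
  by rewrite mk; case: (pe1 hd) => -[-> ->]; rewrite !inE !negb_or ![P4.2 == _]eq_sym f14 f24.
case: g34 => [//|[m34 [g34 h34]]].
have arcW : d && cov -> arc_of r W CC C1 y1 q1.
  by case/andP => hd hc; have [aW _] := covW hd hc; case: (xing_arcW (hx1 hd) aW).
have peW : d && cov -> (y1 = P1.1 /\ last y1 q1 = P2.1) \/ (y1 = P2.1 /\ last y1 q1 = P1.1).
  by case/andP => hd hc; have [aW _] := covW hd hc; case: (xing_arcW (hx1 hd) aW) => _ /pends.
have enW : d && cov -> (y1 \in [:: P1.1; P4.1]) && (last y1 q1 \in [:: P2.1; P3.1]) ||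
        (y1 \in [:: P2.1; P3.1]) && (last y1 q1 \in [:: P1.1; P4.1]).
  by case/peW => -[-> ->]; rewrite !inE !eqxx ?orbT.
have msW : d && cov -> exists2 z, z \in W & z \notin y1 :: q1.
  by case/andP => hd hc; have [_] := covW hd hc.
(* With [P1], [P4] at one replacing vertex and [P2], [P3] at the other, the answer is never one of
   the pairs 14 and 23, for which [R] has provided nothing. *)
have [m [hpath alt]] := solveW (f := d && cov) uW vW hp1423 arcW enW msW.
case: alt => [[_ g0]|[a [a' [aA aA' ma ma' gB]]]].
  apply: (fin5 (qs := [::]) _ _ g0 gR0 he) => // hd.
  by rewrite r1 // !orbT.
move: aA aA'; rewrite !inE => /orP[]/eqP e /orP[]/eqP e'; rewrite e e' in gB; rewrite e in ma; rewrite e' in ma'.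
- apply: (fin5 (qs := [:: P1; P2]) (uq _ _ e12) (sub2 _ _ in1 in2) gB g12 he) => // h.
    by rewrite inE eqxx.
  by rewrite h12 ?orbT.
- apply: (fin5 (qs := [:: P1; P3]) (uq _ _ e13) (sub2 _ _ in1 in3) gB g13 he) => // h.
    by rewrite !inE eqxx.
  by rewrite !inE eqxx !orbT.
- have gB' : gW true [:: P2.1; P4.1] m by apply: gW_mem gB => z; rewrite !inE orbC.
  apply: (fin5 (qs := [:: P2; P4]) (uq _ _ e24) (sub2 _ _ in2 in4) gB' g24 he) => // h.
    by rewrite !inE eqxx !orbT.
  by rewrite !inE eqxx !orbT.
have gB' : gW true [:: P3.1; P4.1] m by apply: gW_mem gB => z; rewrite !inE orbC.
apply: (fin5 (qs := [:: P3; P4]) (uq _ _ e34) (sub2 _ _ in3 in4) gB' g34 he) => // h; last by rewrite inE eqxx.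
case hc : cov; last by rewrite h34 ?orbT // h hc.
have [aW _] := covW h hc; have hdc : d && cov by rewrite h hc.
rewrite aW hpath ?orbT //.
- rewrite ma; apply: contraTneq n'R => e1; have := (inP in4).1.
  by rewrite e1; exact: (cdD D0).
- by rewrite ma; case: (peW hdc) => -[-> ->]; rewrite !inE !negb_or ![P4.1 == _]eq_sym e14 e24.
by rewrite ma'; case: (peW hdc) => -[-> ->]; rewrite !inE !negb_or ![P3.1 == _]eq_sym e13 e23.
Qed.

Lemma solveWe (Q1 Q2 Q3 Q4 : T * T) (s t : T) (f : bool) C y q :
  perm_eq ps0 [:: Q1; Q2; Q3; Q4] ->
  nh r W Q1.1 Q2.1 Q3.1 Q4.1 n n' s t ->
  (f -> arc_of r W CC C y q) ->
  (f -> (y \in [:: Q1.1; Q2.1]) && (last y q \in [:: Q3.1; Q4.1]) ||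
        (y \in [:: Q3.1; Q4.1]) && (last y q \in [:: Q1.1; Q2.1])) ->
  (f -> exists2 z, z \in W & z \notin y :: q) ->
  exists m, [/\ m s = t, pm (Vh W n n') (nh r W Q1.1 Q2.1 Q3.1 Q4.1 n n') m,
    f -> m n != n' -> m n \notin [:: y; last y q] -> m n' \notin [:: y; last y q] ->
      ~~ path (off m) y q &
    m n = n' /\ gW false [::] m \/
    exists a a', [/\ a \in [:: Q1.1; Q2.1], a' \in [:: Q3.1; Q4.1], m n = a, m n' = a' &
      gW false [:: a; a'] m]].
Proof.
case: Q1 Q2 Q3 Q4 => [a1 b1] [a2 b2] [a3 b3] [a4 b4] /= hq st arc ends miss.
have [D _] := permps hq.
have [m [ms pmm h1 h2]] := solve4X G G3 G4 IH D W3 R3 nR n'R nn' fam st arc ends miss.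
exists m; split => //; case: h2 => [[mn s0]|[a [a' [aA aA' mn mn' s0]]]]; [left | right].
  by split => //; exists [::].
by exists a, a'; split => //; exists [:: a; a'].
Qed.

(** Every matching sought contains [P3]. A solution of [R] on [P1], [P3] would fit [mA]; failing
    that, two pairings force [R] to offer both 23 and 34. In [W], attaching [P1] and [P3] to [n] and
    prescribing [P3] leaves exactly these two answers. *)
Lemma cute13 mA : (u, v) = P3 -> ~~ d' -> gW false [:: P1.1; P3.1] mA -> solved V r u v CC.
Proof.
move=> uvP nd' gA.
have he : false -> u \in W /\ v \in W by [].
have in1 : P1 \in [:: P1; P2; P3; P4] by rewrite !inE eqxx.
have in2 : P2 \in [:: P1; P2; P3; P4] by rewrite !inE eqxx ?orbT.
have in3 : P3 \in [:: P1; P2; P3; P4] by rewrite !inE eqxx ?orbT.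
have in4 : P4 \in [:: P1; P2; P3; P4] by rewrite !inE eqxx ?orbT.
have := uP1; rewrite /= !inE !negb_or => /and4P[/and3P[e12 e13 e14] /andP[e23 e24] e34 _].
have := uP2; rewrite /= !inE !negb_or => /and4P[/and3P[f12 f13 f14] /andP[f23 f24] f34 _].
have uq (P Q : T * T) : P.1 != Q.1 -> uniq [:: P; Q].
  by move=> ne; rewrite /= inE andbT; apply: contra ne => /eqP->.
have sub2 (P Q : T * T) : P \in [:: P1; P2; P3; P4] -> Q \in [:: P1; P2; P3; P4] ->
    {subset [:: P; Q] <= [:: P1; P2; P3; P4]}.
  by move=> hP hQ z; rewrite !inE => /orP[]/eqP->; move: hP hQ; rewrite !inE.
have hd' : d' -> False by rewrite (negbTE nd').
have kR (P : T * T) : P \in [:: P1; P2; P3; P4] -> (P.2 != k) && (P.2 != k').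
  move=> hP; have [_ PR] := inP hP; apply/andP; split; apply: contraTneq PR => ->.
    exact: cdD D0 _ kW.
  exact: cdD D0 _ k'W.
have nW' (P : T * T) : P \in [:: P1; P2; P3; P4] -> (P.1 != n) && (P.1 != n').
  move=> hP; have [PW _] := inP hP; apply/andP; split; apply: contraTneq PW => ->.
    by apply/negP => /(cdD D0); rewrite nR.
  by apply/negP => /(cdD D0); rewrite n'R.
have hp1324 : perm_eq ps0 [:: P1; P3; P2; P4].
  apply: perm_trans hp _; rewrite perm_cons.
  by rewrite (perm_catCA [:: P2] [:: P3] [:: P4]).
have hp1423 : perm_eq ps0 [:: P1; P4; P2; P3].
  apply: perm_trans hp _; rewrite perm_cons.
  exact: permEl (perm_catC [:: P2; P3] [:: P4]).
have done13 mR : gR [:: P1.2; P3.2] mR -> solved V r u v CC.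
  move=> gB; apply: (fin5 (qs := [:: P1; P3]) (uq _ _ e13) (sub2 _ _ in1 in3) gA gB he) => //.
  - by rewrite uvP !inE eqxx orbT.
  - by rewrite !inE eqxx.
have g23 : solved V r u v CC \/ exists m, gR [:: P2.2; P3.2] m.
  have st := (nh_n' r R P1.2 P2.2 k k' (mem_head P3.2 [:: P4.2])).1.
  have [m [mk pmm _ alt]] := solveR (f := false) (C := [::]) (x := u) (p := [::]) hp st
    (fun h => False_ind _ (notF h)) (fun h => False_ind _ (notF h)) (fun h => False_ind _ (notF h)).
  case: alt => [[mk' _]|[a [a' [aA aA' ma ma' gB]]]].
    have e : m k' = k by apply: pm_eq pmm _ mk'; rewrite !inE eqxx.
    by have := kR P3 in3; rewrite -mk e eqxx.
  rewrite mk in ma'; subst a'; move: aA; rewrite !inE => /orP[]/eqP e; rewrite e in gB ma; first by left; exact: done13 gB.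
  by right; exists m.
case: g23 => [//|[m23 g23]].
have g34 : solved V r u v CC \/ exists m, gR [:: P3.2; P4.2] m /\ (d && ~~ cov -> ~~ path (off m) x1 p1).
  have in3' : P3.2 \in [:: P2.2; P3.2] by rewrite !inE eqxx orbT.
  have st := (nh_n' r R P1.2 P4.2 k k' in3').1.
  have arc1 : d && ~~ cov -> arc_of r R CC C1 x1 p1 by case/andP => /hx1 /xing_arcR[].
  have pe1 : d && ~~ cov -> (x1 = P1.2 /\ last x1 p1 = P2.2) \/ (x1 = P2.2 /\ last x1 p1 = P1.2).
    by case/andP => /hx1 /xing_arcR[_ /pends].
  have en1 : d && ~~ cov -> (x1 \in [:: P1.2; P4.2]) && (last x1 p1 \in [:: P2.2; P3.2]) ||
        (x1 \in [:: P2.2; P3.2]) && (last x1 p1 \in [:: P1.2; P4.2]).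
    by case/pe1 => -[-> ->]; rewrite !inE !eqxx ?orbT.
  have ms1 : d && ~~ cov -> exists2 z, z \in R & z \notin x1 :: p1 by case/andP => _ /ncovR.
  have [m [mk pmm hpath alt]] := solveR (f := d && ~~ cov) hp1423 st arc1 en1 ms1.
  case: alt => [[mk' _]|[a [a' [aA aA' ma ma' gB]]]].
    have e : m k' = k by apply: pm_eq pmm _ mk'; rewrite !inE eqxx.
    by have := kR P3 in3; rewrite -mk e eqxx.
  rewrite mk in ma'; subst a'; move: aA; rewrite !inE => /orP[]/eqP e; rewrite e in gB ma; first by left; exact: done13 gB.
  right; exists m; split; first by apply: gR_mem gB => z; rewrite !inE orbC.
  move=> hd; apply: hpath => //.
  - by rewrite ma; case/andP: (kR P4 in4).
  - by rewrite ma; case: (pe1 hd) => -[-> ->]; rewrite !inE !negb_or ![P4.2 == _]eq_sym f14 f24.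
  by rewrite mk; case: (pe1 hd) => -[-> ->]; rewrite !inE !negb_or ![P3.2 == _]eq_sym f13 f23.
case: g34 => [//|[m34 [g34 h34]]].
have arcW : d && cov -> arc_of r W CC C1 y1 q1.
  by case/andP => hd hc; have [aW _] := covW hd hc; case: (xing_arcW (hx1 hd) aW).
have peW : d && cov -> (y1 = P1.1 /\ last y1 q1 = P2.1) \/ (y1 = P2.1 /\ last y1 q1 = P1.1).
  by case/andP => hd hc; have [aW _] := covW hd hc; case: (xing_arcW (hx1 hd) aW) => _ /pends.
have enW : d && cov -> (y1 \in [:: P1.1; P3.1]) && (last y1 q1 \in [:: P2.1; P4.1]) ||
        (y1 \in [:: P2.1; P4.1]) && (last y1 q1 \in [:: P1.1; P3.1]).
  by case/peW => -[-> ->]; rewrite !inE !eqxx ?orbT.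
have msW : d && cov -> exists2 z, z \in W & z \notin y1 :: q1.
  by case/andP => hd hc; have [_] := covW hd hc.
have in3' : P3.1 \in [:: P1.1; P3.1] by rewrite !inE eqxx orbT.
have st := (nh_n r W P2.1 P4.1 n n' in3').1.
have [m [mn pmm hpath alt]] := solveWe (f := d && cov) hp1324 st arcW enW msW.
case: alt => [[mn' _]|[a [a' [aA aA' ma ma' gB]]]].
  by have := nW' P3 in3; rewrite -mn mn' eqxx andbF.
rewrite mn in ma; subst a; move: aA'; rewrite !inE => /orP[]/eqP e; rewrite e in gB ma'.
  have gB' : gW false [:: P2.1; P3.1] m by apply: gW_mem gB => z; rewrite !inE orbC.
  apply: (fin5 (qs := [:: P2; P3]) (uq _ _ e23) (sub2 _ _ in2 in3) gB' g23 he) => //.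
    by rewrite uvP !inE eqxx orbT.
  by rewrite !inE eqxx !orbT.
apply: (fin5 (qs := [:: P3; P4]) (uq _ _ e34) (sub2 _ _ in3 in4) gB g34 he) => // h.
  by rewrite uvP !inE eqxx.
case hc : cov; last by rewrite h34 ?orbT // h hc.
have [aW _] := covW h hc; have hdc : d && cov by rewrite h hc.
rewrite aW hpath ?orbT //.
- by rewrite mn; case/andP: (nW' P3 in3).
- by rewrite mn; case: (peW hdc) => -[-> ->]; rewrite !inE !negb_or ![P3.1 == _]eq_sym e13 e23.
by rewrite ma'; case: (peW hdc) => -[-> ->]; rewrite !inE !negb_or ![P4.1 == _]eq_sym e14 e24.
Qed.

End Labels.

(* At most two circuits cross the 4-cut: the first one through P1 and P2 (if [d]),
   the second one through P3 and P4 (if [d']). *)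
Definition labelling (P1 P2 P3 P4 : T * T) (d d' : bool) : Prop :=
  exists C1 i1 x1 p1 y1 q1 C2 i2 x2 p2 y2 q2,
  [/\ perm_eq ps0 [:: P1; P2; P3; P4], (d -> xing C1 i1 x1 p1 y1 q1 P1 P2),
      (d' -> xing C2 i2 x2 p2 y2 q2 P3 P4), (d' -> d) /\ (d -> d' -> C1 != C2) &
      forall C, C \in CC -> ~~ all [in W] C -> ~~ all [in R] C ->
        d && (C == C1) || d' && (C == C2)].

Lemma labelling12 P1 P2 P3 P4 d d' : labelling P1 P2 P3 P4 d d' -> labelling P2 P1 P3 P4 d d'.
Proof.
move=> [C1 [i1 [x1 [p1 [y1 [q1 [C2 [i2 [x2 [p2 [y2 [q2 [h1 h2 h3 h4 h5]]]]]]]]]]]]].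
exists C1, i1, x1, p1, y1, q1, C2, i2, x2, p2, y2, q2; split => //.
  apply: perm_trans h1 _; exact: permEl (perm_catCA [:: P1] [:: P2] [:: P3; P4]).
by move=> /h2; exact: xing_swap.
Qed.

Lemma labelling34 P1 P2 P3 P4 d d' : labelling P1 P2 P3 P4 d d' -> labelling P1 P2 P4 P3 d d'.
Proof.
move=> [C1 [i1 [x1 [p1 [y1 [q1 [C2 [i2 [x2 [p2 [y2 [q2 [h1 h2 h3 h4 h5]]]]]]]]]]]]].
exists C1, i1, x1, p1, y1, q1, C2, i2, x2, p2, y2, q2; split => //.
  by apply: perm_trans h1 _; rewrite !perm_cons; exact: permEl (perm_catC [:: P3] [:: P4]).
by move=> /h3; exact: xing_swap.
Qed.

Lemma labelled14 P1 P2 P3 P4 d d' mA : labelling P1 P2 P3 P4 d d' ->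
  u \in W -> v \in W -> gW true [:: P1.1; P4.1] mA -> solved V r u v CC.
Proof.
move=> [C1 [i1 [x1 [p1 [y1 [q1 [C2 [i2 [x2 [p2 [y2 [q2 [h1 h2 h3 [h4 h4'] h5]]]]]]]]]]]]] uW vW.
exact: (int14 h1 h2 h3 h4 h4' h5 uW vW).
Qed.

(** If the matching of [W] uses no cut edge, [solveR0] provides its counterpart. Otherwise it uses
    one edge from each pair, and exchanging names within the pairs turns them into [P1] and [P4]. *)
Lemma labelled_in P1 P2 P3 P4 d d' : labelling P1 P2 P3 P4 d d' ->
  u \in W -> v \in W -> solved V r u v CC.
Proof.
move=> lab uW vW.
have := lab; move=> [C1 [i1 [x1 [p1 [y1 [q1 [C2 [i2 [x2 [p2 [y2 [q2 [h1 h2 h3 [h4 h4'] h5]]]]]]]]]]]]].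
have [m [_ alt]] := solveW (f := false) (C := [::]) (y := u) (q := [::]) uW vW h1
    (fun h => False_ind _ (notF h)) (fun h => False_ind _ (notF h)) (fun h => False_ind _ (notF h)).
case: alt => [[_ g0]|[a [a' [aA aA' _ _ gB]]]].
  have [mR0 [r1 r2 gR0]] : exists m, [/\ d -> ~~ path (off m) x1 p1, d' -> ~~ path (off m) x2 p2 & gR [::] m].
    by apply: (solveR0 h1 _ _ h4') => [/h2|/h3] /xing_arcR.
  apply: (fin5 h1 h2 h3 h5 (e := true) (qs := [::]) _ _ g0 gR0) => // hd.
  by rewrite r1 // !orbT.
move: aA aA'; rewrite !inE => /orP[]/eqP e /orP[]/eqP e'; rewrite e e' in gB.
- exact: (labelled14 (labelling34 lab) uW vW gB).
- exact: (labelled14 lab uW vW gB).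
- exact: (labelled14 (labelling34 (labelling12 lab)) uW vW gB).
exact: (labelled14 (labelling12 lab) uW vW gB).
Qed.

Lemma labelled_edge P1 P2 P3 P4 d : labelling P1 P2 P3 P4 d false ->
  (u, v) = P3 -> solved V r u v CC.
Proof.
move=> lab uvP.
have := lab; move=> [C1 [i1 [x1 [p1 [y1 [q1 [C2 [i2 [x2 [p2 [y2 [q2 [h1 h2 h3 [h4 h4'] h5]]]]]]]]]]]]].
have := labelling12 lab; move=> [C1' [i1' [x1' [p1' [y1' [q1' [C2' [i2' [x2' [p2' [y2' [q2' [k1 k2 k3 [k4 k4'] k5]]]]]]]]]]]]].
have st := (nh_n' r W P1.1 P2.1 n n' (mem_head P3.1 [:: P4.1])).1.
have [m [mn pmm _ alt]] := solveWe (f := false) (C := [::]) (y := u) (q := [::]) h1 st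
    (fun h => False_ind _ (notF h)) (fun h => False_ind _ (notF h)) (fun h => False_ind _ (notF h)).
have P3W : P3.1 \in W.
  by apply: (cdm D0 (y := P3.2) _).1; rewrite -surjective_pairing (perm_mem h1) !inE eqxx !orbT.
case: alt => [[mn' _]|[a [a' [aA aA' ma ma' gB]]]].
  have e : m n' = n by apply: pm_eq pmm _ mn'; rewrite !inE eqxx.
  by have := cdD D0 P3W; rewrite -mn e nR.
rewrite mn in ma'; subst a'; move: aA; rewrite !inE => /orP[]/eqP e; rewrite e in gB.
  exact: (cute13 h1 h2 h3 h5 uvP isT gB).
exact: (cute13 k1 k2 k3 k5 uvP isT gB).
Qed.

Hypothesis famN : {in CC, forall C, cycle (noe u v) C}.
Hypothesis ps4 : size ps0 = 4.

Let ups : uniq ps0. Proof. exact: map_uniq (cd1 D0). Qed.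

Let complete2 A B : A \in ps0 -> B \in ps0 -> A != B -> exists P Q, perm_eq ps0 [:: A; B; P; Q].
Proof.
move=> hA hB nAB.
have p1 := perm_to_rem hA; have hB' : B \in rem A ps0 by rewrite (mem_rem_uniq _ ups) inE eq_sym nAB.
have p2 := perm_to_rem hB'.
have := size_rem hB'; rewrite (size_rem hA) ps4 /=.
case E : (rem B _) => [|P [|Q []]] //= _.
exists P, Q; apply: perm_trans p1 _; by rewrite perm_cons -E.
Qed.

Let complete4 A B P Q : uniq [:: A; B; P; Q] -> {subset [:: A; B; P; Q] <= ps0} ->
  perm_eq ps0 [:: A; B; P; Q].
Proof.
move=> uq sub; apply: uniq_perm => // z; apply/esym.
by apply: (uniq_min_size uq sub _).2; rewrite ps4.
Qed.

(** Each crossing circuit occupies two cut edges, none of them [uv] by [famN]. So at most two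
    circuits cross, and at most one if [uv] is a cut edge. *)
Lemma cut4_side : u \in W -> solved V r u v CC.
Proof.
move=> uW.
have ex C : C \in CC -> ~~ all [in W] C -> ~~ all [in R] C -> exists i x p y q,
    xing C i x p y q (last y q, x) (y, last x p).
  move=> CCC nW nR'; have [i [x [p [y [q cr]]]]] := crossing_ex G D0 (fam.1 _ CCC) nW nR'.
  by exists i, x, p, y, q; split.
have mem2 C i x p y q P P' : xing C i x p y q P P' ->
    [/\ (last y q, x) \in ps0, (y, last x p) \in ps0 & (last y q, x) != (y, last x p)].
  move=> [_ _ _ [_ _ h1 h2 [h3 _]] _]; split => //.
  by apply: contra h3 => /eqP[-> _].
have disj C i x p y q P P' C' i' x' p' y' q' Q Q' : xing C i x p y q P P' -> xing C' i' x' p' y' q' Q Q' -> C != C' ->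
    uniq [:: (last y q, x); (y, last x p); (last y' q', x'); (y', last x' p')].
  move=> [h1 _ _ h2 _] [h1' _ _ h2' _] ne; exact: (cross_disj fam h1 h1' ne h2 h2').
have noeP C i x p y q P P' : xing C i x p y q P P' -> ((u, v) != (last y q, x)) && ((u, v) != (y, last x p)).
  move=> [CCC _ _ [E _ _ _ _] _]; have := famN CCC; rewrite -(rot_cycle i) E cycle_cat2.
  case/and4P => _ n1 _ n2; apply/andP; split; apply/eqP => -[e1 e2].
    by move: n2; rewrite /noe -e1 -e2 !eqxx.
  by move: n1; rewrite /noe -e1 -e2 !eqxx orbT.
have uvps : v \notin W -> (u, v) \in ps0.
  by move=> vW; rewrite -(cda D0) // (cd_R D0) inE vW (csupr G uv).
case: (boolP (has (fun C => ~~ all [in W] C && ~~ all [in R] C) CC)) => [/hasP[C1 CC1 /andP[nW1 nR1]]|/hasPn nh]; last first.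
  have lab P1 P2 P3 P4 : perm_eq ps0 [:: P1; P2; P3; P4] -> labelling P1 P2 P3 P4 false false.
    move=> hp; exists [::], 0, u, [::], u, [::], [::], 0, u, [::], u, [::]; split => // C CCC nW nR'.
    by have := nh C CCC; rewrite nW nR'.
  case: (boolP (v \in W)) => [vW|/uvps uvP].
    have [P1 [P2 [P3 [P4 e]]]] : exists P1 P2 P3 P4, ps0 = [:: P1; P2; P3; P4].
      by case: (ps0) ps4 => [|P1 [|P2 [|P3 [|P4 []]]]] // _; exists P1, P2, P3, P4.
    by apply: (labelled_in (lab P1 P2 P3 P4 _) uW vW); rewrite e.
  have p1 := perm_to_rem uvP; have := size_rem uvP; rewrite ps4 /=.
  case E : (rem _ _) => [|P1 [|P2 [|P4 []]]] //= _.
  apply: (labelled_edge (lab P1 P2 (u, v) P4 _)) => //.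
  apply: perm_trans p1 _; rewrite E; exact: permEl (perm_catCA [:: (u, v)] [:: P1; P2] [:: P4]).
have [i1 [x1 [p1 [y1 [q1 xg1]]]]] := ex C1 CC1 nW1 nR1.
have [hA hB nAB] := mem2 _ _ _ _ _ _ _ _ xg1.
case: (boolP (v \in W)) => [vW|/uvps uvP].
  case: (boolP (has (fun C => [&& C != C1, ~~ all [in W] C & ~~ all [in R] C]) CC)) => [/hasP[C2 CC2 /and3P[n21 nW2 nR2]]|/hasPn nh].
    have [i2 [x2 [p2 [y2 [q2 xg2]]]]] := ex C2 CC2 nW2 nR2.
    have [hA2 hB2 nAB2] := mem2 _ _ _ _ _ _ _ _ xg2.
    have n12 : C1 != C2 by rewrite eq_sym.
    have pe : perm_eq ps0 [:: (last y1 q1, x1); (y1, last x1 p1); (last y2 q2, x2); (y2, last x2 p2)].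
      apply: complete4; first exact: disj xg1 xg2 n12.
      by move=> z; rewrite !inE => /or4P[]/eqP->.
    apply: (labelled_in (P1 := (last y1 q1, x1)) (P2 := (y1, last x1 p1)) (P3 := (last y2 q2, x2)) (P4 := (y2, last x2 p2)) (d := true) (d' := true) _ uW vW).
    exists C1, i1, x1, p1, y1, q1, C2, i2, x2, p2, y2, q2; split => // C CCC nW nR'.
    apply/negPn/negP; rewrite !andTb negb_or => /andP[m1 m2].
    have [i3 [x3 [p3 [y3 [q3 xg3]]]]] := ex C CCC nW nR'.
    have [hA3 _ _] := mem2 _ _ _ _ _ _ _ _ xg3.
    have := disj _ _ _ _ _ _ _ _ _ _ _ _ _ _ _ _ xg3 xg1 m1; have := disj _ _ _ _ _ _ _ _ _ _ _ _ _ _ _ _ xg3 xg2 m2.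
    rewrite (perm_mem pe) in hA3; rewrite !cons_uniq => /andP[k1 _] /andP[k2 _].
    by move: hA3 k1 k2; rewrite !in_cons !in_nil !negb_or orbF => /or4P[]->; rewrite ?andbF.
  have [P [Q pe]] := complete2 hA hB nAB.
  apply: (labelled_in (P1 := (last y1 q1, x1)) (P2 := (y1, last x1 p1)) (P3 := P) (P4 := Q) (d := true) (d' := false) _ uW vW).
  exists C1, i1, x1, p1, y1, q1, [::], 0, u, [::], u, [::]; split => // C CCC nW nR'.
  by have := nh C CCC; rewrite nW nR' !andbT negbK => ->.
have /andP[nA nB] := noeP _ _ _ _ _ _ _ _ xg1.
have only C : C \in CC -> ~~ all [in W] C -> ~~ all [in R] C -> C == C1.
  move=> CCC nW nR'; apply/negPn/negP => nC.
  have [i2 [x2 [p2 [y2 [q2 xg2]]]]] := ex C CCC nW nR'.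
  have [hA2 hB2 nAB2] := mem2 _ _ _ _ _ _ _ _ xg2.
  have pe : perm_eq ps0 [:: (last y2 q2, x2); (y2, last x2 p2); (last y1 q1, x1); (y1, last x1 p1)].
    apply: complete4; first exact: disj xg2 xg1 nC.
    by move=> z; rewrite !inE => /or4P[]/eqP->.
  have /andP[nA2 nB2] := noeP _ _ _ _ _ _ _ _ xg2.
  by move: uvP; rewrite (perm_mem pe) !inE (negbTE nA) (negbTE nB) (negbTE nA2) (negbTE nB2).
have [P [Q pe]] := complete2 hA hB nAB.
have lab : labelling (last y1 q1, x1) (y1, last x1 p1) P Q true false.
  exists C1, i1, x1, p1, y1, q1, [::], 0, u, [::], u, [::]; split => // C CCC nW nR'.
  by rewrite only.
move: uvP; rewrite (perm_mem pe) !inE (negbTE nA) (negbTE nB) /= => /orP[]/eqP e.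
  exact: labelled_edge lab e.
exact: labelled_edge (labelling34 lab) e.
Qed.

End Combine.

(** * Graphs with no Hamiltonian circuit to hit *)

Section Main.
Variable T : finType.
Implicit Types (V W R X Y : {set T}) (r : rel T) (x y z : T).

(** At most one edge of [x] stays inside [W], so moving [x] across takes at least two edges out of
    the cut and adds at most one. *)
Lemma one_out V r W x : cgraph V r -> W \subset V -> x \in W ->
  1 < \sum_(y in V :\: W) r x y -> cut r (W :\ x) < cut r W.
Proof.
move=> G sW xW le; have xV := subsetP sW x xW.
have := cutD1 G xV xW; have := en_degC G W xV.
have -> : \sum_(y in ~: W) r x y = \sum_(y in V :\: W) r x y.
  rewrite big_mkcond [RHS]big_mkcond; apply: eq_bigr => y _; rewrite !inE.
  case: (y \in W) => //=; case yV: (y \in V) => //; case rxy: (r x y) => //.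
  by rewrite (csupr G rxy) in yV.
by move: le; move: (\sum_(y in W) _) (\sum_(y in _) _) (cut _ _) (cut _ _); clear; lia.
Qed.

Lemma setDD V W : W \subset V -> V :\: (V :\: W) = W.
Proof. by move=> sW; rewrite setDDr setDv set0U; apply/setIidPr. Qed.

Lemma pick2 (X : {set T}) : 2 < #|X| -> exists x y, [/\ x \in X, y \in X & x != y].
Proof.
move=> h; have /card_gt1P[x [y [xX yX xy]]] : 1 < #|X| by apply: leq_trans h.
by exists x, y.
Qed.

Lemma cut3_solved V r W u v CC : cgraph V r -> tec V r ->
  (forall (V' : {set T}) (r' : rel T), #|V'| < #|V| -> cgraph V' r' -> tec V' r' -> hits_all V' r') ->
  W \subset V -> cut r W <= 3 -> 2 < #|W| -> 2 < #|V :\: W| ->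
  r u v -> family r CC -> {in CC, forall C, exists2 x, x \in V & x \notin C} ->
  solved V r u v CC.
Proof.
move=> G G3 IH sW c3 W3 R3 uv fam famH.
have sR : V :\: W \subset V by apply: subsetDl.
(* The cut edges are disjoint, since moving a vertex with two of them across would leave a cut of at
   most two edges. *)
have out X x : X \subset V -> cut r X <= 3 -> 2 < #|X| -> x \in X -> \sum_(y in V :\: X) r x y <= 1.
  move=> sX cX X3 xX; rewrite leqNgt; apply/negP => /(one_out G sX xX) lt.
  have X1 : 1 < #|X :\ x| by have := cardsD1 x X; rewrite xX; move: X3; clear; lia.
  have : 3 <= cut r (X :\ x).
    apply: G3; first exact: subset_trans (subD1set _ _) sX.
      by rewrite -card_gt0 (ltn_trans _ X1).
    apply: contraTneq (subsetP sX x xX) => e; by rewrite -e !inE eqxx.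
  by rewrite leqNgt (leq_trans lt).
have ceq : cut r W = 3.
  apply/eqP; rewrite eqn_leq c3 G3 //; first by rewrite -card_gt0 (ltn_trans _ W3).
  by apply: contraTneq R3 => ->; rewrite setDv cards0.
have [ps sz D] : exists2 ps, size ps = cut r W & cutdata V r W (V :\: W) ps.
  apply: cut_pairs => // x xW; first exact: out.
  have -> : W = V :\: (V :\: W) by rewrite setDD.
  by apply: out => //; rewrite cutC.
rewrite ceq in sz.
case: (boolP (u \in W)) => uW; first exact: (cut3_side G G3 IH uv fam famH D).
have uR : u \in V :\: W by rewrite inE uW (csup G uv).
by apply: (cut3_side G G3 IH uv fam famH (cutdata_sym G D)) => //; rewrite size_swaps.
Qed.

Lemma cut4_solved V r W u v CC : cgraph V r -> tec V r -> c4 V r ->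
  (forall (V' : {set T}) (r' : rel T), #|V'| < #|V| -> cgraph V' r' -> tec V' r' -> hits_all V' r') ->
  W \subset V -> cut r W = 4 -> 2 < #|W| -> 2 < #|V :\: W| ->
  r u v -> family r CC -> {in CC, forall C, exists2 x, x \in V & x \notin C} ->
  {in CC, forall C, cycle (noe u v) C} ->
  solved V r u v CC.
Proof.
move=> G G3 G4 IH sW c4' W3 R3 uv fam famH famN.
have sR : V :\: W \subset V by apply: subsetDl.
(* Moving a vertex with two cut edges across would leave a cut of at most 3. By parity [X] has at
   least four vertices, so three remain, against [G4]. *)
have out X x : X \subset V -> cut r X = 4 -> 2 < #|X| -> 2 < #|V :\: X| -> x \in X ->
    \sum_(y in V :\: X) r x y <= 1.
  move=> sX cX X3 Y3 xX; rewrite leqNgt; apply/negP => /(one_out G sX xX) lt.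
  have sX1 : X :\ x \subset V by apply: subset_trans (subD1set _ _) sX.
  have oX := odd_cut G sX; rewrite cX in oX lt.
  have cd := cardsD1 x X; rewrite xX in cd.
  case: (G4 _ sX1 lt) => h.
    by move: oX X3 cd h; clear; lia.
  have : #|V :\: X| <= #|V :\: (X :\ x)| by apply: subset_leq_card; apply: setDS; apply: subD1set.
  by rewrite leqNgt (leq_ltn_trans h Y3).
have [ps sz D] : exists2 ps, size ps = cut r W & cutdata V r W (V :\: W) ps.
  apply: cut_pairs => // x xW; first exact: out.
  have -> : W = V :\: (V :\: W) by rewrite setDD.
  by apply: out; rewrite ?cutC ?setDD.
rewrite c4' in sz.
have [k [k' [kW k'W kk']]] := pick2 W3.
have [n [n' [nR n'R nn']]] := pick2 R3.
case: (boolP (u \in W)) => uW.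
  exact: (cut4_side G G3 G4 IH D W3 R3 uv fam famH nR n'R nn' kW k'W kk' famN sz uW).
have uR : u \in V :\: W by rewrite inE uW (csup G uv).
have Ds := cutdata_sym G D; have szs : size (swaps ps) = 4 by rewrite size_swaps.
exact: (cut4_side G G3 G4 IH Ds R3 W3 uv fam famH kW k'W kk' nR n'R nn' famN szs uR).
Qed.

Theorem tec_hits_all V r : cgraph V r -> tec V r -> hits_all V r.
Proof.
have [N] := ubnP #|V|; elim: N V r => // N IHN V r leN G G3 u v CC0 uv fam0 famH0.
have IH (V' : {set T}) (r' : rel T) : #|V'| < #|V| -> cgraph V' r' -> tec V' r' -> hits_all V' r'.
  by move=> lt; apply: IHN; apply: leq_trans lt _.
(* Circuits through [uv] are hit by [uv] itself and are set aside. *)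
pose CC := [seq C <- CC0 | cycle (noe u v) C].
have sub : {subset CC <= CC0} by move=> C; rewrite mem_filter => /andP[].
have fam : family r CC.
  by split=> [C /sub|C D x /sub ? /sub]; [exact: fam0.1 | exact: fam0.2].
have famH : {in CC, forall C, exists2 x, x \in V & x \notin C} by move=> C /sub; exact: famH0.
have famN : {in CC, forall C, cycle (noe u v) C} by move=> C; rewrite mem_filter => /andP[].
suff [m [pmm mu h]] : solved V r u v CC.
  exists m; split => // C CC0C; case nC : (cycle (noe u v) C); first by apply: h; rewrite mem_filter nC.
  by apply: (noe_hit mu _ (negbT nC)); apply: pm_eq pmm _ mu; exact: csup uv.
pose big (X : {set T}) := [&& X \subset V, 2 < #|X| & 2 < #|V :\: X|].
case: (boolP [exists X, big X && (cut r X <= 3)]) => [/existsP[X /andP[/and3P[sX X3 Y3] c3]]|n3].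
  exact: (cut3_solved G G3 IH sX c3 X3 Y3).
have G4 : c4 V r.
  move=> X sX cX; case: (leqP #|X| 2) => [|X3]; first by left.
  case: (leqP #|V :\: X| 2) => [|Y3]; first by right.
  by move: n3; rewrite negb_exists => /forallP /(_ X); rewrite /big sX X3 Y3 cX.
case: (boolP [exists X, big X && (cut r X <= 4)]) => [/existsP[X /andP[/and3P[sX X3 Y3] cX]]|n4].
  have c4' : cut r X = 4.
    apply/eqP; rewrite eqn_leq cX ltnNge; apply/negP => h; case: (G4 X sX h).
      by rewrite leqNgt X3.
    by rewrite leqNgt Y3.
  exact: (cut4_solved G G3 G4 IH sX c4' X3 Y3).
have G5 : c5 V r.
  move=> X sX cX; case: (leqP #|X| 2) => [|X3]; first by left.
  case: (leqP #|V :\: X| 2) => [|Y3]; first by right.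
  by move: n4; rewrite negb_exists => /forallP /(_ X); rewrite /big sX X3 Y3 cX.
case: (ltnP 6 #|V|) => V6; first exact: (c5_solved G G3 G5 V6 IH).
exact: (small_hits G G5 V6).
Qed.

End Main.

(** * Kotzig's theorem *)

Section Kotzig.
Variable T : finType.
Implicit Types (V A B : {set T}) (r : rel T) (x y z w : T) (p s S : seq T) (m : T -> T).

(** Unlike in [pm], the relation may have edges leaving [V], so that a subset of the vertices can be
    treated without restricting [r]. *)
Definition vpm V r m : Prop := forall x, x \in V -> [/\ m x \in V, r x (m x) & m (m x) = x].

Definition other V r m : Prop := exists2 m', vpm V r m' & exists2 x, x \in V & m' x != m x.

Definition mbridge V r m : Prop := exists A x,
  [/\ A \subset V, x \in A, m x \notin A &
      forall a b, a \in A -> b \in V -> b \notin A -> r a b -> a = x /\ b = m x].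

Lemma even_path_pm r s : symmetric r -> uniq s -> sorted r s -> ~~ odd (size s) ->
  exists m, forall x, x \in s -> [/\ m x \in s, r x (m x) & m (m x) = x].
Proof.
move=> rs; have [n] := ubnP (size s); elim: n s => // n IH [|a [|b s]] //= lt.
  by exists id.
move=> /and3P[na nb us] /andP[ab pb]; rewrite negbK => ev.
have so : sorted r s by case: s pb {lt na nb us ev} => //= c s /andP[].
have [m hm] := IH s ltac:(by move: lt; clear; lia) us so ev.
move: na; rewrite inE negb_or => /andP[nab na].
have nba : b == a = false by rewrite eq_sym (negbTE nab).
exists (fun x => if x == a then b else if x == b then a else m x) => x.
have ns y : y \in s -> (y == a = false) * (y == b = false).
  by move=> ys; split; apply/eqP => e; subst y; [move: na | move: nb]; rewrite ys.
rewrite !inE => /or3P[/eqP->|/eqP->|xs].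
- by rewrite !eqxx nba orbT.
- by rewrite nba !eqxx rs.
have [h1 h2 h3] := hm x xs.
by rewrite !(ns _ xs) !(ns _ h1) h1 !orbT.
Qed.

Section Step.
Variables (V : {set T}) (r : rel T) (m : T -> T).
Hypothesis rs : symmetric r.
Hypothesis ri : irreflexive r.
Hypothesis hm : vpm V r m.

Let mV x : x \in V -> m x \in V. Proof. by move=> /hm[]. Qed.
Let mm x : x \in V -> m (m x) = x. Proof. by move=> /hm[]. Qed.
Let rm x : x \in V -> r x (m x). Proof. by move=> /hm[]. Qed.
Let minj x y : x \in V -> y \in V -> m x = m y -> x = y.
Proof. by move=> xV yV e; rewrite -(mm xV) e mm. Qed.

(* The path is listed from its newest end: [:: y_k; ...; y_0] stands for the
   alternating path y_0, m y_1, y_1, ..., m y_k, y_k. *)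
Definition alt p : Prop :=
  [/\ {subset p <= V}, uniq (p ++ map m p) & sorted (fun a b => r b (m a)) p].

(** Matching and non-matching edges are exchanged along the alternating circuit. *)
Lemma alt_cycle_other S : alt S -> cycle (fun a b => r b (m a)) S -> 1 < size S -> other V r m.
Proof.
move=> [sV uS _] cS szS; have := uS; rewrite cat_uniq => /and3P[us /hasPn dis _].
have nS x : x \in S -> m x \notin S.
  by move=> xS; apply: (dis (m x)); apply: map_f.
exists (fun x => if x \in S then m (prev S x) else if m x \in S then next S (m x) else m x).
  move=> x xV; case: ifP => xS.
    have pS : prev S x \in S by rewrite mem_prev.
    rewrite mV ?sV // (prev_cycle cS xS) (negbTE (nS _ pS)) mm ?sV // pS.
    by rewrite next_prev.
  case: ifP => mxS.
    have nx : next S (m x) \in S by rewrite mem_next.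
    rewrite sV // nx prev_next // mm //; split => //.
    by rewrite rs; have := next_cycle cS mxS; rewrite mm.
  by rewrite mxS mm // xS mV // rm.
case: S szS sV uS cS us dis nS => [|y [|y' S]] // _ sV uS cS us dis nS.
exists y; first by rewrite sV // mem_head.
rewrite mem_head; apply/eqP => /minj e.
have yp : prev [:: y, y' & S] y \in [:: y, y' & S] by rewrite mem_prev mem_head.
have e' := e (sV _ yp) (sV _ (mem_head _ _)).
have := next_prev us y; rewrite e' /= eqxx => e2.
by move: us; rewrite /= e2 mem_head.
Qed.

Section Blossom.
Variables (B : seq T) (b : T).
Hypothesis BV : {subset b :: B <= V}.
Hypothesis uB : uniq (b :: B).
Hypothesis cB : cycle r (b :: B).
Hypothesis eB : ~~ odd (size B).
Hypothesis mB : forall x, x \in B -> m x \in B.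

(* The odd circuit b :: B is contracted to b. *)
Definition blV := V :\: [set z in B].
Definition blr : rel T := fun x y => (x != y) &&
  (if x == b then has (fun z => r z y) (b :: B) else
   if y == b then has (fun z => r x z) (b :: B) else r x y).

Let bV : b \in V. Proof. by apply: BV; rewrite mem_head. Qed.
Let bB : b \notin B. Proof. by case/andP: uB. Qed.
Let V1P x : (x \in blV) = (x \in V) && (x \notin B).
Proof. by rewrite /blV !inE andbC. Qed.

(** The mate of the contracted vertex is joined to [z]. Without [z], the odd circuit is a path with
    an even number of vertices, which is matched along itself. *)
Lemma blossom_lift m2 z : vpm blV blr m2 -> z \in b :: B -> r z (m2 b) ->
  exists m', [/\ vpm V r m', m' (m2 b) = z &
     forall x, x \in blV -> x != b -> x != m2 b -> m' x = m2 x].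
Proof.
move=> h2 zB rz; have [i s E] := rot_to zB.
have b1 : b \in blV by rewrite V1P bV.
have [w1 rw mw] := h2 b b1; set w := m2 b in rz w1 rw mw *.
have wB : w \notin b :: B.
  rewrite inE negb_or; move: w1; rewrite V1P => /andP[_ ->]; rewrite andbT.
  by move: rw; rewrite /blr eq_sym => /andP[].
have us : uniq (z :: s) by rewrite -E rot_uniq.
have ms x : (x \in b :: B) = (x == z) || (x \in s) by rewrite -(mem_rot i) E inE.
have so : sorted r s.
  have : cycle r (z :: s) by rewrite -E rot_cycle.
  by case: (s) => //= c s'; rewrite rcons_path => /and3P[].
have es : ~~ odd (size s).
  by have := size_rot i (b :: B); rewrite E /= => -[->].
have [f hf] := even_path_pm rs (andP us).2 so es.
have zs : z \notin s by case/andP: us.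
exists (fun x => if x == w then z else if x == z then w else if x \in s then f x else m2 x).
have wz : w == z = false by apply: contraNF wB => /eqP->.
have ws : w \in s = false by apply: contraNF wB => h; rewrite ms h orbT.
split; last first.
- move=> x xV1 xb xw; rewrite (negbTE xw); have xB : x \notin b :: B.
    by rewrite inE negb_or xb; move: xV1; rewrite V1P => /andP[].
  by move: xB; rewrite ms negb_or => /andP[/negbTE-> /negbTE->].
- by rewrite eqxx.
have wV : w \in V by move: w1; rewrite V1P => /andP[].
move=> x xV; case: (eqVneq x w) => [->|xw].
  by rewrite BV // eq_sym wz eqxx rs.
case: (eqVneq x z) => [->|xz]; first by rewrite wV eqxx.
case: ifP => xs.
  have [f1 f2 f3] := hf x xs; have fw : f x == w = false by apply: contraTF f1 => /eqP->; rewrite ws.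
  have fz : f x == z = false by apply: contraTF f1 => /eqP->.
  by rewrite fw fz f1 f3 BV // ms f1 orbT.
have xnB : x \notin b :: B by rewrite ms negb_or xz xs.
have xb : x != b by apply: contraNneq xnB => ->; rewrite mem_head.
have x1 : x \in blV by rewrite V1P xV; apply: contra xnB => h; rewrite inE h orbT.
have [g1 g2 g3] := h2 x x1.
have mb : m2 x != b by apply: contra xw => /eqP e; rewrite -g3 e.
have mxw : m2 x != w.
  by apply: contra xb => /eqP e; rewrite -g3 e mw.
have mnB : m2 x \notin b :: B by rewrite inE negb_or mb; move: g1; rewrite V1P => /andP[].
move: (mnB); rewrite ms negb_or => /andP[/negbTE e1 /negbTE e2].
rewrite (negbTE mxw) e1 e2 g3; split => //; first by move: g1; rewrite V1P => /andP[].
by move: g2; rewrite /blr (negbTE xb) (negbTE mb) => /andP[].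
Qed.

Lemma blossom_vpm : vpm blV blr m.
Proof.
move=> x; rewrite V1P => /andP[xV xB]; rewrite V1P mV // mm //; split => //.
  by apply: contra xB => h; rewrite -(mm xV); apply: mB.
have nx : x != m x by apply: contraTneq (rm xV) => <-; rewrite ri.
rewrite /blr nx /=; case: eqP => [e|_].
  by rewrite -e rm.
by case: eqP => [e|_]; rewrite /= -?e rm.
Qed.

Lemma blossom_other : other blV blr m -> other V r m.
Proof.
move=> [m2 h2 [x x1 ne]].
have b1 : b \in blV by rewrite V1P bV.
have [w1 rw mw] := h2 b b1.
have [z zB rz] : exists2 z, z \in b :: B & r z (m2 b).
  by move: rw; rewrite /blr eqxx => /andP[_ /hasP].
have [m' [hm' e1 e2]] := blossom_lift h2 zB rz.
exists m' => //.
have wV : m2 b \in V by move: w1; rewrite V1P => /andP[].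
case: (eqVneq (m2 b) (m b)) => [e|nb].
  exists x; first by move: x1; rewrite V1P => /andP[].
  have xb : x != b by apply: contra ne => /eqP->; rewrite e.
  have xw : x != m2 b by apply: contra ne => /eqP->; rewrite mw e mm.
  by rewrite e2.
exists (m2 b) => //; rewrite e1; apply/eqP => ez.
have w1' : m2 b \notin B by move: w1; rewrite V1P => /andP[].
move: zB; rewrite ez inE => /orP[/eqP e|/mB]; last by rewrite mm // (negbTE w1').
by move: nb; rewrite -{2}e mm ?eqxx.
Qed.

(** Contraction may have merged several edges into the bridge. This requires a neighbour of [m b] in
    [B], and then the lift of [m] through that neighbour is another perfect matching. *)
Lemma blossom_mbridge : mbridge blV blr m -> other V r m \/ mbridge V r m.
Proof.
move=> [A [x [sA xA mxA hA]]].
have b1 : b \in blV by rewrite V1P bV.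
case: (boolP (has (fun z => r z (m b)) B)) => [/hasP[z zB rz]|nB].
  left; have zB' : z \in b :: B by rewrite inE zB orbT.
  have [m' [hm' e1 e2]] := blossom_lift blossom_vpm zB' rz.
  exists m' => //; exists (m b); first exact: mV.
  by rewrite e1 mm //; apply: contraNneq bB => <-.
right.
pose A' := if b \in A then A :|: [set z in B] else A.
have sAV : A \subset V by apply: subset_trans sA (subsetDl _ _).
have V1nB y : y \in blV -> y \notin B by rewrite V1P => /andP[].
have x1 := subsetP sA x xA.
have nBA y : y \in A -> y \notin B by move=> /(subsetP sA)/V1nB.
exists A', x; split.
- rewrite /A'; case: ifP => // _; rewrite subUset sAV.
  by apply/subsetP => y; rewrite inE => yB; apply: BV; rewrite inE yB orbT.
- by rewrite /A'; case: ifP; rewrite // inE xA.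
- rewrite /A'; case: ifP => // _; rewrite !inE negb_or mxA /=.
  by have [/V1nB] := blossom_vpm x1.
have [mx1 _ mmx] := blossom_vpm x1.
move=> a c aA cV cA rac.
have nac : a != c by apply: contraTneq rac => ->; rewrite ri.
case: (boolP (a \in B)) => aB.
  have bA : b \in A.
    by move: aA; rewrite /A'; case: ifP => // _ /nBA; rewrite aB.
  have cA2 : c \notin A /\ c \notin B.
    by move: cA; rewrite /A' bA !inE negb_or => /andP[].
  have c1 : c \in blV by rewrite V1P cV; case: cA2.
  have rb : blr b c.
    rewrite /blr eqxx; apply/andP; split; first by apply: contraNneq cA2.1 => <-.
    by apply/hasP; exists a => //; rewrite inE aB orbT.
  have [eb ec] := hA b c bA c1 cA2.1 rb.
  by move/hasPn: nB => /(_ a aB); rewrite eb -ec rac.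
have aA1 : a \in A by move: aA; rewrite /A'; case: ifP => // _; rewrite !inE (negbTE aB) orbF.
case: (boolP (c \in B)) => cB'.
  have bA : b \notin A by move: cA; rewrite /A'; case: ifP => // _; rewrite !inE cB' orbT.
  have ab : a != b by apply: contraNneq bA => <-.
  have rb : blr a b.
    rewrite /blr ab (negbTE ab) eqxx; apply/hasP; exists c => //; by rewrite inE cB' orbT.
  have [ea eb] := hA a b aA1 b1 bA rb.
  move/hasPn: nB => /(_ c cB'); rewrite eb -ea mm ?(subsetP sAV) //.
  by rewrite rs rac.
have c1 : c \in blV by rewrite V1P cV cB'.
have cA1 : c \notin A by move: cA; rewrite /A'; case: ifP => // _; rewrite !inE negb_or => /andP[].
apply: hA => //; rewrite /blr nac /=; case: eqP => [e|_]; first by rewrite -e rac.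
by case: eqP => [e|_]; rewrite /= -?e rac.
Qed.

End Blossom.

(** Restores the mates that the list of an alternating path in [alt] leaves out. *)
Definition fl s := flatten [seq [:: a; m a] | a <- s].

Lemma perm_fl s : perm_eq (fl s) (s ++ map m s).
Proof.
elim: s => //= a s IH; rewrite perm_cons /fl /= -/(fl s) perm_sym.
by rewrite -cat1s perm_catCA /= perm_cons perm_sym.
Qed.

Lemma odd_fl s : ~~ odd (size (fl s)).
Proof. by elim: s => //= a s; rewrite /fl /= -/(fl s) !negbK. Qed.

Lemma path_fl z y s u : r z y -> {subset y :: s <= V} ->
  path (fun a b => r b (m a)) y (rcons s u) -> path r z (rcons (fl (y :: s)) u).
Proof.
elim: s z y => [|c s IH] z y rz sV /=; rewrite rz rm ?sV ?mem_head //=.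
  by rewrite rs.
move=> /andP[h1 h2]; apply: IH => //; first by rewrite rs.
by move=> x xs; apply: sV; rewrite inE xs orbT.
Qed.

End Step.

(* An alternating path is prolonged by an edge outside the matching.  It either
   grows, or closes an alternating circuit, or closes an odd circuit, which is
   contracted. *)
Lemma kotzig V r m : symmetric r -> irreflexive r -> V != set0 -> vpm V r m ->
  other V r m \/ mbridge V r m.
Proof.
have [n] := ubnP #|V|; elim: n V r => // n IH V r lt rs ri V0 hm.
(* A vertex with no neighbour other than its mate gives a bridge at once. *)
case: (boolP [forall x in V, exists y in V, r x y && (y != m x)]); last first.
  rewrite negb_forall_in => /exists_inP[x xV]; rewrite negb_exists_in => /forall_inP h.
  right; exists [set x], x; split; rewrite ?sub1set ?set11 //.
    by rewrite inE; have [_ h2 _] := hm x xV; apply: contraTneq h2 => ->; rewrite ri.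
  move=> a b; rewrite inE => /eqP-> bV _ rb; split=> //.
  by move: (h b bV); rewrite rb /= negbK => /eqP.
move=> /forall_inP hphi.
(* The paths have distinct vertices, so [#|T| - size p] decreases whenever the path grows. *)
have ext k p : #|T| - size p < k -> alt V r m p -> p != [::] -> other V r m \/ mbridge V r m.
  elim: k p => // k IHk [|y p'] // ltp ap _.
  have [sV up sp] := ap; have yV : y \in V by apply: sV; rewrite mem_head.
  have /exists_inP[u uV /andP[ru nu]] := hphi y yV.
  have [muV rmu mmu] := hm u uV.
  have mI a c : a \in V -> c \in V -> m a = m c -> a = c.
    by move=> /hm[_ _ ea] /hm[_ _ ec] e; rewrite -ea e ec.
  (* [u] is an earlier end of the path: the part of the path after [u] closes an odd circuit with
     base [u]. *)
  case: (boolP (u \in y :: p')) => up1.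
    have uy : u != y by apply: contraTneq ru => ->; rewrite ri.
    have [s [t es]] : exists s t, y :: p' = s ++ u :: t.
      by case/splitPr: up1 => s t; exists s, t.
    case: s es => [[e _]|y' s [e1 es]]; first by rewrite e eqxx in uy.
    subst y' p'.
    have sV' : {subset y :: s <= V}.
      by move=> x xs; apply: sV; rewrite -cat_cons mem_cat xs.
    have pm1 := perm_fl m (y :: s).
    have mfl x : (x \in fl m (y :: s)) = (x \in (y :: s) ++ map m (y :: s)).
      exact: perm_mem pm1 x.
    have uB : uniq (u :: fl m (y :: s)).
      have : subseq (u :: (y :: s) ++ map m (y :: s)) (u :: (y :: s) ++ map m (y :: s)) by [].
      move=> _; rewrite cons_uniq mfl (perm_uniq pm1).
      have : perm_eq ((y :: s ++ u :: t) ++ map m (y :: s ++ u :: t))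
           ((u :: (y :: s) ++ map m (y :: s)) ++ (t ++ m u :: map m t)).
        apply/permP => a; do 3! rewrite ?(map_cat, count_cat) /=.
        by clear; lia.
      by move/perm_uniq; rewrite up cat_uniq => /esym/andP[].
    have BV : {subset u :: fl m (y :: s) <= V}.
      move=> x; rewrite inE mfl mem_cat => /or3P[/eqP->|/sV'|/mapP[a aS ->]] //.
      by have [] := hm a (sV' a aS).
    have cB : cycle r (u :: fl m (y :: s)).
      apply: (path_fl rs hm) => //; first by rewrite rs.
      by move: sp; rewrite /= cat_path rcons_path /= => /and3P[-> ->].
    have mB x : x \in fl m (y :: s) -> m x \in fl m (y :: s).
      rewrite !mfl !mem_cat => /orP[h|/mapP[a aS ->]]; first by rewrite map_f ?orbT.
      by have [_ _ ->] := hm a (sV' a aS); rewrite aS.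
    have oB := odd_fl m (y :: s).
    have h1 := blossom_vpm ri hm u mB.
    have lt1 : #|blV V (fl m (y :: s))| < n.
      rewrite -ltnS; apply: leq_trans lt; rewrite ltnS; apply: proper_card; apply/properP; split.
        exact: subsetDl.
      by exists y => //; rewrite /blV in_setD in_set mfl mem_head.
    have rs1 : symmetric (blr r (fl m (y :: s)) u).
      move=> a c; rewrite /blr eq_sym; case: (c =P a) => // ne; congr andb.
      case: (a =P u) => [ea|_]; case: (c =P u) => [ec|_] //.
      + by case: ne; rewrite ea ec.
      + by apply: eq_has => z; rewrite rs.
      + by apply: eq_has => z; rewrite rs.
    have ri1 : irreflexive (blr r (fl m (y :: s)) u) by move=> a; rewrite /blr eqxx.
    have V10 : blV V (fl m (y :: s)) != set0.
      by apply/set0Pn; exists u; rewrite /blV in_setD in_set uV andbT; case/andP: uB.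
    case: (IH _ _ lt1 rs1 ri1 V10 h1) => h.
      by left; apply: (blossom_other rs hm BV uB cB oB mB) h.
    exact: (blossom_mbridge rs ri hm BV uB cB oB mB) h.
  (* [u] is the mate of an earlier end [a]: the path from [u] on closes an alternating circuit. *)
  case: (boolP (u \in map m (y :: p'))) => [/mapP[a ap1 ea]|up2].
    left; have ay : a != y by apply: contraNneq nu => <-; rewrite ea.
    have [s [t es]] : exists s t, y :: p' = rcons s a ++ t.
      by case/path.splitP: ap1 => s t; exists s, t.
    case: s es => [[e _]|y' s [e1 es]]; first by rewrite e eqxx in ay.
    subst y' p'.
    apply: (@alt_cycle_other V r m rs hm (y :: rcons s a)); last by rewrite /= size_rcons.
    - split.
      + by move=> x xs; apply: sV; rewrite -cat_cons mem_cat xs.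
      + move: up; have : perm_eq ((y :: rcons s a ++ t) ++ map m (y :: rcons s a ++ t))
          (((y :: rcons s a) ++ map m (y :: rcons s a)) ++ (t ++ map m t)).
          apply/permP => f; do 3! rewrite ?(map_cat, count_cat) /=.
          by clear; lia.
        by move/perm_uniq => ->; rewrite cat_uniq => /andP[].
      + by move: sp; rewrite /= cat_path => /andP[].
    - move: sp; rewrite /= cat_path => /andP[h _].
      by rewrite rcons_path h last_rcons -ea ru.
  apply: (IHk (m u :: y :: p')) => //.
    have : size (y :: p') < #|T|.
      have : uniq (u :: y :: p') by rewrite cons_uniq up1; move: up; rewrite cat_uniq => /and3P[].
      by move/card_uniqP => e; have := max_card (mem [:: u, y & p']); rewrite e.
    by move: ltp; rewrite /=; clear; lia.
  have mp : (m u \in map m (y :: p')) = (u \in y :: p').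
    apply/mapP/idP => [[a aS e]|h]; last by exists u.
    by rewrite (mI _ _ uV (sV a aS) e).
  have mp2 : (m u \in y :: p') = (u \in map m (y :: p')).
    apply/idP/mapP => [h|[a aS ->]]; first by exists (m u).
    by have [_ _ ->] := hm a (sV a aS).
  split.
  - by move=> x; rewrite inE => /orP[/eqP->|/sV].
  - have -> : map m [:: m u, y & p'] = u :: map m (y :: p') by rewrite /= mmu.
    have umu : u != m u by apply: contraTneq rmu => <-; rewrite ri.
    move: up up1 up2 mp mp2; move: (map m (y :: p')) (y :: p') => M S uSM uS uM e1 e2.
    rewrite -(cat1s u) uniq_catCA /= uSM inE !mem_cat (negbTE umu) (negbTE uS).
    by rewrite e1 e2 (negbTE uS) (negbTE uM).
  - by rewrite /= mmu ru.
have /set0Pn[y yV] := V0; have [myV ry mmy] := hm y yV.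
apply: (ext _ [:: y]) => //; split => //=.
- by move=> x; rewrite inE => /eqP->.
- by rewrite inE andbT; apply: contraTneq ry => <-; rewrite ri.
Qed.
End Kotzig.

(** * Triangles in graphs with a unique perfect matching *)

Section Triangle.
Variable T : finType.
Implicit Types (V A B S X Y : {set T}) (r : rel T) (x y z : T) (m : T -> T).

Lemma other_sub V S r m : S \subset V -> vpm V r m -> vpm S r m ->
  other S r m -> other V r m.
Proof.
move=> /subsetP sS hV hS [m' hm' [x xS ne]].
exists (fun x => if x \in S then m' x else m x); last by exists x; rewrite ?sS ?xS.
move=> y yV; case: ifP => yS.
  by have [h1 h2 h3] := hm' y yS; rewrite sS // h1.
have [h1 h2 h3] := hV y yV; rewrite h1 h2 h3; split => //.
by case: ifP => // h; have [] := hS _ h; rewrite h3 yS.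
Qed.

Lemma cutU_disj r X Y : symmetric r -> [disjoint X & Y] ->
  cut r X + cut r Y = cut r (X :|: Y) + 2 * en r X Y.
Proof.
move=> rs dis.
have h A B : [disjoint A & B] -> cut r A = en r A B + en r A (~: (A :|: B)).
  move=> /pred0P d; rewrite /cut (en_splitr B); congr (_ + _); congr en.
    by apply/setP => y; rewrite !inE; have := d y; rewrite /=; case: (y \in A); case: (y \in B).
  by apply/setP => y; rewrite !inE negb_or andbC.
rewrite (h X Y) // (h Y X) 1?disjoint_sym // (en_sym Y X rs) [Y :|: X]setUC.
have -> : cut r (X :|: Y) = en r X (~: (X :|: Y)) + en r Y (~: (X :|: Y)).
  rewrite {1}/cut (en_splitl X); congr (_ + _); congr en; apply/setP => y; rewrite !inE.
    by case: (y \in X); rewrite ?andbF.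
  by move/pred0P: dis => /(_ y) /=; case: (y \in X); case: (y \in Y).
lia.
Qed.

Lemma en_bridge r X Y x y : (forall a b, a \in X -> b \in Y -> r a b -> a = x /\ b = y) ->
  en r X Y <= 1.
Proof.
move=> h; have le a b : a \in X -> b \in Y -> r a b <= (a == x) && (b == y).
  by move=> aX bY; case rab: (r a b) => //; have [-> ->] := h a b aX bY rab; rewrite !eqxx.
apply: leq_trans (_ : \sum_(a in X) (a == x) <= 1).
  apply: leq_sum => a aX; apply: leq_trans (_ : \sum_(b in Y) ((a == x) && (b == y) : nat) <= _).
    by apply: leq_sum => b bY; exact: le.
  case: (a == x); last by rewrite big1.
  case: (boolP (y \in Y)) => yY.
    by rewrite (bigD1 y) //= eqxx big1 // => b /andP[_ /negbTE->].
  by rewrite big1 // => b bY; case: eqP => // e; rewrite -e bY in yY.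
case: (boolP (x \in X)) => xX.
  by rewrite (bigD1 x) //= eqxx big1 // => b /andP[_ /negbTE->].
by rewrite big1 // => b bY; case: eqP => // e; rewrite -e bY in xX.
Qed.

Section TriIn.
Variables (V : {set T}) (r : rel T).
Hypothesis G : cgraph V r.
Hypothesis G3 : tec V r.

Definition tri a b c := [/\ uniq [:: a; b; c], r a b, r b c & r a c].

Lemma tri3 x y z : x \in V -> y \in V -> z \in V -> uniq [:: x; y; z] ->
  cut r [set x; y; z] = 3 -> tri x y z.
Proof.
move=> xV yV zV u; have := u; rewrite /= !inE !negb_or !andbT => /andP[/andP[xy xz] yz].
have := cutU1 G xV (_ : x \notin [set y; z]); rewrite !inE negb_or xy xz => /(_ isT).
rewrite big_setU1 ?inE //= big_set1 (cut_set2 G yV zV yz) setUA => e1 e2.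
rewrite e2 in e1; split => //; move: e1;
by case: (r x y); case: (r x z); case: (r y z) => //=; clear; lia.
Qed.

Lemma tri_in A x x' m : A \subset V -> cut r A = 3 -> 3 <= #|A| -> x \in A -> x' \notin A ->
  r x x' -> vpm (A :\ x) r m -> ~ other (A :\ x) r m ->
  exists a b c, [/\ tri a b c, {subset [:: a; b; c] <= A} & 3 < #|A| -> x \notin [:: a; b; c]].
Proof.
have [n] := ubnP #|A|; elim: n A x x' => // n IH A x x' lt sA cA A3 xA xA' rx hm nh.
have xV := subsetP sA x xA.
have cx := cardsD1 x A; rewrite xA in cx.
have n0 : A :\ x != set0 by rewrite -card_gt0; move: cx A3; clear; lia.
have [//|[A1 [z [s1 zA1 mz h1]]]] := kotzig (csym G) (cirr G) n0 hm.
have sD : A :\ x \subset A := subD1set _ _.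
set B1 := (A :\ x) :\: A1.
have zD := subsetP s1 z zA1; have [mzD rz mmz] := hm z zD.
have mB1 : m z \in B1 by rewrite inE mz mzD.
have dis : [disjoint A1 & B1].
  by apply/pred0P => y; rewrite /= inE; case: (y \in A1).
have eU : A1 :|: B1 = A :\ x.
  by rewrite /B1 setDE setUIr setUCr setIT; apply/setUidPr.
have hB a b : a \in A1 -> b \in B1 -> r a b -> a = z /\ b = m z.
  by move=> aA; rewrite inE => /andP[bA bD]; apply: h1.
have e1 := en_bridge hB.
have e2 := cutU_disj (csym G) dis.
have e3 := cutD1 G xV xA.
have e4 := en_degC G A xV.
have e5 : 0 < \sum_(y in ~: A) r x y by rewrite (bigD1 x') ?inE //= rx.
have t1 : 3 <= cut r A1.
  apply: G3; first exact: subset_trans (subset_trans s1 sD) sA.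
    by apply/set0Pn; exists z.
  by apply: contraTneq xV => <-; apply/negP => /(subsetP s1); rewrite !inE eqxx.
have sB1 : B1 \subset A :\ x := subsetDl _ _.
have t2 : 3 <= cut r B1.
  apply: G3; first exact: subset_trans (subset_trans sB1 sD) sA.
    by apply/set0Pn; exists (m z).
  by apply: contraTneq xV => <-; apply/negP => /(subsetP sB1); rewrite !inE eqxx.
rewrite eU in e2.
(* [x] has at most two edges inside [A], so [A :\ x] has cut at most 4. With the bridge counted
   twice, the two cuts add up to at most 6, and each is at least 3. *)
have [c1 c2] : cut r A1 = 3 /\ cut r B1 = 3.
  by move: e1 e2 e3 e4 e5 t1 t2; rewrite cA; clear; lia.
have cU : #|A1| + #|B1| = #|A :\ x| by rewrite -eU cardsU (disjoint_setI0 dis) cards0 subn0.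
have o1 := odd_cut G (subset_trans (subset_trans s1 sD) sA).
have o2 := odd_cut G (subset_trans (subset_trans sB1 sD) sA).
rewrite c1 in o1; rewrite c2 in o2.
have rec X y y' : X \subset A :\ x -> cut r X = 3 -> 3 <= #|X| -> y \in X -> y' \notin X ->
  r y y' -> vpm (X :\ y) r m -> exists a b c,
   [/\ tri a b c, {subset [:: a; b; c] <= A} & 3 < #|A| -> x \notin [:: a; b; c]].
  move=> sX cX X3 yX yX' ry hX.
  have ltX : #|X| < n by have := subset_leq_card sX; move: lt cx; clear; lia.
  have sXA := subset_trans sX sD.
  have [|a [b [c [t st _]]]] := IH X y y' ltX (subset_trans sXA sA) cX X3 yX yX' ry hX.
    move=> o; apply: nh; apply: other_sub hm hX o.
    exact: subset_trans (subD1set _ _) sX.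
  exists a, b, c; split => //; first by move=> w /st /(subsetP sXA).
  by move=> _; apply/negP => /st /(subsetP sX); rewrite !inE eqxx.
case: (leqP 3 #|A1|) => [A13|A1lt].
  apply: (rec A1 z (m z)) => // w; rewrite !inE => /andP[wz wA].
  have [g1 g2 g3] := hm w (subsetP s1 w wA); rewrite g2 g3; split => //.
  apply/andP; split.
    by apply: contraNneq mz => <-; rewrite g3.
  by apply: contraNT wz => nw; have [-> _] := h1 w (m w) wA g1 nw g2.
case: (leqP 3 #|B1|) => [B13|B1lt].
  apply: (rec B1 (m z) z) => //.
    by rewrite inE zA1.
    by rewrite (csym G).
  move=> w; rewrite 2!inE => /andP[wz wB].
  have [g1 g2 g3] := hm w (subsetP sB1 w wB); rewrite g2 g3; split => //.
  have nw : m w \notin A1.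
    apply: contra wz => mw.
    have g2' : r (m w) w by rewrite (csym G).
    by have [_ ew] := hB (m w) w mw wB g2'; apply/eqP.
  have mB : m w \in B1 by rewrite inE nw g1.
  rewrite in_setD1 mB andbT.
  by apply: contraTneq wB => e; rewrite -g3 e mmz inE zA1.
have xz : x != z by apply: contraTneq zD => ->; rewrite !inE eqxx.
have xmz : x != m z by apply: contraTneq mzD => <-; rewrite !inE eqxx.
have zmz := cneq G rz.
have k1 : #|A1| = 1 by move: o1 A1lt; clear; lia.
have k2 : #|B1| = 1 by move: o2 B1lt; clear; lia.
have E1 : A1 = [set z].
  by move/eqP/cards1P: k1 => [w E]; move: zA1; rewrite E inE => /eqP->.
have E2 : B1 = [set m z].
  by move/eqP/cards1P: k2 => [w E]; move: mB1; rewrite E inE => /eqP->.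
have EA : A = [set x; z; m z].
  by rewrite -(setD1K xA) -eU E1 E2 setUA.
exists x, z, (m z); split.
- apply: tri3 => //; try by apply: (subsetP sA); apply: (subsetP sD).
    by rewrite /= !inE negb_or xz xmz zmz.
  by rewrite -EA.
- by move=> w; rewrite EA !inE -orbA.
- by move: cx; rewrite -cU k1 k2 => ->.
Qed.

End TriIn.
End Triangle.

Definition uniq_pm (T : finType) (V : {set T}) (r : rel T) u v := forall m m',
  pm V r m -> pm V r m' -> m u = v -> m' u = v -> {in V, m =1 m'}.

(** * Contracting a triangle *)

Section Sub.
Variables (T : finType) (V : {set T}) (r : rel T).
Hypothesis G : cgraph V r.
Local Notation S := {x : T | x \in V}.

Definition sub_rel : rel S := fun x y => r (val x) (val y).

Lemma sub_sym : symmetric sub_rel.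
Proof. by move=> x y; rewrite /sub_rel (csym G). Qed.

Lemma sub_irr : irreflexive sub_rel.
Proof. by move=> x; rewrite /sub_rel (cirr G). Qed.

Lemma sub_en X Y : en sub_rel X Y = en r (val @: X) (val @: Y).
Proof.
rewrite /en big_imset /=; last by move=> x y _ _; exact: val_inj.
apply: eq_bigr => x _; rewrite big_imset //= => y z _ _; exact: val_inj.
Qed.

Lemma sub_setT : val @: [set: S] = V.
Proof.
apply/setP => x; apply/imsetP/idP => [[y _ ->]|xV]; first exact: valP.
by exists (Sub x xV); rewrite ?inE.
Qed.

Lemma sub_cgraph : cgraph [set: S] sub_rel.
Proof.
split; [exact: sub_sym | exact: sub_irr | by move=> *; rewrite inE |] => x _.
rewrite -(cdeg G (valP x)) [RHS](bigID (mem V)) /= [X in _ + X]big1 ?addn0.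
  transitivity (\sum_(y in val @: [set: S]) r (val x) y); last by rewrite sub_setT.
  rewrite big_imset /=; last by move=> y z _ _; exact: val_inj.
  by apply: eq_bigl => y; rewrite inE.
by move=> y yV; case rxy: (r _ y) => //; rewrite (csupr G rxy) in yV.
Qed.

Lemma sub_tec : tec V r -> tec [set: S] sub_rel.
Proof.
move=> G3 X _ X0 XT; rewrite (cutE sub_cgraph) sub_en.
have -> : val @: ([set: S] :\: X) = V :\: (val @: X).
  apply/setP => x; apply/imsetP/setDP => [[y + ->]|[xV nx]].
    rewrite !inE andbT => yX; split; first exact: valP.
    by apply: contra yX => /imsetP[z zX /val_inj->].
  exists (Sub x xV) => //; rewrite !inE andbT; apply: contra nx => xX.
  by apply/imsetP; exists (Sub x xV).
rewrite -(cutE G); apply: G3.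
- by apply/subsetP => _ /imsetP[y _ ->]; exact: valP.
- by rewrite -card_gt0 card_imset ?card_gt0 //; exact: val_inj.
by rewrite -[X in _ != X]sub_setT (inj_eq (imset_inj val_inj)).
Qed.

Lemma sub_pm m : pm [set: S] sub_rel m ->
  exists2 f, pm V r f & forall x, f (val x) = val (m x).
Proof.
move=> hm; exists (fun x => if insub x is Some y then val (m y) else x); last first.
  by move=> x; rewrite valK.
move=> x xV; rewrite (insubT (mem V) xV) /= valK.
by have [h1 h2] := hm (Sub x xV) (in_setT _); rewrite h2.
Qed.

End Sub.

Section Contract.
Variable T : finType.
Implicit Types (V W R : {set T}) (r : rel T) (x y z n : T) (ps : seq (T * T)) (m : T -> T).

Lemma tri_side r a b c d : symmetric r -> tri r a b c -> d \in [:: a; b; c] ->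
  exists m, side [set a; b; c] r m [:: d].
Proof.
move=> rs [u ab bc ac] dd.
move: u; rewrite /= !inE !negb_or !andbT => /andP[/andP[nab nac] nbc].
have [p [q [pq npq [dp dq] E]]] : exists p q, [/\ r p q, p != q, d != p /\ d != q &
    forall x, (x \in [set a; b; c]) = (x \in [:: d; p; q])].
  move: dd; rewrite !inE => /or3P[] /eqP->.
  - by exists b, c; split => // x; rewrite !inE -orbA.
  - exists a, c; rewrite [b == a]eq_sym; split => // x; rewrite !inE.
    by case: (x == a); case: (x == b).
  - exists a, b; rewrite [c == a]eq_sym [c == b]eq_sym; split => // x; rewrite !inE.
    by case: (x == a); case: (x == b); case: (x == c).
exists (fun x => if x == p then q else p) => x; rewrite !E !inE => /or3P[/eqP-> /negP//|/eqP->|/eqP->] _.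
  by rewrite !eqxx ![_ == d]eq_sym (negbTE dq) [q == p]eq_sym (negbTE npq) orbT.
rewrite [q == p]eq_sym (negbTE npq) !eqxx ![_ == d]eq_sym (negbTE dp) rs pq.
by rewrite (negbTE npq).
Qed.

Lemma cut_tri r V a b c : cgraph V r -> tri r a b c -> cut r [set a; b; c] = 3.
Proof.
move=> G [u ab bc ac]; move: u; rewrite /= !inE !negb_or !andbT => /andP[/andP[nab nac] nbc].
have := cutU1 G (csup G ab) (_ : a \notin [set b; c]); rewrite !inE negb_or nab nac => /(_ isT).
rewrite big_setU1 ?inE //= big_set1 (cut_set2 G (csup G bc) (csupr G bc) nbc) setUA ab ac bc.
by clear; lia.
Qed.

Section Tri.
Variables (V : {set T}) (r : rel T) (a b c : T).
Hypothesis G : cgraph V r.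
Hypothesis G3 : tec V r.
Hypothesis V4 : 4 < #|V|.
Hypothesis abc : tri r a b c.
Local Notation R := [set a; b; c].
Local Notation W := (V :\: R).

Let sR : R \subset V.
Proof.
case: abc => _ ab bc _; apply/subsetP => x; rewrite !inE -orbA => /or3P[]/eqP->.
- exact: (csup G ab).
- exact: (csup G bc).
exact: (csupr G bc).
Qed.

Lemma card_tri : #|R| = 3.
Proof. by case: abc => /card_uniqP h _ _ _; rewrite -[RHS]h; apply: eq_card => x; rewrite !inE -orbA. Qed.

Lemma tri_adj x y : x \in R -> y \in R -> r x y = (x != y).
Proof.
have [_ ab bc ac] := abc; have [ba cb ca] : [/\ r b a, r c b & r c a] by split; rewrite (csym G).
move=> xR yR; apply/idP/idP => [/(cneq G)//|]; move: xR yR.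
by rewrite !inE -!orbA => /or3P[]/eqP-> /or3P[]/eqP->; rewrite ?eqxx.
Qed.

Lemma tri_cutdata : exists2 ps, size ps = 3 & cutdata V r W R ps.
Proof.
have e : V :\: W = R by rewrite setDDr setDv set0U; apply/setIidPr.
have [||ps sp D] := @cut_pairs _ V r W G (subsetDl _ _).
- move=> x; rewrite e => /setDP[xV xR].
  have := cutU1 G xV xR; rewrite (cut_tri G abc).
  (* A vertex outside with two neighbours in the triangle would form with it a set of cut at most
     2. *)
  have : 3 <= cut r (x |: R).
    apply: G3.
    - by rewrite subUset sub1set xV.
    - by apply/set0Pn; exists x; rewrite !inE eqxx.
    apply: contraTneq V4 => <-; rewrite cardsU1 xR card_tri; by [].
  by clear; lia.
- move=> y; rewrite e => yR; have yV := subsetP sR y yR.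
  have := en_degC G R yV; have -> : \sum_(z in R) r y z = 2.
    rewrite (bigD1 y) //= (cirr G) add0n.
    rewrite (eq_bigr (fun=> 1)); last by move=> z /andP[zR zy]; rewrite tri_adj // eq_sym zy.
    have e2 : #|R :\ y| = 2 by have := cardsD1 y R; rewrite yR card_tri; clear; lia.
    by rewrite sum1_card -[RHS]e2; apply: eq_card => z; rewrite in_setD1 andbC.
  suff : \sum_(x in W) r y x <= \sum_(x in ~: R) r y x by clear; lia.
  rewrite [leqLHS]big_mkcond [leqRHS]big_mkcond; apply: leq_sum => z _.
  by rewrite !inE; case: (z \in V); rewrite ?andbF ?andbT.
rewrite e in D; exists ps => //.
by rewrite sp -(cut_tri G abc) -(cutC G sR).
Qed.

Section Lift.
Variable ps : seq (T * T).
Hypothesis ps3 : size ps = 3.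
Hypothesis D : cutdata V r W R ps.
Variable n : T.
Hypothesis nR : n \in R.

Lemma tri_lift m : pm (V3 W n) (n3 r W ps n) m -> exists2 M, pm V r M &
  {in W, forall x, if x == m n then (m n, M x) \in ps else M x == m x}.
Proof.
move=> hm; have [d pd E] := n3_out D nR hm.
have L := L3_new D nR.
have s1 := side_new (sW3 W n) L hm E.
have [_ dR] := cdm D pd.
have [mt st] : exists mt, side R r mt [:: d].
  by apply: tri_side (csym G) abc _; move: dR; rewrite !inE -orbA.
have [||M [hM e1 e2 e3]] := @glue_cut _ _ _ _ _ _ G D m mt [:: (m n, d)] _ _ s1 st.
- by move=> p; rewrite inE => /eqP->.
- by [].
exists M => // x xW; case: (x =P m n) => [->|/eqP xm].
  by have [-> _] := e3 _ _ (mem_head _ _).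
by rewrite e1 //= mem_seq1.
Qed.

(** The lifts of two matchings through [uv] also contain [uv], hence agree. A lift determines which
    cut edge is used, and with it the matching of the contracted graph. *)
Lemma tri_unique u v : u \in W -> v \in W -> uniq_pm V r u v ->
  uniq_pm (V3 W n) (n3 r W ps n) u v.
Proof.
move=> uW vW U m m' hm hm' eu eu'.
have [M hM EM] := tri_lift hm; have [M' hM' EM'] := tri_lift hm'.
have nW := nW3 D nR.
have key f F : pm (V3 W n) (n3 r W ps n) f -> f u = v ->
    {in W, forall x, if x == f n then (f n, F x) \in ps else F x == f x} -> F u = v.
  move=> hf fu /(_ u uW); case: eqP => [e|_ /eqP->//].
  by move: nW; have [_ ee] := hf n (setU11 _ _); rewrite -ee -e fu vW.
have eM := U M M' hM hM' (key _ _ hm eu EM) (key _ _ hm' eu' EM').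
have mW f : pm (V3 W n) (n3 r W ps n) f -> f n \in W.
  by move=> hf; have [d pd _] := n3_out D nR hf; have [] := cdm D pd.
have fW f x : pm (V3 W n) (n3 r W ps n) f -> x \in W -> x != f n -> f x \in W.
  move=> hf xW xn; have x3 := subsetP (sW3 W n) x xW; have [rx ff] := hf x x3.
  have : f x \in V3 W n by apply: csupr (n3_cgraph G D ps3 nR) _ _ rx.
  by rewrite inE => /orP[|//]; rewrite inE => /eqP e; rewrite -ff e eqxx in xn.
have sWV : {subset W <= V} by move=> x /setDP[].
have eqn : m n = m' n.
  apply/eqP; case: (m n =P m' n) => // /eqP ne.
  have h1 := EM _ (mW _ hm); have h2 := EM' _ (mW _ hm); rewrite eqxx in h1; rewrite (negbTE ne) in h2; move/eqP: h2 => h2.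
  have := fW _ _ hm' (mW _ hm) ne; rewrite -h2 -eM ?sWV ?mW // => h3.
  by have [_ /negP] := cdm D h1; have := cdD D h3; case: (_ \in _).
move=> x; rewrite inE => /orP[/set1P->//|xW].
have h1 := EM x xW; have h2 := EM' x xW; move: h1 h2; rewrite -eqn.
case: (x =P m n) => [-> _ _|_ /eqP<- /eqP<-]; last by rewrite eM ?sWV.
have [_ e1] := hm n (setU11 _ _); have [_ e2] := hm' n (setU11 _ _).
by rewrite e1 eqn e2.
Qed.

End Lift.
End Tri.
End Contract.

Definition sub_graph (T : finType) (V : {set T}) r (G : cgraph V r) : sgraph :=
  SGraph (sub_sym G) (sub_irr G).

(** * Recovering a graph by expanding the contracted vertex *)

Section Expand.
Variable G : sgraph.
Local Notation VG := [set: G].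
Local Notation r := (@adj G).
Variables (a b c n : G) (ps : seq (G * G)).
Local Notation R := [set a; b; c].
Local Notation W := (VG :\: R).
Hypothesis cG : cgraph VG r.
Hypothesis abc : tri r a b c.
Hypothesis ps3 : size ps = 3.
Hypothesis D : cutdata VG r W R ps.
Hypothesis nR : n \in R.
Hypothesis cH : cgraph (V3 W n) (n3 r W ps n).
Local Notation H := (sub_graph cH).
Definition vH : H := exist _ n (setU11 n W).

(** The end in the triangle of the cut edge at [x], with default value [x] where there is no such
    edge. *)
Definition mate (x : G) : G := nth x (unzip2 ps) (index x (unzip1 ps)).

Lemma mateP x : x \in unzip1 ps -> (x, mate x) \in ps.
Proof.
move=> xp; have lt : index x (unzip1 ps) < size ps by rewrite -(size_map fst) index_mem.
suff <- : nth (x, x) ps (index x (unzip1 ps)) = (x, mate x) by rewrite mem_nth.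
rewrite /mate (nth_map (x, x)) //.
rewrite [LHS]surjective_pairing; congr pair.
by rewrite -(nth_map _ x) // nth_index.
Qed.

Lemma vH_nbr (y : H) : adj vH y = (val y \in unzip1 ps).
Proof.
rewrite /= /sub_rel /n3 /nrel /= (negbTE (nW3 D nR)) /= !(memL3 _ _ _) eqxx /=.
by case: (val y =P n) => [e|_] /=; rewrite ?orbF // e orbb.
Qed.

(** The inverse of the isomorphism: the new vertex attached to a neighbour of [n] goes to the
    triangle vertex that this neighbour is joined to in [G]. *)
Definition gE (p : expand vH) : G :=
  match p with inl x => val (val x) | inr y => mate (val (val y)) end.

Lemma gE_inl (x : {x : H | x != vH}) : val (val x) \in W /\ val (val x) != n.
Proof.
have xn : val (val x) != n.
  apply/negP => /eqP e; have := valP x; rewrite -val_eqE /= => /negP; apply; exact/eqP.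
split=> //; have := valP (val x); rewrite inE => /orP[/set1P e|//].
by rewrite e eqxx in xn.
Qed.

Lemma gE_inr (y : {y : H | adj vH y}) : (val (val y), mate (val (val y))) \in ps.
Proof. by apply: mateP; rewrite -vH_nbr; exact: (valP y). Qed.

Lemma gE_adj p q : r (gE p) (gE q) = adj p q.
Proof.
have ir (x : {x : H | x != vH}) (y : {y : H | adj vH y}) :
    r (val (val x)) (mate (val (val y))) = (val x == val y).
  have [xW _] := gE_inl x; have yp := gE_inr y; have [_ yR] := cdm D yp.
  rewrite (cda D) // -val_eqE; apply/idP/eqP => [h|->//]; exact: (cd_inj2 D h yp).
case: p q => [x|x] [y|y] /=.
- have [xW xn] := gE_inl x; have [yW yn] := gE_inl y.
  by rewrite /sub_rel /n3 /nrel xW yW !memL3 (negbTE xn) (negbTE yn) !orbF.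
- exact: ir.
- by rewrite (csym cG) ir eq_sym.
have xp := gE_inr x; have [_ xR] := cdm D xp.
have yp := gE_inr y; have [_ yR] := cdm D yp.
rewrite (tri_adj cG abc xR yR); congr negb.
rewrite -[x == y]val_eqE -[val x == val y]val_eqE; apply/eqP/eqP => [e|-> //].
by rewrite e in xp; exact: (cd_inj2 D xp yp).
Qed.

Lemma gE_inj : injective gE.
Proof.
case=> [x|x] [y|y] e.
- by congr inl; apply: val_inj; apply: val_inj.
- have [xW _] := gE_inl x; have [_ yR] := cdm D (gE_inr y).
  by have := cdD D xW; rewrite (e : val (val x) = mate (val (val y))) yR.
- have [yW _] := gE_inl y; have [_ xR] := cdm D (gE_inr x).
  by have := cdD D yW; rewrite -(e : mate (val (val x)) = val (val y)) xR.
congr inr; apply: val_inj; apply: val_inj.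
have xp := gE_inr x; rewrite (e : mate (val (val x)) = mate (val (val y))) in xp; exact: (cd_inj2 D xp (gE_inr y)).
Qed.

Lemma expand_iso : isomorphic G (expand vH).
Proof.
have cE : #|G| <= #|expand vH|.
  rewrite card_sum !card_sig.
  have -> : #|[pred x : H | x != vH]| = #|W|.
    have := cardC1 vH; rewrite card_sig => e; rewrite [LHS]e.
    by rewrite (_ : #|_| = #|V3 W n|) ?cardsU1 ?(nW3 D nR) //; apply: eq_card.
  have -> : #|[pred x : H | adj vH x]| = 3.
    rewrite -[RHS]ps3 -(size_map fst) -(card_uniqP (cd1 D)).
    rewrite -(card_imset _ val_inj); apply: eq_card => x; apply/imsetP/idP.
      by case=> y; rewrite inE vH_nbr => h ->.
    move=> h; have xW : x \in V3 W n.
      by case/mapP: h => -[p q] /(cdm D)[pW _] ->; rewrite inE pW orbT.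
    by exists (exist _ x xW) => //; rewrite inE vH_nbr.
  by have := cardsID R VG; rewrite setTI cardsT (card_tri abc); clear; lia.
have [f fK gK] := inj_card_bij gE_inj cE.
exists f; first by exists gE.
by move=> x y; rewrite -gE_adj !gK.
Qed.

End Expand.

Lemma klee4 (G : sgraph) : cgraph [set: G] (@adj G) -> #|G| = 4 -> klee G.
Proof.
move=> cG G4; apply: klee_K4; exists (fun x => cast_ord G4 (enum_rank x)).
  exists (fun i => enum_val (cast_ord (esym G4) i)) => x.
    by rewrite cast_ordK enum_rankK.
  by rewrite enum_valK cast_ordKV.
move=> x y; rewrite /= /complete_adj (inj_eq (@cast_ord_inj _ _ G4)) (inj_eq enum_rank_inj).
apply/idP/idP => [xy|/(cneq cG)//]; case nxy: (adj x y) => //.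
suff : \sum_z adj x z < 3 by rewrite (cdeg cG).
have le : \sum_z adj x z <= #|[set~ x] :\ y|.
  rewrite -sum1_card [leqRHS]big_mkcond; apply: leq_sum => z _.
  rewrite !inE; case: (z =P y) => [->|_]; first by rewrite nxy.
  by case: (z =P x) => [->|_]; [rewrite (cirr cG) | case: (adj x z)].
have := cardsD1 y [set~ x]; rewrite cardsC1 G4 !inE eq_sym xy.
by move: le; clear; lia.
Qed.

(** [tri_in] is applied to the complement of [v], which has cut 3, with [u] as the exceptional
    vertex; without [u] it has a single perfect matching. Beyond four vertices the triangle found
    avoids both [u] and [v], so that uniqueness passes to the contraction. *)
Theorem unique_klee (G : sgraph) (u v : G) : cgraph [set: G] (@adj G) ->
  tec [set: G] (@adj G) -> adj u v -> uniq_pm [set: G] (@adj G) u v -> klee G.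
Proof.
have [N] := ubnP #|G|; elim: N G u v => // N IH G u v lt cG tG uv U.
have xT (x : G) : x \in [set: G] by rewrite inE.
have sz : 4 <= #|G|.
  have [p [q [w [un E]]]] := cnbr cG (xT u).
  have un4 : uniq [:: u; p; q; w] by rewrite cons_uniq un andbT -E (cirr cG).
  by have := max_card (mem [:: u; p; q; w]); rewrite (card_uniqP un4).
case: (ltngtP #|G| 4) => [|G4|/(klee4 cG)//]; first by rewrite ltnNge sz.
have uv' := cneq cG uv.
(* With the empty family, [tec_hits_all] says that each edge lies in a perfect matching. *)
have [m [hm mu _]] : exists m, [/\ pm [set: G] (@adj G) m, m u = v & {in [::], forall c, hit m c}].
  by apply: (tec_hits_all cG tG uv).
have mv : m v = u by apply: (pm_eq hm (xT u) mu).
have cC : cut (@adj G) [set~ v] = 3.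
  rewrite -setTD (cutC cG (subsetT _)).
  by have := cutU1 cG (xT v) (negbT (in_set0 v)); rewrite setU0 big_set0 /cut en0l; clear; lia.
have vm : vpm ([set~ v] :\ u) (@adj G) m.
  move=> x; rewrite !inE => /andP[xu xv]; have [h1 h2] := hm x (xT x).
  rewrite h1 h2; split => //; apply/andP; split.
    by apply: contra xv => /eqP e; rewrite -h2 e mu.
  by apply: contra xu => /eqP e; rewrite -h2 e mv.
have nh : ~ other ([set~ v] :\ u) (@adj G) m.
  move=> [m' hm' [x xA ne]].
  pose M z := if z == u then v else if z == v then u else m' z.
  have hM : pm [set: G] (@adj G) M.
    move=> z _; rewrite /M; case: (z =P u) => [->|/eqP zu].
      by rewrite [v == u]eq_sym (negbTE uv') eqxx uv.
    case: (z =P v) => [->|/eqP zv]; first by rewrite eqxx (csym cG).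
    have [|h1 h2 h3] := hm' z; first by rewrite !inE zu zv.
    by move: h1; rewrite !inE => /andP[/negbTE-> /negbTE->].
  have := U M m hM hm _ mu x (xT x); rewrite /M eqxx => /(_ erefl).
  by move: xA; rewrite !inE => /andP[/negbTE-> /negbTE->] e; rewrite e eqxx in ne.
have cA : #|[set~ v]| = #|G|.-1 by rewrite cardsC1.
have [|||a [b [c [abc sA hA]]]] := @tri_in _ _ _ cG tG [set~ v] u v m (subsetT _) cC _ _ _ uv vm nh.
- by rewrite cA; move: G4; clear; lia.
- by rewrite !inE.
- by rewrite !inE eqxx.
have nu : u \notin [:: a; b; c] by apply: hA; rewrite cA; move: G4; clear; lia.
have nv : v \notin [:: a; b; c] by apply/negP => /sA; rewrite !inE eqxx.
have G4' : 4 < #|[set: G]| by rewrite cardsT.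
have [ps ps3 D] := tri_cutdata cG tG G4' abc.
have aR : a \in [set a; b; c] by rewrite !inE eqxx.
have cH := n3_cgraph cG D ps3 aR.
have R3 : 2 < #|[set a; b; c]| by rewrite (card_tri abc).
have tH := n3_tec cG tG D ps3 R3 aR.
apply: klee_expand _ (expand_iso cG abc ps3 D aR cH).
have uW : u \in [set: G] :\: [set a; b; c] by rewrite in_setD in_setT andbT; move: nu; rewrite !inE -orbA.
have vW : v \in [set: G] :\: [set a; b; c] by rewrite in_setD in_setT andbT; move: nv; rewrite !inE -orbA.
have UH := tri_unique cG abc ps3 D aR uW vW U.
have uH := subsetP (sW3 _ a) u uW; have vH' := subsetP (sW3 _ a) v vW.
apply: (IH (sub_graph cH) (exist _ u uH) (exist _ v vH')).
- have := V3_card D R3 aR; rewrite cardsT /= card_sig => h.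
  by rewrite -ltnS; apply: leq_ltn_trans lt; apply: leq_trans h; rewrite ltnS.
- exact: sub_cgraph.
- exact: sub_tec.
- by rewrite /= /sub_rel /n3 /nrel /= uW vW uv.
move=> m1 m2 hm1 hm2 e1 e2 x _.
have [f1 p1 q1] := sub_pm hm1; have [f2 p2 q2] := sub_pm hm2.
apply: val_inj; rewrite -q1 -q2; apply: UH => //; last exact: (valP x).
  by rewrite (q1 (exist _ u uH)) e1.
by rewrite (q2 (exist _ u uH)) e2.
Qed.

(** * Circuits as subgraphs *)

Section MinDegree.
Variables (T : finType) (e : rel T) (X : {set T}).
Hypothesis es : symmetric e.
Hypothesis ei : irreflexive e.

(** A path that is prolonged without turning back to the preceding vertex finally meets itself, and
    that closes a circuit. *)
Lemma min_deg_circ : X != set0 ->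
  (forall x y, x \in X -> exists z, [/\ z \in X, e x z & z != y]) ->
  exists2 c, circ e c & {subset c <= X}.
Proof.
move=> /set0Pn[x0 x0X] h.
have ext k p : #|T| - size p < k -> {subset p <= X} -> uniq p -> sorted e p -> p != [::] ->
    exists2 c, circ e c & {subset c <= X}.
  elim: k p => // k IH [|y p] // lt sp up ep _.
  (* [head y p] is the vertex before [y] on the path. For a path with one vertex it is [y], which
     [z] avoids anyway as there are no loops. *)
  have [z [zX yz zh]] := h y (head y p) (sp y (mem_head _ _)).
  case: (boolP (z \in y :: p)) => zp.
    have zy : z != y by apply: contraTneq yz => ->; rewrite ei.
    move: zp; rewrite inE (negbTE zy) /= => zp.
    have [s [t es1]] : exists s t, p = rcons s z ++ t by case/path.splitP: zp => s t; exists s, t.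
    subst p; exists (y :: rcons s z); last by move=> x xs; apply: sp; rewrite -cat_cons mem_cat xs.
    apply/and3P; split.
    - by move: up; rewrite -cat_cons cat_uniq => /andP[].
    - rewrite /= rcons_path last_rcons es yz andbT.
      by move: ep; rewrite /= cat_path => /andP[].
    by case: s {up lt sp ep zp} zh => [|w s] /=; [rewrite eqxx | rewrite size_rcons].
  apply: (IH (z :: y :: p)) => //.
  - have : uniq (z :: y :: p) by rewrite cons_uniq zp.
    move/card_uniqP => E; have := max_card (mem [:: z, y & p]); rewrite E.
    by move: lt; rewrite /=; clear; lia.
  - by move=> x; rewrite inE => /orP[/eqP->|/sp].
  - by rewrite cons_uniq zp.
  by rewrite /= es yz.
apply: (ext _ [:: x0]) => // x; by rewrite inE => /eqP->.
Qed.

End MinDegree.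

(** [en r X X] counts every edge twice, so there are at least as many edges as vertices. Deleting a
    vertex of degree at most 1 preserves this, and without such a vertex [min_deg_circ] applies. *)
Lemma dense_circ (T : finType) (r : rel T) (X : {set T}) : symmetric r -> irreflexive r ->
  X != set0 -> 2 * #|X| <= en r X X -> exists2 c, circ r c & {subset c <= X}.
Proof.
move=> rs ri; have [n] := ubnP #|X|; elim: n X => // n IH X lt X0 eX.
case: (boolP [exists x in X, \sum_(y in X) r x y <= 1]) => [/exists_inP[x xX le]|]; last first.
  rewrite negb_exists_in => /forall_inP h; apply: min_deg_circ => // x y xX.
  have := h x xX; rewrite -ltnNge => h2.
  have /exists_inP[z zX /andP[xz zy]] : [exists z in X, r x z && (z != y)].
    apply: contraLR h2; rewrite negb_exists_in -leqNgt => /forall_inP hz.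
    apply: leq_trans (_ : \sum_(z in X) (z == y) <= 1).
      apply: leq_sum => z zX; have := hz z zX; by case: (r x z); case: (z == y).
    case: (boolP (y \in X)) => yX.
      by rewrite (bigD1 y) //= eqxx big1 // => b /andP[_ /negbTE->].
    by rewrite big1 // => b bY; case: eqP => // ee; rewrite -ee bY in yX.
  by exists z.
have eD : en r X X = en r (X :\ x) (X :\ x) + 2 * \sum_(y in X) r x y.
  rewrite /en (big_setD1 x xX) /=.
  have -> : \sum_(y in X :\ x) \sum_(z in X) r y z =
    \sum_(y in X :\ x) r x y + \sum_(y in X :\ x) \sum_(z in X :\ x) r y z.
    by rewrite -big_split; apply: eq_bigr => y _; rewrite (big_setD1 x xX) /= rs.
  by rewrite (big_setD1 x xX) /= ri; clear; lia.
have cX := cardsD1 x X; rewrite xX in cX.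
have [||| c cc sc] := IH (X :\ x).
- by move: lt cX; clear; lia.
- rewrite -card_gt0; apply: contraTT eX; rewrite -eqn0Ngt => /eqP c0.
  rewrite eD cX c0 (_ : en r _ _ = 0); last by move/eqP: c0; rewrite cards_eq0 => /eqP->; rewrite en0l.
  rewrite (big_setD1 x xX) /= ri big1 // => y; move/eqP: c0; rewrite cards_eq0 => /eqP->.
  by rewrite inE.
- by move: eX eD le cX; clear; lia.
by exists c => // y /sc; rewrite inE => /andP[].
Qed.

Section CircEdges.
Variable T : finType.
Implicit Types (r : rel T) (c : seq T).

Lemma next_neq_prev r c x : circ r c -> x \in c -> next c x != prev c x.
Proof.
move=> /and3P[uc _ sc] xc; have [i s E] := rot_to xc.
have us : uniq (x :: s) by rewrite -E rot_uniq.
have ss : 2 < size (x :: s) by rewrite -E size_rot.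
rewrite -(next_rot i uc) -(prev_rot i uc) E; apply/eqP => e.
have e2 : next (x :: s) (next (x :: s) x) = x by rewrite e next_prev.
case: s us ss e2 {E e} => [|a [|b s]] //= us _; rewrite eqxx.
have /negbTE nxa : a != x by rewrite eq_sym; move: us; rewrite inE negb_or => /andP[/andP[]].
by rewrite nxa eqxx => eb; move: us; rewrite eb !inE eqxx orbT.
Qed.

Definition cedges c : {set {set T}} := [set [set x; next c x] | x in c].

End CircEdges.

(** * From the notions of the statement to lists of vertices *)

Section Translate.
Variable G : sgraph.
Local Notation VG := [set: G].
Local Notation r := (@adj G).

Lemma edgesP f : reflect (exists x y, adj x y /\ f = [set x; y]) (f \in edges G).
Proof.
rewrite inE; apply: (iffP existsP) => [[x /existsP[y /andP[xy /eqP->]]]|[x [y [xy ->]]]].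
  by exists x, y.
by exists x; apply/existsP; exists y; rewrite xy eqxx.
Qed.

Lemma edge_in (x y : G) : ([set x; y] \in edges G) = adj x y.
Proof.
apply/edgesP/idP => [[a [b [ab e]]]|xy]; last by exists x, y.
have ne : a != b by apply: contraTneq ab => ->; rewrite adj_irrefl.
have xy : x != y.
  by apply: contra_neq ne => exy; move/setP: e => e; have := e a; have := e b;
     rewrite !inE exy !orbb !eqxx orbT /= => /eqP-> /eqP->.
have := set21 x y; rewrite e !inE => /orP[]/eqP ex; have := set22 x y; rewrite e !inE => /orP[]/eqP ey.
- by rewrite ex ey eqxx in xy.
- by rewrite ex ey.
- by rewrite ex ey adj_sym.
by rewrite ex ey eqxx in xy.
Qed.

Lemma cubic_cgraph : cubic G -> cgraph VG r.
Proof.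
move=> h; split; [exact: adj_sym | exact: adj_irrefl | by move=> *; rewrite inE |] => x _.
by rewrite -[RHS](h x) -big_mkcond /= sum1_card; apply: eq_card => y; rewrite !inE.
Qed.

Lemma circ_circuit (c : seq G) : circ r c -> circuit ([set x in c], cedges c).
Proof.
move=> cc; have [uc cy sc] := and3P cc.
have R : cycle [rel u v | [set u; v] \in cedges c] c.
  by apply: cycle_from_next => // x xc; apply: imset_f.
apply/and3P; split => /=.
- apply/andP; split.
    apply/subsetP => f /imsetP[x xc ->]; rewrite edge_in; exact: next_cycle cy xc.
  apply/forall_inP => f /imsetP[x xc ->]; apply/subsetP => y.
  by rewrite !inE => /orP[]/eqP->; rewrite ?mem_next.
- apply/forall_inP => x; rewrite inE => xc; rewrite /edge_degree /=.
  have px : prev c x \in c by rewrite mem_prev.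
  have -> : [set f in cedges c | x \in f] = [set [set x; next c x]; [set x; prev c x]].
    apply/setP => f; rewrite !inE; apply/andP/orP.
      move=> [/imsetP[y yc ->]]; rewrite !inE => /orP[]/eqP->; first by left.
      by right; rewrite prev_next // setUC.
    case=> /eqP->; rewrite set21; split=> //; apply/imsetP.
      by exists x.
    by exists (prev c x) => //; rewrite next_prev // setUC.
  rewrite cards2; have ne := next_neq_prev cc xc.
  suff -> : [set x; next c x] != [set x; prev c x] by [].
  apply/eqP => e.
  have := set22 x (next c x); rewrite e !inE (negbTE ne) orbF => /eqP e1.
  by have := next_cycle cy xc; rewrite e1 adj_irrefl.
apply/andP; split.
  by apply/set0Pn; case: c sc {cc uc cy R} => // x c _; exists x; rewrite inE mem_head.
apply/forall_inP => x; rewrite inE => xc; apply/forall_inP => y; rewrite inE => yc.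
have [i s E] := rot_to xc.
have : cycle [rel u v | [set u; v] \in cedges c] (x :: s) by rewrite -E rot_cycle.
rewrite /= rcons_path => /andP[pth _].
by apply: (path_connect pth); rewrite -E mem_rot.
Qed.

Lemma cut_sizeE A : cut_size A <= cut r A.
Proof.
pose S := [set p : G * G | [&& p.1 \in A, p.2 \in ~: A & adj p.1 p.2]].
have -> : cut r A = #|S|.
  rewrite /cut /en -sum1_card.
  rewrite (pair_big (mem A) (mem (~: A)) (fun x y => (r x y : nat))) /=.
  rewrite [LHS]big_mkcond [RHS]big_mkcond /=; apply: eq_bigr => -[x y] _ /=.
  by rewrite !inE /=; case: (x \in A); case: (y \in A); case: (adj x y).
apply: leq_trans (leq_imset_card (fun p => [set p.1; p.2]) S); apply: subset_leq_card.
apply/subsetP => f; rewrite inE => /andP[fe /exists_inP[x xA /exists_inP[y yA /eqP ef]]].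
apply/imsetP; exists (x, y) => //; rewrite inE xA yA /= -edge_in -ef; exact: fe.
Qed.

(** A single vertex has cut 3, so [A] has at least two vertices. The sum of the degrees inside [A]
    is then at least [3 * #|A| - 2], hence at least [2 * #|A|]. *)
Lemma small_cut_circuit A : cgraph VG r -> A != set0 -> cut r A <= 2 -> has_circuit A.
Proof.
move=> cG A0 cA; have eA := en_deg cG (subsetT A).
have [||||c cc sc] := @dense_circ _ r A.
- exact: adj_sym.
- exact: adj_irrefl.
- exact: A0.
- have A2 : 1 < #|A|.
    rewrite ltn_neqAle card_gt0 A0 andbT; apply/negP => /eqP /esym /eqP /cards1P[x eA1].
    have := cutU1 cG (in_setT x) (negbT (in_set0 x)); rewrite setU0 big_set0 -eA1 /cut en0l -/(cut r A).
    by move: cA; clear; lia.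
  by move: eA cA A2; clear; lia.
apply/existsP; exists ([set x in c], cedges c); rewrite circ_circuit //=.
by apply/subsetP => x; rewrite inE => /sc.
Qed.

(** By [small_cut_circuit], both sides of a cut with at most two edges contain a circuit, so such a
    cut would be cyclic. *)
Lemma cec_tec : cgraph VG r -> cyclically_edge_connected G 3 -> tec VG r.
Proof.
move=> cG h X _ X0 XT; rewrite leqNgt ltnS; apply/negP => cX.
have cc : cyclic_cut X.
  rewrite /cyclic_cut small_cut_circuit //=; apply: small_cut_circuit => //.
    by apply: contra XT => /eqP e; rewrite -[X]setCK e setC0.
  by rewrite -setTD (cutC cG (subsetT X)).
move: h; rewrite /cyclically_edge_connected /cyclic_edge_connectivity.
case: pickP => [A0 cA0|/(_ X)]; last by rewrite cc.
case: arg_minnP => // A cA /(_ X cc) le.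
have := cut_sizeE X; rewrite lez_nat; move: le cX; clear; lia.
Qed.

(** All consecutive pairs of the list are edges of [C], so hitting the list puts an edge of [C] into
    the matching. The list is obtained from minimum degree 2 in [C]. *)
Lemma circuit_circ C : circuit C -> exists c,
  [/\ circ r c, cycle [rel u v | [set u; v] \in C.2] c & {subset c <= C.1}].
Proof.
case: C => A F /and3P[/andP[/= sF /forall_inP iF] /forall_inP rF /andP[A0 _]].
pose e : rel G := [rel u v | [set u; v] \in F].
have es : symmetric e by move=> u v; rewrite /e /= setUC.
have er u v : e u v -> adj u v by move=> h; rewrite -edge_in; apply: (subsetP sF).
have ei : irreflexive e by move=> u; apply/negP => /er; rewrite adj_irrefl.
have [x y xA|c cc sc] := min_deg_circ es ei A0.
  have /cards2P[f [g [fg E]]] : #|[set w in F | x \in w]| == 2 by exact: rF x xA.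
  have nb w : w \in [set f; g] -> exists z, [/\ z \in A, e x z & w = [set x; z]].
    rewrite -E inE => /andP[wF xw]; have /edgesP[p [q [pq ew]]] := subsetP sF w wF.
    have wA := subsetP (iF w wF).
    move: (xw); rewrite {1}ew !inE => /orP[]/eqP ex.
      by exists q; rewrite wA ?ew ?set22 // /e /= ex -ew.
    by exists p; rewrite wA ?ew ?set21 // /e /= ex setUC -ew.
  have [z1 [z1A e1 f1]] := nb f (set21 _ _); have [z2 [z2A e2 g1]] := nb g (set22 _ _).
  case: (eqVneq z1 y) => [z1y|]; last by exists z1.
  exists z2; split => //; apply: contraNneq fg => z2y; by rewrite f1 g1 z1y z2y.
exists c; split => //; last by case/and3P: cc.
by case/and3P: cc => h1 h2 h3; apply/and3P; split => //; apply: sub_cycle h2.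
Qed.

Lemma hit_edge (m : G -> G) c (F : {set {set G}}) : circ r c -> cycle [rel u v | [set u; v] \in F] c ->
  hit m c -> exists2 x, x \in c & [set x; m x] \in F.
Proof.
move=> /and3P[uc _ _] cF hm.
have /hasP[x xc /eqP mx] : has (fun x => m x == next c x) c.
  apply: contraR hm => /hasPn h; apply: cycle_from_next => // x xc; exact: h.
by exists x => //; rewrite mx; have := next_cycle cF xc.
Qed.

Lemma pm_perfect (m : G -> G) : pm VG r m ->
  perfect_matching [set [set x; m x] | x : G].
Proof.
move=> hm; have h x := hm x (in_setT x); split.
  by apply/subsetP => f /imsetP[x _ ->]; rewrite edge_in; case: (h x).
move=> x; rewrite /edge_degree (_ : [set _ in _ | _] = [set [set x; m x]]) ?cards1 //.
apply/setP => f; rewrite !inE; apply/andP/eqP => [[/imsetP[y _ ->]]|->].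
  by rewrite !inE => /orP[]/eqP-> //; case: (h y) => _ ->; rewrite setUC.
by rewrite set21; split => //; apply: imset_f.
Qed.

Lemma hamiltonian_hit u v c : cgraph VG r -> tec VG r -> ~ klee G -> adj u v ->
  circ r c -> (forall x, x \in c) -> exists m, [/\ pm VG r m, m u = v & hit m c].
Proof.
move=> cG tG nk uv cc hc.
(* Among finite functions the existence of a suitable matching is decidable. *)
pose P (m : {ffun G -> G}) := [&& [forall x, adj x (m x) && (m (m x) == x)], m u == v & hit m c].
case: (boolP [exists m, P m]) => [/existsP[m /and3P[/forallP h /eqP mu hm]]|nP].
  by exists m; split => // x _; have /andP[-> /eqP->] := h x.
case: nk; apply: (unique_klee cG tG uv) => m m' hm hm' mu mu' x _.
have nh f : pm VG r f -> f u = v -> (f x != next c x) && (f x != prev c x).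
  move=> hf fu; have cf : cycle (off f) c.
    apply: contraNT nP => nc; apply/existsP; exists (finfun f); apply/and3P; split.
    - by apply/forallP => y; rewrite !ffunE; have [-> ->] := hf y (in_setT y); rewrite eqxx.
    - by rewrite ffunE fu.
    - by apply: contra nc; apply: sub_cycle => a b; rewrite /off ffunE.
  have := next_cycle cf (hc x); rewrite /off => -> /=.
  have := prev_cycle cf (hc x); rewrite /off; apply: contra => /eqP e.
  by rewrite -e (hf x (in_setT x)).2.
have [/and3P[uc cy _]] := cc.
have rn := next_cycle cy (hc x); have rp := prev_cycle cy (hc x); rewrite (csym cG) in rp.
have [w [_ E]] := cnbr2 cG rn rp (next_neq_prev cc (hc x)).
have fw f : pm VG r f -> f u = v -> f x = w.
  move=> hf fu; have [rx _] := hf x (in_setT x); have /andP[/negbTE a /negbTE b] := nh f hf fu.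
  by move: rx; rewrite E !inE a b => /eqP.
by rewrite (fw m) // (fw m').
Qed.

End Translate.

Theorem theorem1p6 (G : sgraph) (G_cubic : cubic G)
    (G_cyc3 : cyclically_edge_connected G 3) (G_not_klee : ~ klee G)
    (e : {set G}) (e_edge : e \in edges G)
    (CC : {set {set G} * {set {set G}}})
    (CC_circuit : forall C, C \in CC -> circuit C)
    (CC_disjoint : forall C D, C \in CC -> D \in CC -> C != D ->
       [disjoint C.1 & D.1]) :
  exists M : {set {set G}},
    [/\ perfect_matching M, e \in M &
        forall C, C \in CC -> exists2 f, f \in C.2 & f \in M].
Proof.
have cG := cubic_cgraph G_cubic; have tG := cec_tec cG G_cyc3.
have /edgesP[u [v [uv ->]]] := e_edge.
have /fin_all_exists[c hc] : forall C : {set G} * {set {set G}}, exists c : seq G, C \in CC ->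
    [/\ circ (@adj G) c, cycle [rel x y | [set x; y] \in C.2] c & {subset c <= C.1}].
  move=> C; case: (boolP (C \in CC)) => CCC; last by exists [::].
  by have [c hc] := circuit_circ (CC_circuit C CCC); exists c.
have same C D x : C \in CC -> D \in CC -> x \in c C -> x \in c D -> C = D.
  move=> hC hD xC xD; apply/eqP; apply: contraT => ne.
  have [_ _ sC] := hc C hC; have [_ _ sD] := hc D hD.
  by have /pred0P/(_ x) := CC_disjoint C D hC hD ne; rewrite /= sC // sD.
suff [m [hm mu hit_all]] : exists m, [/\ pm [set: G] (@adj G) m, m u = v &
    forall C, C \in CC -> hit m (c C)].
  exists [set [set x; m x] | x : G]; split; first exact: pm_perfect.
    by apply/imsetP; exists u; rewrite ?mu.
  move=> C hC; have [h1 h2 _] := hc C hC.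
  have [x _ xF] := hit_edge h1 h2 (hit_all C hC).
  by exists [set x; m x] => //; apply: imset_f.
case: (boolP [exists C in CC, [forall x, x \in c C]]) => [/exists_inP[C hC /forallP ham]|nham].
  have [h1 _ _] := hc C hC.
  have [m [hm mu hh]] := hamiltonian_hit cG tG G_not_klee uv h1 ham.
  exists m; split => // D hD; have [/and3P[_ _ sz] _ _] := hc D hD.
  case E : (c D) sz => [|y s] // _.
  by rewrite -E -(same C D y hC hD (ham y)) // E mem_head.
have [||m [hm mu hh]] := tec_hits_all cG tG uv (CC := [seq c C | C <- enum CC]).
- split=> [d /mapP[C]|d d' x /mapP[C hC ->] /mapP[D hD ->] xC xD].
    by rewrite mem_enum => hC ->; case: (hc C hC).
  by rewrite !mem_enum in hC hD; rewrite (same C D x).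
- move=> d /mapP[C]; rewrite mem_enum => hC ->.
  move: nham; rewrite negb_exists_in => /forall_inP/(_ C hC).
  by rewrite negb_forall => /existsP[x nx]; exists x.
by exists m; split => // C hC; apply: hh; apply: map_f; rewrite mem_enum.
Qed.
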